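(* (a) The following 2-component links are pairwise non-isotopic: the Hopf link, the trivial link (with 2 components), the Whitehead link. (b) The Borromean rings link is not isotopic to the trivial link (with 3 components).
   Context: A knot is a closed non-self-intersecting polygonal line in $\mathbb{R}^3$ (non-oriented). A link is an ordered collection of pairwise disjoint knots, called its components. Elementary move: suppose that two sides $AC$ and $CB$ of a triangle $ABC$ are edges of one component of a link and that the link and the (filled, planar) triangle $ABC$ do not intersect at any other points. The elementary move $ACB\to AB$ replaces the two edges $AC$ and $CB$ by the edge $AB$; the inverse operation is also called an elementary move. If $ABC$ is degenerate, an elementary move is either subdivision of an edge or the inverse operation. Two links are isotopic if one is obtained from the other by a finite sequence of elementary moves through links (the order of components being preserved). The trivial link with $m$ components is a link formed by $m$ triangles in parallel planes. The Hopf link is the (polygonal) closure of the 2-strand braid $\sigma_1^2$. The Whitehead link is the closure of the 3-strand braid $\sigma_1\sigma_2^{-1}\sigma_1\sigma_2^{-2}$. The Borromean rings link is the closure of the 3-strand braid $(\sigma_1\sigma_2^{-1})^3$. In each case the components are taken in some fixed order. *)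

(* Defs.v *)
From HB Require Import structures.
From Stdlib Require Import Relation_Operators.
From mathcomp Require Import all_boot all_order all_algebra.
From mathcomp Require Import all_classical reals.
From mathcomp Require Import ring lra.

Set Implicit Arguments.
Unset Strict Implicit.
Unset Printing Implicit Defensive.

Import Order.TTheory GRing.Theory Num.Theory.
Local Open Scope classical_set_scope.
Local Open Scope ring_scope.

(* A closed polygonal line in R^3 is given by its cyclic list of vertices.    *)
Notation polygon R := (seq 'rV[R]_3).

Section Links.
Variable R : realType.
Implicit Types (P Q : polygon R) (A B C : 'rV[R]_3).

Definition segment A B : set 'rV[R]_3 :=
  [set (1 - t) *: A + t *: B | t in [set t : R | 0 <= t <= 1]].

Definition triangle A B C : set 'rV[R]_3 :=
  [set X | exists a b c : R, [/\ 0 <= a, 0 <= b, 0 <= c, a + b + c = 1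
                               & X = a *: A + b *: B + c *: C]].

(* The edges of P join P`_i to P`_(i.+1 %% size P), for i < size P.           *)
Definition edge_point P (i : nat) (t : R) : 'rV[R]_3 :=
  (1 - t) *: P`_i + t *: P`_(i.+1 %% size P).

Definition carrier P : set 'rV[R]_3 :=
  [set X | exists i t, [/\ (i < size P)%N, 0 <= t < 1 & X = edge_point P i t]].

(* "Non-self-intersecting": the closed line, parametrised by its half-open    *)
(* edges, runs through each of its points exactly once.                       *)
Definition is_knot P : Prop :=
  (2 < size P)%N /\
  forall i j t u, (i < size P)%N -> (j < size P)%N ->
    0 <= t < 1 -> 0 <= u < 1 ->
    edge_point P i t = edge_point P j u -> i = j /\ t = u.

Definition is_link m (L : m.-tuple (polygon R)) : Prop :=
  (forall i, is_knot (tnth L i)) /\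
  (forall i j, i != j -> carrier (tnth L i) `&` carrier (tnth L j) = set0).

Record link m := Link {
  components :> m.-tuple (polygon R);
  componentsP : is_link components }.

(* Knots are non-oriented and have no base point, so that vertex lists count  *)
(* only up to rotation and reversal.                                          *)
Definition same_polygon P Q : Prop :=
  exists k : nat, Q = rot k P \/ Q = rot k (rev P).

(* The move ACB -> AB on one component of L, yielding L'.                     *)
Definition elementary_reduction m (L L' : link m) : Prop :=
  exists (i : 'I_m) A C B (s : polygon R),
    [/\ same_polygon (tnth L i) [:: A, C, B & s],
        same_polygon (tnth L' i) [:: A, B & s],
        forall j, j != i -> same_polygon (tnth L j) (tnth L' j)
      & if free [:: C - A; B - A] then
          forall j, carrier (tnth L j) `&` triangle A C B `<=`
                    segment A C `|` segment C B
        else exists2 t : R, 0 < t < 1 & C = (1 - t) *: A + t *: B].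

(* The symmetric closure adds the inverse moves. Each intermediate stage is a *)
(* [link m]; relabelling vertices of a component is itself an isotopy, being  *)
(* a subdivision of an edge followed by the inverse move.                     *)
Definition isotopic m : link m -> link m -> Prop :=
  clos_refl_sym_trans (link m) (@elementary_reduction m).

Definition is_trivial_link m (L : link m) : Prop :=
  (forall i, size (tnth L i) = 3%N) /\
  exists2 n : 'rV[R]_3, n != 0 &
  exists2 c : 'I_m -> R, injective c &
    forall i X, X \in tnth L i -> \sum_k n 0 k * X 0 k = c i.

End Links.

(* Braids on strands 1, ..., n: the letter (i, true) stands for sigma_i and   *)
(* (i, false) for its inverse.                                                *)
Notation braid_word := (seq (nat * bool)).
Notation sigma i := (i%N, true).
Notation sigmaV i := (i%N, false).

Notation lattice_point := (int * int * int)%type.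

Definition lattice_vec (R : realType) (v : lattice_point) : 'rV[R]_3 :=
  \row_k ([:: v.1.1; v.1.2; v.2]`_k)%:~R.

Definition next_pos (j : nat) (a : nat * bool) : nat :=
  if j == a.1 then a.1.+1 else if j == a.1.+1 then a.1 else j.

Definition end_pos (w : braid_word) (j : nat) : nat := foldl next_pos j w.

(* The braid runs upwards in the y direction: the k-th letter (from k = 0)    *)
(* fills the layer 2k <= y <= 2k+2, where position j is at x = 2j, z = 0.     *)
(* The two strands crossing at sigma_i pass over (2i+1, 2k+1) at height z = 1 *)
(* (the one going from i to i+1) and z = -1; for the inverse of sigma_i these *)
(* heights are exchanged.                                                     *)
(* [strand k w j] lists the vertices, the last one excepted, of the strand of *)
(* w that starts at position j, when the first letter of w has index k.       *)
Fixpoint strand (k : nat) (w : braid_word) (j : nat) : seq lattice_point :=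
  if w is a :: w' then
    let h : int := if a.2 then 1 else -1 in
    let mid (z : int) : lattice_point := ((a.1.*2.+1)%:Z, (k.*2.+1)%:Z, z) in
    ((j.*2)%:Z, (k.*2)%:Z, 0)
      :: (if j == a.1 then [:: mid h]
          else if j == a.1.+1 then [:: mid (- h)] else [::])
      ++ strand k.+1 w' (next_pos j a)
  else [::].

(* The closing arcs, joining the top of position j to its bottom, are nested  *)
(* rectangular lines in the plane z = 0 around the right hand side of the     *)
(* braid; l is the number of letters.                                         *)
Definition closing_arc (n l j : nat) : seq lattice_point :=
  let d := (n.+1 - j)%N in
  let right := ((n.*2 + d)%N)%:Z in let top := ((l.*2 + d)%N)%:Z in
  [:: ((j.*2)%:Z, (l.*2)%:Z, 0); ((j.*2)%:Z, top, 0);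
      (right, top, 0); (right, - d%:Z, 0); ((j.*2)%:Z, - d%:Z, 0)].

(* The cycle of j under the permutation induced by w, in cyclic order: n      *)
(* iterations cover it and [undup] keeps the last occurrence of each position.*)
Definition braid_cycle n (w : braid_word) (j : nat) : seq nat :=
  undup (traject (end_pos w) j n).

(* One polygon per cycle of the induced permutation; a cycle is represented   *)
(* by its least element.                                                      *)
Definition braid_closure n (w : braid_word) : seq (seq lattice_point) :=
  [seq flatten [seq strand 0 w j ++ closing_arc n (size w) (end_pos w j)
               | j <- braid_cycle n w i]
  | i <- iota 1 n & all (leq i) (braid_cycle n w i)].

(* The components may come in any order.                                      *)
Definition is_closure_of R m n (w : braid_word) (L : link R m) : Prop :=
  perm_eq L [seq map (lattice_vec R) P | P <- braid_closure n w].

Definition is_hopf_link R (L : link R 2) : Prop :=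
  is_closure_of 2 [:: sigma 1; sigma 1] L.

Definition is_whitehead_link R (L : link R 2) : Prop :=
  is_closure_of 3 [:: sigma 1; sigmaV 2; sigma 1; sigmaV 2; sigmaV 2] L.

Definition is_borromean_link R (L : link R 3) : Prop :=
  is_closure_of 3
    [:: sigma 1; sigmaV 2; sigma 1; sigmaV 2; sigma 1; sigmaV 2] L.

(* The above vertex lists do define links: their half-open edges are pairwise *)
(* separated by planes with small integer coefficients.                       *)
Section WellFormed.
Implicit Types (f v : lattice_point) (e : lattice_point * lattice_point).
Implicit Types (P Q : seq lattice_point).

Let lform f v : int := f.1.1 * v.1.1 + f.1.2 * v.1.2 + f.2 * v.2.

Let forms : seq lattice_point :=
  let s : seq int := [:: 0; 1; -1; 2; -2] in
  [seq (x, z) | x <- [seq (x, y) | x <- s, y <- s], z <- s].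

Let sep_by f e e' :=
  [&& lform f e.1 < lform f e'.1, lform f e.1 < lform f e'.2,
      lform f e.2 <= lform f e'.1 & lform f e.2 <= lform f e'.2].

Let sep e e' := has (fun f => sep_by f e e' || sep_by f e' e) forms.

Let lattice_edges P :=
  mkseq (fun i => (nth (0, 0, 0) P i, nth (0, 0, 0) P (i.+1 %% size P)))
        (size P).

Definition lattice_link (s : seq (seq lattice_point)) : bool :=
  all (fun P => [&& (2 < size P)%N, all (fun e => e.1 != e.2) (lattice_edges P)
                  & pairwise sep (lattice_edges P)]) s
  && pairwise (fun P Q => allrel sep (lattice_edges P) (lattice_edges Q)) s.

Variable R : realType.

Local Notation vec := (lattice_vec R).

Let rform f (X : 'rV[R]_3) : R :=
  f.1.1%:~R * X 0 0 + f.1.2%:~R * X 0 1 + f.2%:~R * X 0 (inord 2).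

Let rform_vec f v : rform f (vec v) = (lform f v)%:~R.
Proof. by rewrite /rform /lform !mxE /= inordK // !rmorphD /= !rmorphM. Qed.

Let rform_conv f t X Y :
  rform f ((1 - t) *: X + t *: Y) = (1 - t) * rform f X + t * rform f Y.
Proof. by rewrite /rform !mxE; ring. Qed.

Let epoint e (t : R) := (1 - t) *: vec e.1 + t *: vec e.2.

Let sep_by_neq f e e' t u : sep_by f e e' -> 0 <= t < 1 -> 0 <= u < 1 ->
  epoint e t <> epoint e' u.
Proof.
move=> /and4P[h1 h2 h3 h4] /andP[t0 t1] /andP[u0 u1] /(congr1 (rform f)).
rewrite /epoint !rform_conv !rform_vec.
move: h1 h2 h3 h4; rewrite -!(ltr_int R) -!(ler_int R).
set a := (lform f e.1)%:~R; set b := (lform f e.2)%:~R.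
set c := (lform f e'.1)%:~R; set d := (lform f e'.2)%:~R => ac ad bc bd.
case: (lerP c d) => cd; nra.
Qed.

Let sep_neq e e' t u : sep e e' -> 0 <= t < 1 -> 0 <= u < 1 ->
  epoint e t <> epoint e' u.
Proof.
move=> /hasP[f _ /orP[h|h]] ht hu; first exact: (sep_by_neq h).
by move=> /esym; apply: (sep_by_neq h).
Qed.

Let vec_inj : injective vec.
Proof.
move=> [[x y] z] [[x' y'] z'] /rowP h.
have := h 0; have := h 1; have := h (inord 2).
by rewrite !mxE /= inordK //= => /intr_inj -> /intr_inj -> /intr_inj ->.
Qed.

Let size_edges P : size (lattice_edges P) = size P.
Proof. exact: size_mkseq. Qed.

Let edge_pointE P i t : (i < size P)%N ->
  edge_point (map vec P) i t = epoint (nth (0, 0) (lattice_edges P) i) t.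
Proof.
move=> hi; have hS : (i.+1 %% size P < size P)%N.
  by rewrite ltn_mod; case: P hi.
by rewrite /edge_point /epoint nth_mkseq //= size_map !(nth_map (0, 0, 0)).
Qed.

Lemma lattice_linkP m (s : seq (seq lattice_point)) :
  lattice_link s -> size s = m ->
  exists L : link R m, L = [seq map vec P | P <- s] :> seq _.
Proof.
move=> /andP[/allP knots disj] sz.
have szE : size [seq map vec P | P <- s] == m by rewrite size_map sz.
suff lk : is_link (Tuple szE) by exists (Link lk).
have tE (i : 'I_m) : tnth (Tuple szE) i = map vec (nth [::] s i).
  by rewrite (tnth_nth [::]) (nth_map [::]) // sz.
have ins (i : 'I_m) : nth [::] s i \in s by rewrite mem_nth ?sz.
split=> [i|i j ij].
  rewrite tE; have /and3P[s2 ne pw] := knots _ (ins i).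
  split; first by rewrite size_map.
  set P := nth _ _ _ in s2 ne pw *.
  have aux a b t u : (a < b)%N -> (b < size P)%N -> 0 <= t < 1 -> 0 <= u < 1 ->
      edge_point (map vec P) a t <> edge_point (map vec P) b u.
    move=> ab hb ht hu; rewrite !edge_pointE ?(ltn_trans ab) //.
    apply: sep_neq => //; move/(pairwiseP (0, 0)): pw; apply => //.
    - by rewrite inE /= size_edges (ltn_trans ab).
    - by rewrite inE /= size_edges.
  rewrite size_map => a b t u ha hb ht hu eq_ab.
  case: (ltngtP a b) => [ab|ab|ab]; [by case: (aux _ _ t u ab) | |].
    by case: (aux _ _ u t ab).
  split=> //; move: eq_ab; rewrite -ab !edge_pointE //.
  have /allP/(_ (nth (0, 0) (lattice_edges P) a)) := ne.
  rewrite mem_nth ?size_edges // => /(_ isT).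
  case: (nth _ _ _) => v w /= vw /rowP eq_tu; rewrite /epoint /= in eq_tu.
  have /rV0Pn[k] : vec w - vec v != 0.
    by rewrite subr_eq0 eq_sym (inj_eq vec_inj).
  have := eq_tu k; rewrite !mxE; set x := _%:~R; set y := _%:~R => e xy.
  have : (t - u) * (y - x) = 0 by move: e; lra.
  by move/eqP; rewrite mulf_eq0 (negPf xy) orbF subr_eq0 => /eqP.
wlog ij' : i j {ij} / (i < j)%N.
  move=> W; case: (ltngtP i j) => [/W //|/W|/val_inj e]; first by rewrite setIC.
  by rewrite e eqxx in ij.
rewrite !tE; apply/seteqP; split=> // X [[a [t [ha ht ->]]] [b [u [hb hu]]]].
rewrite !size_map in ha hb; rewrite !edge_pointE //; apply: sep_neq => //.
have /(pairwiseP [::])/(_ i j) := disj.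
rewrite !inE !sz !ltn_ord => /(_ isT isT ij') /allrelP; apply.
  by rewrite mem_nth ?size_edges.
by rewrite mem_nth ?size_edges.
Qed.

Let closure_exists m n (w : braid_word) :
  lattice_link (braid_closure n w) -> size (braid_closure n w) = m ->
  exists L : link R m, is_closure_of n w L.
Proof.
by move=> h1 h2; have [L LE] := lattice_linkP h1 h2; exists L; rewrite /is_closure_of LE.
Qed.

Lemma trivial_link_exists m : (m < 4)%N ->
  exists L : link R m, is_trivial_link L.
Proof.
move=> m4; pose T k : seq lattice_point :=
  [:: (0, 0, Posz k); (1, 0, Posz k); (0, 1, Posz k)].
have [||L LE] := @lattice_linkP m (mkseq T m); last 1 first.
- exists L; have LT i : tnth L i = map vec (T i).
    by rewrite (tnth_nth [::]) LE (nth_map [::]) ?size_mkseq // nth_mkseq.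
  split=> [i|]; first by rewrite LT.
  exists (vec (0, 0, 1)); first by apply/rV0Pn; exists (inord 2); rewrite mxE inordK //= oner_neq0.
  exists (fun i => (nat_of_ord i)%:R).
    by move=> i j /eqP; rewrite eqr_nat => /eqP/val_inj.
  move=> i X; rewrite LT !inE => /or3P[] /eqP ->;
  by rewrite !big_ord_recl big_ord0 !mxE /=; ring.
- by case: m m4 => [|[|[|[|//]]]] _; vm_compute.
- by rewrite size_mkseq.
Qed.

Lemma hopf_link_exists : exists L : link R 2, is_hopf_link L.
Proof. by apply: closure_exists; vm_compute. Qed.

Lemma whitehead_link_exists : exists L : link R 2, is_whitehead_link L.
Proof. by apply: closure_exists; vm_compute. Qed.

Lemma borromean_link_exists : exists L : link R 3, is_borromean_link L.
Proof. by apply: closure_exists; vm_compute. Qed.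

End WellFormed.

(* Main.v *)
From HB Require Import structures.
From Stdlib Require Import ZArith Relation_Operators.
Require Import Defs.
From mathcomp Require Import all_boot all_order all_algebra.
From mathcomp Require Import all_classical reals topology normedtype derive.
From mathcomp Require Import ring lra zify ssrZ.

(** An elementary move is induced by a homeomorphism of the space, so that
    isotopic links have homeomorphic complements, componentwise. We compare
    the local systems on these complements with values in the infinite
    dihedral group, the isometries x |-> c + x and x |-> c - x of the integers.

    A link is colorable when there is such a system for which the meridians of
    each component i are reflections x |-> c - x with c of a parity f i
    depending on i only, f being non-constant. The trivial link is colorable:
    let the system jump by x |-> i - x across one side of the plane of the i-th
    triangle. For the closures of braids, the Dehn relations between the
    holonomies through the regions of the diagram imply that f is constant;
    the required triangles and their disjointness from the link are checked on
    integer separating planes.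

    The Hopf link and the Whitehead link are distinguished by the linking number
    modulo 2, the monodromy along one component of a local system off the
    other one. It vanishes for the Whitehead link, where each component is the
    boundary modulo 2 of triangles that miss the other component. *)

Set Implicit Arguments.
Unset Strict Implicit.
Unset Printing Implicit Defensive.

Import Order.TTheory GRing.Theory Num.Theory.
Import numFieldNormedType.Exports.
Local Open Scope classical_set_scope.
Local Open Scope ring_scope.

(** * Local systems and parallel transport *)

(** Meridians are homotopy classes of loops, while a homeomorphism transports local data. The
    conditions on them are therefore local: [ramified] says that a Z/2-valued character of the
    system has no section on any neighborhood of a point minus the link. Nontriviality of
    [is_reflection] and [parity (f i)] together says that the meridian is a reflection with c of
    parity f i. Conjugation changes c by an even number, up to sign, so that this parity belongs to
    the component and not to the choice of a meridian.

    The translation parts of the holonomies through the regions form an integral Dehn coloring of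
    the diagram. The determinants 2, 8 and 16 of the Hopf, Whitehead and Borromean links being
    nonzero, the associated Fox coloring is constant, hence so is f. Residues modulo 2 alone would
    not see this.

    All homotopies are reduced to two kinds of triangles: those that miss the link, across which
    holonomies compose, and those pierced once, whose boundary is a meridian. Both kinds can be
    tested by integer arithmetic. *)

(* [lra] and [nra] are slow in the presence of quantified hypotheses. *)
Ltac clear_products := repeat match goal with H : forall _, _ |- _ => clear H end.
Ltac slra := clear_products; lra.
Ltac snra := clear_products; nra.


(** Compactness of the unit interval as real induction: the supremum of the x with Q 0 x cannot lie
    below 1, because the local hypothesis carries Q past it. *)
Lemma unit_interval_ind (R : realType) (Q : R -> R -> Prop) :
  (forall x, 0 <= x <= 1 -> exists2 e, 0 < e & forall a b,
     0 <= a -> b <= 1 -> x - e < a -> a <= x -> x <= b -> b < x + e -> Q a b) ->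
  (forall a b c, 0 <= a -> a <= b -> b <= c -> c <= 1 ->
     Q a b -> Q b c -> Q a c) ->
  Q 0 1.
Proof.
move=> loc glue; pose S := [set x : R | 0 <= x <= 1 /\ Q 0 x].
have S0 : S 0.
  split; first by rewrite lexx ler01.
  have [|e e0 H] := loc 0; first by rewrite lexx ler01.
  by apply: H; rewrite ?lexx ?ler01 //; slra.
have Sub : has_sup S.
  by split; [exists 0|exists 1 => x [/andP[]]].
have s0 : 0 <= sup S by apply: ub_le_sup; case: Sub.
have s1 : sup S <= 1 by apply: ge_sup; [case: Sub|move=> x [/andP[]]].
have [|e e0 H] := loc (sup S); first by rewrite s0 s1.
have [x [/andP[x0 x1] Qx] sx] := sup_adherent e0 Sub.
have xs : x <= sup S by apply: ub_le_sup; case: Sub => // _ _; split=> //; rewrite x0 x1.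
pose b := Num.min 1 (sup S + e / 2).
have sb : sup S <= b by rewrite /b le_min s1 /=; slra.
have b1 : b <= 1 by rewrite /b ge_min lexx.
have bse : b < sup S + e by rewrite /b gt_min; apply/orP; right; slra.
have Qb : Q 0 b by apply: glue Qx (H x b _ _ _ _ _ _) => //; slra.
have : b <= sup S.
  by apply: ub_le_sup; [case: Sub | split=> //; apply/andP; split=> //; slra].
rewrite /b ge_min => /orP[h|h]; last by slra.
by have <- : b = 1 by rewrite /b; apply: min_l; slra.
Qed.

Lemma unit_interval_const (R : realType) (S : Type) (f : R -> S) :
  (forall x : R, 0 <= x <= 1 -> exists2 U, nbhs x U &
     forall y, U y -> 0 <= y <= 1 -> f y = f x) -> f 0 = f 1.
Proof.
move=> loc; apply: (@unit_interval_ind R (fun a b => f a = f b)) => [x x01|a b c _ _ _ _ -> //].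
have [U /nbhs_ballP[e e0 eU] fU] := loc x x01; exists e => // a b *.
have ballE y : ball x e y = (`|x - y| < e) by [].
rewrite (fU a) 1?(fU b) //; try (apply: eU; rewrite ballE ltr_norml); slra.
Qed.

Section Sections.
Variables (G : groupType).
Local Open Scope group_scope.

(* A [G]-local system is encoded by the transition elements [T y z] between   *)
(* points [y] and [z]; only their values for close points are meaningful.     *)
Definition flat_at (M : topologicalType) (T : M -> M -> G) (x : M) :=
  exists2 U, nbhs x U &
    forall y z w, U y -> U z -> U w -> T y z * T z w = T y w.

(** A trivialization over [D]: the transitions become the coboundary of [s]. As [D] need not be
    open, this also covers systems restricted to curves. *)
Definition section_on (M : topologicalType) (T : M -> M -> G) (D : set M)
    (s : M -> G) :=
  forall x, D x -> exists2 U, nbhs x U &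
    forall y z, U y -> D y -> U z -> D z -> s z = s y * T y z.

Lemma flat_at_comp (M N : topologicalType) (T : M -> M -> G) (f : N -> M) x :
  {for x, continuous f} -> flat_at T (f x) ->
  flat_at (fun y z => T (f y) (f z)) x.
Proof. by move=> fx [U Ux TU]; exists (f @^-1` U) => [|y z w]; [exact: fx|exact: TU]. Qed.

Lemma section_on_comp (M N : topologicalType) (T : M -> M -> G) (f : N -> M)
    (D : set M) s : continuous f -> section_on T D s ->
  section_on (fun y z => T (f y) (f z)) (f @^-1` D) (s \o f).
Proof.
move=> fc sD x Dx; have [U Ux TU] := sD _ Dx.
by exists (f @^-1` U) => [|y z]; [exact: fc|exact: TU].
Qed.

Lemma section_onS (M : topologicalType) (T : M -> M -> G) (D E : set M) s :
  E `<=` D -> section_on T D s -> section_on T E s.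
Proof.
move=> ED sD x /ED /sD[U Ux TU]; exists U => // y z Uy /ED Dy Uz /ED; exact: TU.
Qed.

Lemma section_on_mull (M : topologicalType) (T : M -> M -> G) (D : set M) s g :
  section_on T D s -> section_on T D (fun x => g * s x).
Proof.
move=> sD x /sD[U Ux TU]; exists U => // y z Uy Dy Uz Dz.
by rewrite (TU y z) // mulgA.
Qed.

Lemma flat_at1 (M : topologicalType) (T : M -> M -> G) x :
  flat_at T x -> T x x = 1.
Proof.
move=> [U Ux TU]; have xU := nbhs_singleton Ux.
by apply: (mulgI (T x x)); rewrite TU // mulg1.
Qed.

(** At a common point x both sections are s1 x * T x w nearby, so by flatness a transition between a
    point of [D] and one of [E] can be computed through x. At other points closedness provides a
    neighborhood that misses the other set. *)
Lemma section_onU (M : topologicalType) (T : M -> M -> G) (D E : set M) s1 s2 :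
  closed D -> closed E -> (forall x, D x \/ E x -> flat_at T x) ->
  section_on T D s1 -> section_on T E s2 ->
  (forall x, D x -> E x -> s1 x = s2 x) ->
  section_on T (D `|` E) (fun x => if `[< D x >] then s1 x else s2 x).
Proof.
move=> cD cE fl sD sE s12 x DEx.
have sEx y : E y -> (if `[< D y >] then s1 y else s2 y) = s2 y.
  by move=> Ey; case: asboolP => // Dy; exact: s12.
have sDx y : D y -> (if `[< D y >] then s1 y else s2 y) = s1 y.
  by move=> Dy; case: asboolP.
have [U Ux TU] := fl x DEx.
have [Dx|nDx] := pselect (D x); last first.
  have Ex : E x by case: DEx.
  have [V Vx TV] := sE x Ex.
  exists (V `&` ~` D) => [|y z [Vy nDy] Dy [Vz nDz] Dz].
    by apply: filterI => //; apply: open_nbhs_nbhs; split=> //; exact: closed_openC.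
  case: Dy Dz => [//|Ey] [//|Ez]; rewrite !sEx //; exact: TV.
have [V Vx TV] := sD x Dx.
have [Ex|nEx] := pselect (E x); last first.
  exists (V `&` ~` E) => [|y z [Vy nDy] Dy [Vz nDz] Dz].
    by apply: filterI => //; apply: open_nbhs_nbhs; split=> //; exact: closed_openC.
  case: Dy Dz => [Ey|//] [Ez|//]; rewrite !sDx //; exact: TV.
have [W Wx TW] := sE x Ex.
exists (U `&` V `&` W) => [|y z [[Uy Vy] Wy] DEy [[Uz Vz] Wz] DEz].
  by do 2?apply: filterI.
have xU := nbhs_singleton Ux.
have key w : U w -> V w -> W w -> (D `|` E) w ->
    (if `[< D w >] then s1 w else s2 w) = s1 x * T x w.
  move=> Uw Vw Ww [Dw|Ew].
    by rewrite sDx // (TV x w) //; exact: nbhs_singleton.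
  by rewrite sEx // s12 // (TW x w) //; exact: nbhs_singleton.
by rewrite !key // -mulgA TU.
Qed.

(** The quotient of two sections is locally constant, which makes sections over a path unique up to
    a left factor. *)
Lemma section_on_quot (M : topologicalType) (T : M -> M -> G) (D : set M) s s' x :
  section_on T D s -> section_on T D s' -> D x ->
  exists2 U, nbhs x U & forall y, U y -> D y -> s y * (s' y)^-1 = s x * (s' x)^-1.
Proof.
move=> sD sD' Dx; have [U Ux TU] := sD _ Dx; have [V Vx TV] := sD' _ Dx.
exists (U `&` V) => [|y [Uy Vy] Dy]; first exact: filterI.
have xU := nbhs_singleton Ux; have xV := nbhs_singleton Vx.
by rewrite (TU x y) // (TV x y) // invgM mulgA mulgK.
Qed.

End Sections.

(** * Flat systems on a square are trivial *)

Section Square.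
Variables (R : realType) (G : groupType).

Definition rect (a b c d : R) : set (R * R) :=
  [set p | (a <= p.1 <= b) && (c <= p.2 <= d)].

Lemma closed_rect a b c d : closed (rect a b c d).
Proof.
have -> : rect a b c d = (fst @^-1` [set x | a <= x]) `&` (fst @^-1` [set x | x <= b])
   `&` (snd @^-1` [set x | c <= x]) `&` (snd @^-1` [set x | x <= d]).
  apply/seteqP; split=> p; rewrite /rect /=; last by slra.
  by move=> h; split; [split; [split|]|]; slra.
have cf : continuous (fst : R * R -> R) by move=> p; exact: cvg_fst.
have cs : continuous (snd : R * R -> R) by move=> p; exact: cvg_snd.
do 3?apply: closedI; apply: closed_comp; try by move=> *; (apply: cf || apply: cs).
- exact: closed_ge.
- exact: closed_le.
- exact: closed_ge.
- exact: closed_le.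
Qed.

Lemma continuous_pair (M N N' : topologicalType) (f : M -> N) (g : M -> N') :
  continuous f -> continuous g -> continuous (fun x => (f x, g x)).
Proof.
by move=> cf cg x; apply: (@cvg_pair _ _ _ _ (nbhs (f x)) (nbhs (g x)));
  [exact: cf|exact: cg].
Qed.

Lemma interpolation_continuous (a b : R) :
  continuous (fun x : R => (1 - x) * a + x * b).
Proof.
move=> x; apply: cvgD; apply: cvgMl; [|exact: cvg_id].
by apply: cvgB; [exact: cvg_cst|exact: cvg_id].
Qed.

Section Glue.
Variable T : R * R -> R * R -> G.

(* The quotient of two sections on adjacent rectangles is constant along the  *)
(* common side, so that a translate of one of them extends the other.         *)
Lemma glue_sections (D E : set (R * R)) (i : R -> R * R) s1 s2 :
  closed D -> closed E -> (forall x, D x \/ E x -> flat_at T x) ->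
  continuous i -> (forall t : R, (0 <= t <= 1) -> (D `&` E) (i t)) ->
  (forall p, (D `&` E) p -> exists2 t : R, (0 <= t <= 1) & p = i t) ->
  section_on T D s1 -> section_on T E s2 ->
  exists s, section_on T (D `|` E) s.
Proof.
move=> cD cE fl ci iDE DEi sD sE.
pose q p := (s1 p * (s2 p)^-1)%g.
have qc (t u : R) : (0 <= t <= 1) -> (0 <= u <= 1) -> q (i t) = q (i u).
  move=> t01 u01.
  pose j (x : R) := ((1 - x) * t + x * u).
  have j01 (x : R) : (0 <= x <= 1) -> (0 <= j x <= 1).
    by move: t01 u01; rewrite /j; snra.
  have cj : continuous j by exact: interpolation_continuous.
  have -> : t = j 0 by rewrite /j; ring.
  have -> : u = j 1 by rewrite /j; ring.
  apply: (@unit_interval_const R G (fun x => q (i (j x)))) => x x01.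
  have sDE1 : section_on T (D `&` E) s1 by apply: section_onS sD => p [].
  have sDE2 : section_on T (D `&` E) s2 by apply: section_onS sE => p [].
  have DEx := iDE _ (j01 _ x01).
  have [U Ux qU] := section_on_quot sDE1 sDE2 DEx.
  exists ((i \o j) @^-1` U) => [|y Uy y01].
    by apply: (continuous_comp (cj x) (ci (j x))).
  exact: (qU _ Uy (iDE _ (j01 _ y01))).
have z01 : 0 <= (0 : R) <= 1 by rewrite lexx ler01.
exists (fun p => (if `[< D p >] then s1 p else q (i 0) * s2 p)%g).
apply: section_onU => //; first exact: section_on_mull.
move=> p Dp Ep; have [t t01 pE] := DEi p (conj Dp Ep).
by rewrite (qc 0 t) // -pE /q mulgVK.
Qed.

End Glue.

(** Two nested real inductions: sections over small rectangles are glued vertically into thin strips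
    of full height, and these are glued horizontally. *)
Lemma square_section (T : R * R -> R * R -> G) :
  (forall p, rect 0 1 0 1 p -> flat_at T p) ->
  exists s, section_on T (rect 0 1 0 1) s.
Proof.
move=> fl.
pose good a b c d := exists s, section_on T (rect a b c d) s.
have flr a b c d p : 0 <= a -> b <= 1 -> 0 <= c -> d <= 1 -> rect a b c d p -> flat_at T p.
  by move=> a0 b1 c0 d1; rewrite /rect /= => h; apply: fl; rewrite /rect /=; slra.
have glue2 a b c d e : 0 <= a -> a <= b -> b <= 1 -> 0 <= c -> c <= d -> d <= e -> e <= 1 ->
    good a b c d -> good a b d e -> good a b c e.
  move=> a0 ab b1 c0 cd de e1 [s1 h1] [s2 h2]; rewrite /good.
  have -> : rect a b c e = rect a b c d `|` rect a b d e.
    apply/seteqP; split=> p /=; rewrite /rect /=; last by case; slra.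
    by case: (leP p.2 d) => h H; [left|right]; slra.
  apply: (@glue_sections T _ _ (fun t => ((1 - t) * a + t * b, d)) s1 s2) => //;
    try exact: closed_rect.
  - by move=> p [|]; apply: flr => //; slra.
  - apply: continuous_pair; first exact: interpolation_continuous.
    by move=> x; exact: cvg_cst.
  - by move=> t t01; split; rewrite /rect /=; snra.
  - move=> [x y]; rewrite /rect /= => -[/= h1' h2'].
    have -> : y = d by slra.
    have [ab'|ab'] := eqVneq a b.
      by exists 0; [slra|congr (_, _); slra].
    have ba : 0 < b - a by rewrite subr_gt0 lt_neqAle ab' ab.
    exists ((x - a) / (b - a)).
      by rewrite divr_ge0 ?ler_pdivrMr //=; slra.
    congr (_, _); field; slra.
have glue1 a b c : 0 <= a -> a <= b -> b <= c -> c <= 1 ->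
    good a b 0 1 -> good b c 0 1 -> good a c 0 1.
  move=> a0 ab bc c1 [s1 h1] [s2 h2]; rewrite /good.
  have -> : rect a c 0 1 = rect a b 0 1 `|` rect b c 0 1.
    apply/seteqP; split=> p /=; rewrite /rect /=; last by case; slra.
    by case: (leP p.1 b) => h H; [left|right]; slra.
  apply: (@glue_sections T _ _ (fun t => (b, t)) s1 s2) => //;
    try exact: closed_rect.
  - by move=> p [|]; apply: flr => //; slra.
  - by apply: continuous_pair => x; [exact: cvg_cst|exact: cvg_id].
  - by move=> t t01; split; rewrite /rect /=; slra.
  - move=> [x y]; rewrite /rect /= => -[/= h1' h2'].
    by exists y; [slra|congr (_, _); slra].
apply: (@unit_interval_ind R (fun a b => good a b 0 1)) => // t t01.
(* The width of the strip around t has to be the same at all heights, so it is quantified inside the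
   induction predicate; gluing takes the smaller of the two widths. *)
pose Q c d := exists2 e, 0 < e & forall a b, 0 <= a -> b <= 1 -> a <= b ->
  t - e < a -> b < t + e -> good a b c d.
suff [e e0 He] : Q 0 1 by exists e => // a b *; apply: He => //; slra.
apply: (@unit_interval_ind R Q) => [u u01|c d e c0 cd de e1 [e2 e20 h2] [e3 e30 h3]].
  have [|U + TU] := fl (t, u); first by rewrite /rect /=; slra.
  rewrite nbhsE => -[B [oB Btu] BU].
  have /nbhs_ballP[e /= e0 eB] := open_nbhs_nbhs (conj oB Btu).
  exists e => // c d c0 d1 uc cu ud du; exists e => // a b a0 b1 ab ta bt.
  have inB p : rect a b c d p -> B p.
    rewrite /rect /= => h; apply: eB.
    have hb : `|t - p.1| < e /\ `|u - p.2| < e by rewrite !ltr_norml; split; slra.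
    exact: hb.
  (* Inside one flat neighborhood the transition from a fixed corner is a section. *)
  exists (T (a, c)) => p pr; exists B => [|y z By _ Bz _].
    by apply: open_nbhs_nbhs; split=> //; exact: inB.
  by rewrite TU //; apply: BU => //; apply: inB; rewrite /rect /=; slra.
exists (Num.min e2 e3) => [|a b a0 b1 ab ta bt].
  by rewrite lt_min e20.
have := ge_min e2 e2 e3; have := ge_min e3 e2 e3; rewrite !lexx !orbT /= => m3 m2.
by apply: (glue2 _ _ _ d) => //; [apply: h2|apply: h3]; slra.
Qed.
End Square.

Section Coordinates.
Variables (R : realType).
Local Notation V := 'rV[R]_3.

Lemma coordB (x y : V) k : (x - y) 0 k = x 0 k - y 0 k.
Proof. by rewrite !mxE. Qed.
Lemma coordD (x y : V) k : (x + y) 0 k = x 0 k + y 0 k.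
Proof. by rewrite !mxE. Qed.
Lemma coordZ (x : V) t k : (t *: x) 0 k = t * x 0 k.
Proof. by rewrite !mxE. Qed.
Definition coordE := (coordB, coordD, coordZ).

End Coordinates.

(** * Holonomy along segments and around triangles *)

Section Transport.
Variables (R : realType) (G : groupType).
Local Notation V := 'rV[R]_3.
Implicit Types (A B C X Y Z : V).

Definition line A B (t : R) : V := (1 - t) *: A + t *: B.

Lemma line0 A B : line A B 0 = A.
Proof. by rewrite /line subr0 scale1r scale0r addr0. Qed.

Lemma line1 A B : line A B 1 = B.
Proof. by rewrite /line subrr scale1r scale0r add0r. Qed.

Lemma line_id A t : line A A t = A.
Proof. by rewrite /line -scalerDl subrK scale1r. Qed.

Lemma segmentP A B (t : R) : 0 <= t <= 1 -> segment A B (line A B t).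
Proof. by move=> t01; exists t. Qed.

Lemma line_continuous A B : continuous (line A B).
Proof.
move=> t; apply: cvgD; apply: cvgZr_tmp; [|exact: cvg_id].
by apply: cvgB; [exact: cvg_cst|exact: cvg_id].
Qed.

Lemma ball_line X e A B (t : R) : ball X e A -> ball X e B -> 0 <= t <= 1 ->
  ball X e (line A B t).
Proof.
rewrite -!ball_normE /= => XA XB t01.
have -> : X - line A B t = (1 - t) *: (X - A) + t *: (X - B).
  by rewrite /line; apply/rowP => i; rewrite !coordE; ring.
apply: le_lt_trans (ler_normD _ _) _; rewrite !normrZ.
rewrite !ger0_norm; [|lra|lra].
case: (ltrP `|X - A| `|X - B|) => h; nra.
Qed.

Section Flat.
Variables (K : set V) (T : V -> V -> G).
Hypothesis Tflat : forall X, ~ K X -> flat_at T X.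

Let path_section A B (s : R -> G) :=
  section_on (fun t u => T (line A B t) (line A B u)) [set t : R | 0 <= t <= 1] s.

Definition transports A B (g : G) :=
  exists2 s, path_section A B s & s 1 = (s 0 * g)%g.

(** The holonomy along the segment, read off from any section over it. The value 1 is a default for
    segments without a section, which can occur only if they meet [K]. *)
Definition transport A B := xget 1%g (transports A B).

Lemma transports_unique A B g g' : transports A B g -> transports A B g' -> g = g'.
Proof.
move=> [s hs s1] [s' hs' s1'].
pose q t := (s t * (s' t)^-1)%g.
have : q 0 = q 1.
  apply: (@unit_interval_const R G q) => x x01.
  by have [U Ux qU] := section_on_quot hs hs' x01; exists U.
rewrite /q s1 s1' invgM mulgA => /mulIg.
by rewrite -mulgA -{1}[s 0]mulg1 => /mulgI h; apply: divg1_eq.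
Qed.

Lemma transportE A B g : transports A B g -> transport A B = g.
Proof.
move=> h; rewrite /transport; case: xgetP => [g1 _ h1|/(_ g)//].
exact: transports_unique h1 h.
Qed.

Lemma section_on_eq (M : topologicalType) (T1 T2 : M -> M -> G) D s :
  T1 =2 T2 -> section_on T1 D s -> section_on T2 D s.
Proof. by move=> e h x /h[U Ux TU]; exists U => // y z *; rewrite -e; exact: TU. Qed.

(** The square is mapped onto the triangle: the side p.1 = 0 collapses to [A], while the three
    others run along AB, AC and BC. Degenerate triangles are included. *)
Let fan A B C (p : R * R) := line A (line B C p.2) p.1.

Let fan_continuous A B C : continuous (fan A B C).
Proof.
have c1 : continuous (fst : R * R -> R) by move=> p; exact: cvg_fst.
have c2 : continuous (snd : R * R -> R) by move=> p; exact: cvg_snd.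
move=> p; rewrite /fan /line.
by apply: cvgD; [apply: cvgZr_tmp; apply: cvgB; [exact: cvg_cst|exact: c1]|
  apply: cvgZ; [exact: c1|apply: cvgD; apply: cvgZr_tmp; [
    apply: cvgB; [exact: cvg_cst|exact: c2]|exact: c2]]].
Qed.

Lemma triangle_fan A B C (t u : R) : 0 <= t <= 1 -> 0 <= u <= 1 ->
  triangle A B C (line A (line B C u) t).
Proof.
move=> t01 u01; exists (1 - t), (t * (1 - u)), (t * u); split; [nra|nra|nra|ring|].
by rewrite /line; apply/rowP => i; rewrite !coordE; ring.
Qed.

Lemma transport_triangle A B C : (forall X, triangle A B C X -> ~ K X) ->
  [/\ transports A B (transport A B), transports B C (transport B C),
      transports A C (transport A C) &
      transport A C = (transport A B * transport B C)%g].
Proof.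
move=> off.
have [|s hs] := @square_section R G (fun p q => T (fan A B C p) (fan A B C q)).
  move=> p pI; apply: (flat_at_comp (@fan_continuous A B C p)).
  by apply/Tflat/off/triangle_fan; move: pI; rewrite /rect /=; lra.
pose s00 := s (0, 0); pose s10 := s (1, 0); pose s01 := s (0, 1); pose s11 := s (1, 1).
have sub (i : R -> R * R) X Y : continuous i ->
    (forall t : R, 0 <= t <= 1 -> rect 0 1 0 1 (i t)) ->
    (forall t, fan A B C (i t) = line X Y t) -> path_section X Y (s \o i).
  move=> ci iI iE; have := section_on_comp ci hs.
  move/(section_onS (E := [set t : R | 0 <= t <= 1] : set R)).
  move=> /(_ iI); apply: section_on_eq => t u; by rewrite !iE.
have c0 (a : R) : continuous (fun t : R => (t, a)).
  by apply: continuous_pair => x; [exact: cvg_id|exact: cvg_cst].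
have c1 (a : R) : continuous (fun t : R => (a, t)).
  by apply: continuous_pair => x; [exact: cvg_cst|exact: cvg_id].
have AB : transports A B ((s00)^-1 * s10)%g.
  exists (s \o (fun t => (t, 0))); last by rewrite /= mulVKg.
  apply: sub => [|t|t]; first exact: c0.
    by rewrite /rect /=; lra.
  by rewrite /fan line0.
have AC : transports A C ((s01)^-1 * s11)%g.
  exists (s \o (fun t => (t, 1))); last by rewrite /= mulVKg.
  apply: sub => [|t|t]; first exact: c0.
    by rewrite /rect /=; lra.
  by rewrite /fan line1.
have BC : transports B C ((s10)^-1 * s11)%g.
  exists (s \o (fun t => (1, t))); last by rewrite /= mulVKg.
  apply: sub => [|t|t]; first exact: c1.
    by rewrite /rect /=; lra.
  by rewrite /fan line1.
have AA : s (0, 0) = s (0, 1).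
  have hAA : path_section A A (s \o (fun t => (0, t))).
    apply: sub => [|t|t]; first exact: c1.
      by rewrite /rect /=; lra.
    by rewrite /fan line0 line_id.
  apply: (@unit_interval_const R G (fun t => s (0, t))) => x x01.
  have [U Ux UT] := hAA x x01; exists U => // y Uy y01.
  have /= -> := UT x y (nbhs_singleton Ux) x01 Uy y01.
  rewrite !line_id flat_at1 ?mulg1 //; apply: Tflat; apply: off.
  by have := @triangle_fan A B C 0 0; rewrite line0; apply; rewrite ?lexx ?ler01.
rewrite (transportE AB) (transportE BC) (transportE AC); split=> //.
by rewrite /s00 AA mulgA mulgK.
Qed.

Lemma transportM A B C : (forall X, triangle A B C X -> ~ K X) ->
  (transport A B * transport B C = transport A C)%g.
Proof. by case/transport_triangle. Qed.

(** Balls are convex, so that near a point T Y itself is a section along the segment from Y to Z.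
    This allows sections to be built from holonomies. *)
Lemma transport_near X : ~ K X -> exists2 U, nbhs X U &
  forall Y Z, U Y -> U Z -> transport Y Z = T Y Z.
Proof.
move=> KX; have [U /nbhs_ballP[e /= e0 eU] TU] := Tflat KX.
exists (ball X e) => [|Y Z XY XZ]; first exact: nbhsx_ballx.
have inU t : 0 <= t <= 1 -> U (line Y Z t).
  by move=> t01; apply: eU; exact: ball_line.
apply: transportE; exists (fun t => T Y (line Y Z t)) => [t t01|].
  exists setT; first exact: filterT.
  move=> y z _ y01 _ z01; rewrite TU //; try exact: inU.
  exact: eU.
by rewrite line0 line1 TU //; exact: eU.
Qed.

Lemma triangleAAB A B X : triangle A A B X -> segment A B X.
Proof.
move=> [a [b [c [a0 b0 c0 e ->]]]]; exists c => /=; first lra.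
by rewrite -scalerDl; congr (_ *: _ + _); lra.
Qed.

Lemma transport1 A : ~ K A -> transport A A = 1%g.
Proof.
move=> KA; apply: (mulgI (transport A A)); rewrite mulg1 transportM //.
by move=> X /triangleAAB[t _ <-]; rewrite -[_ + _]/(line _ _ _) line_id.
Qed.

Lemma transportV A B : (forall X, segment A B X -> ~ K X) ->
  transport B A = ((transport A B)^-1)%g.
Proof.
move=> off; apply: (mulgI (transport A B)); rewrite mulgV transportM.
  rewrite transport1 //; apply: off; exists 0; rewrite /= ?lexx ?ler01 //.
  exact: line0.
move=> X [a [b [c [a0 b0 c0 e ->]]]]; apply: off; exists b => /=; first lra.
by rewrite addrAC -scalerDl; congr (_ *: _ + _); lra.
Qed.

End Flat.
End Transport.

(** * The infinite dihedral group and its characters *)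

(* [(b, c)] is the isometry x |-> (-1)^b x + c of the integers. *)
Definition dihedral : Type := (bool * int)%type.
HB.instance Definition _ := Choice.on dihedral.

Definition sgz_of (b : bool) (c : int) : int := if b then - c else c.

Definition dihedral_mul (g h : dihedral) : dihedral :=
  (g.1 (+) h.1, g.2 + sgz_of g.1 h.2).
Definition dihedral_inv (g : dihedral) : dihedral := (g.1, - sgz_of g.1 g.2).

Fact dihedral_mulA : associative dihedral_mul.
Proof.
by move=> [[] a] [[] b] [[] c]; rewrite /dihedral_mul /sgz_of /=; congr (_, _); ring.
Qed.
Fact dihedral_mul1 : left_id (false, 0) dihedral_mul.
Proof. by move=> [[] a]; rewrite /dihedral_mul /= add0r. Qed.
Fact dihedral_mulr1 : right_id (false, 0) dihedral_mul.
Proof. by move=> [[] a]; rewrite /dihedral_mul /= ?oppr0 addr0. Qed.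
Fact dihedral_mulV : left_inverse (false, 0) dihedral_inv dihedral_mul.
Proof. by move=> [[] a]; rewrite /dihedral_mul /= /dihedral_inv /=; congr (_, _); ring. Qed.
Fact dihedral_mulrV : right_inverse (false, 0) dihedral_inv dihedral_mul.
Proof. by move=> [[] a]; rewrite /dihedral_mul /= /dihedral_inv /=; congr (_, _); ring. Qed.
HB.instance Definition _ := isGroup.Build dihedral dihedral_mulA dihedral_mul1
  dihedral_mulr1 dihedral_mulV dihedral_mulrV.

Definition signs : Type := bool.
HB.instance Definition _ := Choice.on signs.
HB.instance Definition _ := isGroup.Build signs addbA addFb addbF addbb addbb.

Definition is_reflection (g : dihedral) : signs := g.1.

(* On reflections, [parity f] is nontrivial exactly when [odd g.2 = f]. *)
Definition parity (f : bool) (g : dihedral) : signs :=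
  odd `|g.2|%N (+) (~~ f && g.1).

Lemma is_reflectionM : {morph is_reflection : g h / (g * h)%g}.
Proof. by []. Qed.

(** c + c' and c - c' have the same parity, so the parity of the translation part is a character;
    [parity f] is this character or its sum with [is_reflection]. *)
Lemma parityM f : {morph parity f : g h / (g * h)%g}.
Proof.
move=> [b c] [b' c']; rewrite /parity /= /dihedral_mul /=.
have -> : odd `|c + sgz_of b c'| = odd `|c| (+) odd `|c'|.
  by case: b; rewrite /sgz_of; lia.
have -> (x y : signs) : (x * y)%g = x (+) y by [].
by case: f b b' => -[] [] /=; do 2!case: odd.
Qed.

Section RealContinuity.
Variables (R : realType) (M : topologicalType).
Implicit Types f g : M -> R.

Lemma ctsD f g : continuous f -> continuous g -> continuous (fun x => f x + g x).
Proof. by move=> cf cg x; apply: cvgD; [exact: cf|exact: cg]. Qed.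

Lemma ctsN f : continuous f -> continuous (fun x => - f x).
Proof. by move=> cf x; apply: cvgN; exact: cf. Qed.

Lemma ctsB f g : continuous f -> continuous g -> continuous (fun x => f x - g x).
Proof. by move=> cf cg; apply: ctsD => //; exact: ctsN. Qed.

Lemma ctsM f g : continuous f -> continuous g -> continuous (fun x => f x * g x).
Proof. by move=> cf cg x; apply: cvgM; [exact: cf|exact: cg]. Qed.

Lemma cts_norm f : continuous f -> continuous (fun x => `|f x|).
Proof. by move=> cf x; apply: cvg_norm; exact: cf. Qed.

Lemma cts_min f g : continuous f -> continuous g ->
  continuous (fun x => Num.min (f x) (g x)).
Proof. by move=> cf cg x; apply: continuous_min; [exact: cf|exact: cg]. Qed.

Lemma cts_max f g : continuous f -> continuous g ->
  continuous (fun x => Num.max (f x) (g x)).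
Proof. by move=> cf cg x; apply: continuous_max; [exact: cf|exact: cg]. Qed.

Lemma nbhs_neg f x : continuous f -> f x < 0 -> nbhs x [set y | f y < 0].
Proof. by move=> cf fx; exact: (cf x _ (lt_nbhsl fx)). Qed.

Lemma nbhs_pos f x : continuous f -> 0 < f x -> nbhs x [set y | 0 < f y].
Proof.
move=> cf fx; have := @nbhs_neg (fun x => - f x) x (ctsN cf).
rewrite oppr_lt0 => /(_ fx); apply: filterS => y /=; by rewrite oppr_lt0.
Qed.

End RealContinuity.

(** * Ramification and meridians *)

Section Ramification.
Variable R : realType.
Local Notation V := 'rV[R]_3.
Implicit Types (X Y Z p n : V) (K : set V).

Definition dot n X : R := \sum_k n 0 k * X 0 k.

Lemma dotDr n X Y : dot n (X + Y) = dot n X + dot n Y.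
Proof. by rewrite /dot -big_split; apply: eq_bigr => k _; rewrite !mxE mulrDr. Qed.

Lemma dotZr n a X : dot n (a *: X) = a * dot n X.
Proof. by rewrite /dot mulr_sumr; apply: eq_bigr => k _; rewrite !mxE mulrCA. Qed.

Lemma dotNr n X : dot n (- X) = - dot n X.
Proof. by rewrite -scaleN1r dotZr mulN1r. Qed.

Lemma dotBr n X Y : dot n (X - Y) = dot n X - dot n Y.
Proof. by rewrite dotDr dotNr. Qed.

Lemma dot_continuous n : continuous (dot n).
Proof.
rewrite /dot; elim: (index_enum _) => [|k s IHs].
  rewrite (_ : (fun _ => _) = cst 0); first exact: cst_continuous.
  by apply/funext => X; rewrite big_nil.
rewrite (_ : (fun _ => _) = (fun X : V => n 0 k * X 0 k + \sum_(i <- s) n 0 i * X 0 i)).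
  by apply: ctsD => //; apply: ctsM; [exact: cst_continuous|exact: coord_continuous].
by apply/funext => X; rewrite big_cons.
Qed.

(** Nontrivial local monodromy at [p], expressed without choosing a loop around [K]. *)
Definition ramified (A : groupType) (T : V -> V -> A) K p :=
  forall U, nbhs p U -> ~ exists s, section_on T (U `\` K) s.

Lemma line_dot n p X Y t : dot n (line X Y t - p) =
  (1 - t) * dot n (X - p) + t * dot n (Y - p).
Proof. by rewrite /line !(dotBr, dotDr, dotZr); ring. Qed.

Lemma triangle_dot_lt0 n p X Y Z Q : dot n (X - p) < 0 -> dot n (Y - p) < 0 ->
  dot n (Z - p) < 0 -> triangle X Y Z Q -> dot n (Q - p) < 0.
Proof.
move=> hX hY hZ [a [b [c [a0 b0 c0 e ->]]]]; move: hX hY hZ.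
rewrite !(dotBr, dotDr, dotZr) => hX hY hZ.
have -> : a * dot n X + b * dot n Y + c * dot n Z - dot n p =
  a * (dot n X - dot n p) + b * (dot n Y - dot n p) + c * (dot n Z - dot n p).
  have -> : c = 1 - a - b by lra. ring.
case: (lerP a (1/3)) => ha; [case: (lerP b (1/3)) => hb; [have hc : 1/3 <= c by lra|]|]; nra.
Qed.

Lemma triangle_convex X Y Z A B C Q : triangle X Y Z A -> triangle X Y Z B ->
  triangle X Y Z C -> triangle A B C Q -> triangle X Y Z Q.
Proof.
move=> [a1 [b1 [c1 [? ? ? e1 ->]]]] [a2 [b2 [c2 [? ? ? e2 ->]]]].
move=> [a3 [b3 [c3 [? ? ? e3 ->]]]] [a [b [c [? ? ? e ->]]]].
exists (a * a1 + b * a2 + c * a3), (a * b1 + b * b2 + c * b3), (a * c1 + b * c2 + c * c3).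
split; first by rewrite !addr_ge0 ?mulr_ge0.
- by rewrite !addr_ge0 ?mulr_ge0.
- by rewrite !addr_ge0 ?mulr_ge0.
- have -> : c1 = 1 - a1 - b1 by lra.
  have -> : c2 = 1 - a2 - b2 by lra.
  have -> : c3 = 1 - a3 - b3 by lra.
  have -> : c = 1 - a - b by lra.
  by ring.
- by apply/rowP => k; rewrite !coordE; ring.
Qed.

Lemma ball_triangle p e X Y Z Q : ball p e X -> ball p e Y -> ball p e Z ->
  triangle X Y Z Q -> ball p e Q.
Proof.
move=> hX hY hZ [a [b [c [a0 b0 c0 s ->]]]].
have [c1|c1] := eqVneq c 1.
  have -> : a = 0 by lra. have -> : b = 0 by lra.
  by rewrite !scale0r !add0r c1 scale1r.
have -> : a *: X + b *: Y + c *: Z = line (line X Y (b / (1 - c))) Z c.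
  rewrite /line; apply/rowP => k; rewrite !coordE.
  have -> : a = 1 - b - c by lra.
  by field; rewrite subr_eq0 eq_sym.
have c1' : 0 < 1 - c by rewrite subr_gt0 lt_neqAle c1; lra.
apply: ball_line => //; last by lra.
by apply: ball_line => //; rewrite divr_ge0 ?ler_pdivrMr //=; lra.
Qed.

Section Meridian.
Variables (G A : groupType) (chi : G -> A) (K : set V) (T : V -> V -> G).
Hypothesis chiM : {morph chi : g h / (g * h)%g}.
Hypothesis Tflat : forall X, ~ K X -> flat_at T X.
Local Notation P := (transport T).

Lemma morph1 : chi 1%g = 1%g.
Proof. by apply: (mulgI (chi 1)); rewrite -chiM !mulg1. Qed.

Lemma morphV g : chi (g^-1)%g = ((chi g)^-1)%g.
Proof. by apply: (mulgI (chi g)); rewrite -chiM !mulgV morph1. Qed.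

Lemma morph_conj_eq1 g h : chi (g * h * g^-1)%g = 1%g -> chi h = 1%g.
Proof.
rewrite !chiM morphV => /divg1_eq; rewrite -{2}[chi g]mulg1; exact: mulgI.
Qed.

Let off X Y Z := forall Q, triangle X Y Z Q -> ~ K Q.

Lemma conj_telescope (x x' p q r yy' y'y zz' z'z : G) :
  (y'y * yy' = 1)%g -> (z'z * zz' = 1)%g ->
  (x * (p * q * r) * x' = x * p * y'y * (yy' * q * z'z) * (zz' * r * x'))%g.
Proof.
by move=> yK zK; rewrite -!mulgA (mulgA y'y) yK mul1g (mulgA z'z) zK mul1g.
Qed.

(** Near p the complement of [K] is the union of three half-balls, each convex and each containing
    two of the vertices. If the loop XYZ had trivial image, the holonomies from X, continued from
    one half-ball to the next, would agree on all overlaps and form a section around p. *)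
Lemma local_meridian p (e : R) n1 n2 n3 X Y Z : 0 < e ->
  (forall Q, ball p e Q -> ~ K Q ->
     [\/ dot n1 (Q - p) < 0, dot n2 (Q - p) < 0 | dot n3 (Q - p) < 0]) ->
  (forall Q n, ball p e Q -> n \in [:: n1; n2; n3] -> dot n (Q - p) < 0 -> ~ K Q) ->
  ball p e X -> ball p e Y -> ball p e Z ->
  dot n1 (Y - p) < 0 -> dot n1 (Z - p) < 0 ->
  dot n2 (X - p) < 0 -> dot n2 (Z - p) < 0 ->
  dot n3 (X - p) < 0 -> dot n3 (Y - p) < 0 ->
  ramified (fun Y Z => chi (T Y Z)) K p ->
  chi (P X Y * P Y Z * P Z X)%g <> 1%g.
Proof.
move=> e0 cover offK bX bY bZ n1Y n1Z n2X n2Z n3X n3Y ram chi1.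
apply: (ram (ball p e)); first exact: nbhsx_ballx.
have PM n a b c : n \in [:: n1; n2; n3] -> ball p e a -> ball p e b -> ball p e c ->
    dot n (a - p) < 0 -> dot n (b - p) < 0 -> dot n (c - p) < 0 ->
    (P a b * P b c = P a c)%g.
  move=> nn ba bb bc na nb nc; apply: (transportM Tflat) => Q Qt.
  apply: (offK _ n) => //; first exact: ball_triangle Qt.
  exact: triangle_dot_lt0 Qt.
have i1 : n1 \in [:: n1; n2; n3] by rewrite !inE eqxx.
have i2 : n2 \in [:: n1; n2; n3] by rewrite !inE eqxx orbT.
have i3 : n3 \in [:: n1; n2; n3] by rewrite !inE eqxx !orbT.
pose s3 Q := chi (P X Q); pose s1 Q := chi (P X Y * P Y Q)%g.
pose s2 Q := chi (P X Y * P Y Z * P Z Q)%g.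
pose s Q := if dot n3 (Q - p) < 0 then s3 Q else
  if dot n1 (Q - p) < 0 then s1 Q else s2 Q.
have sE3 Q : dot n3 (Q - p) < 0 -> s Q = s3 Q by rewrite /s => ->.
have sE1 Q : ball p e Q -> dot n1 (Q - p) < 0 -> s Q = s1 Q.
  move=> bQ h; rewrite /s h; case: ifP => // h3.
  by rewrite /s3 /s1 (PM n3).
have sE2 Q : ball p e Q -> dot n2 (Q - p) < 0 -> s Q = s2 Q.
  move=> bQ h; rewrite /s; case: ifP => h3.
    (* The overlap of the last half-space with the first closes the cycle; it is here that the
       assumption on the loop enters. *)
    by rewrite /s3 /s2 -(PM n2 Z X Q) // mulgA chiM chi1 mul1g.
  by case: ifP => // h1; rewrite /s1 /s2 -mulgA (PM n1 Y Z Q).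
exists s => Q [bQ KQ].
have [U UQ TU] := transport_near Tflat KQ.
have step n B g : n \in [:: n1; n2; n3] -> dot n (Q - p) < 0 ->
    ball p e B -> dot n (B - p) < 0 ->
    (forall y, ball p e y -> dot n (y - p) < 0 -> s y = chi (g * P B y)%g) ->
    exists2 U, nbhs Q U & forall y z, U y -> (ball p e `\` K) y -> U z ->
       (ball p e `\` K) z -> s z = (s y * chi (T y z))%g.
  move=> nn nQ bB nB sE.
  exists (U `&` [set y : V | dot n (y - p) < 0]) => [|y z [Uy ny] [by' _] [Uz nz] [bz _]].
    apply: filterI => //.
    apply: (@nbhs_neg R V (fun y => dot n (y - p))) => //.
    have -> : (fun y : V => dot n (y - p)) = (fun y => dot n y - dot n p).
      by apply/funext => y; rewrite dotBr.
    by apply: ctsB; [exact: dot_continuous|exact: cst_continuous].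
  by rewrite !sE // -chiM -mulgA -TU // (PM n).
have [h|h|h] := cover Q bQ KQ.
- by apply: (step n1 Y (P X Y)) => // y by' ny; rewrite sE1.
- by apply: (step n2 Z (P X Y * P Y Z)%g) => // y by' ny; rewrite sE2.
- by apply: (step n3 X 1%g) => // y by' ny; rewrite sE3 // mul1g.
Qed.

(* The loop is contracted towards [p] by a homothety.                         *)
Lemma meridian p (e : R) n1 n2 n3 X Y Z : 0 < e ->
  (forall Q, ball p e Q -> ~ K Q ->
     [\/ dot n1 (Q - p) < 0, dot n2 (Q - p) < 0 | dot n3 (Q - p) < 0]) ->
  (forall Q n, ball p e Q -> n \in [:: n1; n2; n3] -> dot n (Q - p) < 0 -> ~ K Q) ->
  triangle X Y Z p -> (forall Q, triangle X Y Z Q -> K Q -> Q = p) ->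
  dot n1 (Y - p) < 0 -> dot n1 (Z - p) < 0 ->
  dot n2 (X - p) < 0 -> dot n2 (Z - p) < 0 ->
  dot n3 (X - p) < 0 -> dot n3 (Y - p) < 0 ->
  ramified (fun Y Z => chi (T Y Z)) K p ->
  chi (P X Y * P Y Z * P Z X)%g <> 1%g.
Proof.
move=> e0 cover offK pt only n1Y n1Z n2X n2Z n3X n3Y ram.
pose D := 1 + `|X - p| + `|Y - p| + `|Z - p|.
have [x0 y0 z0] : [/\ 0 <= `|X - p|, 0 <= `|Y - p| & 0 <= `|Z - p|] by [].
have D0 : 0 < D by rewrite /D; lra.
(* The ratio of the homothety: [D] exceeds the distances from p to the vertices, so the image of the
   triangle lies in the ball. *)
pose d := Num.min 1 (e / D).
have d0 : 0 < d by rewrite /d lt_min ltr01 divr_gt0.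
have d1 : d <= 1 by rewrite /d ge_min lexx.
have dD : d * D <= e by rewrite -ler_pdivlMr // /d ge_min lexx orbT.
have lineB Q : line p Q d - p = d *: (Q - p).
  by rewrite /line; apply/rowP => k; rewrite !coordE; ring.
have lb Q : `|Q - p| < D -> ball p e (line p Q d).
  move=> QD; rewrite -ball_normE /= distrC lineB normrZ gtr0_norm //.
  by apply: lt_le_trans dD; rewrite ltr_pM2l.
have ln n Q : dot n (Q - p) < 0 -> dot n (line p Q d - p) < 0.
  by move=> h; rewrite lineB dotZr pmulr_rlt0.
have vX : triangle X Y Z X.
  by exists 1, 0, 0; rewrite !scale0r scale1r !addr0; split; rewrite ?ler01.
have vY : triangle X Y Z Y.
  by exists 0, 1, 0; rewrite !scale0r scale1r addr0 !add0r; split; rewrite ?ler01 ?addr0.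
have vZ : triangle X Y Z Z.
  by exists 0, 0, 1; rewrite !scale0r scale1r !add0r; split; rewrite ?ler01.
have lt Q : triangle X Y Z Q -> triangle X Y Z (line p Q d).
  move=> Qt; apply: (triangle_convex pt Qt Qt).
  exists (1 - d), d, 0; split; [lra|lra|by []|lra|by rewrite scale0r addr0].
have PM n a b c : n \in [:: n1; n2; n3] -> triangle X Y Z a -> triangle X Y Z b ->
    triangle X Y Z c ->
    dot n (a - p) < 0 -> dot n (b - p) < 0 -> dot n (c - p) < 0 ->
    (P a b * P b c = P a c)%g.
  move=> nn ba bb bc na nb nc; apply: (transportM Tflat) => Q Qt KQ.
  have := triangle_dot_lt0 na nb nc Qt.
  rewrite (only Q) // ?subrr; last exact: triangle_convex Qt.
  by rewrite -(scale0r p) dotZr mul0r ltxx.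
have i1 : n1 \in [:: n1; n2; n3] by rewrite !inE eqxx.
have i2 : n2 \in [:: n1; n2; n3] by rewrite !inE eqxx orbT.
have i3 : n3 \in [:: n1; n2; n3] by rewrite !inE eqxx !orbT.
have noK n Q : triangle X Y Z Q -> dot n (Q - p) < 0 -> ~ K Q.
  move=> tQ h KQ; move: h; rewrite (only Q) // subrr.
  by rewrite -(scale0r p) dotZr mul0r ltxx.
(* A side and its image under the homothety lie in one half-space, within the triangle, hence off
   [K]. Replacing each side by the detour through its image turns the loop into a conjugate of the
   small one. *)
have split_side n a b : n \in [:: n1; n2; n3] -> triangle X Y Z a -> triangle X Y Z b ->
    dot n (a - p) < 0 -> dot n (b - p) < 0 ->
    P a b = (P a (line p a d) * P (line p a d) (line p b d) * P (line p b d) b)%g.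
  move=> nn ta tb na nb.
  rewrite (PM n a (line p a d) (line p b d)) ?(PM n) //; by [exact: lt|exact: ln].
have inv n a : n \in [:: n1; n2; n3] -> triangle X Y Z a -> dot n (a - p) < 0 ->
    (P (line p a d) a * P a (line p a d) = 1)%g.
  move=> nn ta na; rewrite (PM n) ?(transport1 Tflat) //; try by [exact: lt|exact: ln].
  apply: (noK n); by [exact: lt|exact: ln].
have [XD YD ZD] : [/\ `|X - p| < D, `|Y - p| < D & `|Z - p| < D].
  by rewrite /D; split; lra.
have loc := local_meridian e0 cover offK (lb _ XD) (lb _ YD) (lb _ ZD) (ln _ _ n1Y)
  (ln _ _ n1Z) (ln _ _ n2X) (ln _ _ n2Z) (ln _ _ n3X) (ln _ _ n3Y) ram.
move=> chi1; apply/loc/(@morph_conj_eq1 (P X (line p X d))).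
rewrite -[RHS]chi1 (split_side n3 X Y) // (split_side n1 Y Z) // (split_side n2 Z X) //.
have <- : P (line p X d) X = ((P X (line p X d))^-1)%g.
  by apply: (mulIg (P X (line p X d))); rewrite mulVg (inv n2).
congr chi; apply: conj_telescope; by [exact: (inv n1)|exact: (inv n2)].
Qed.

End Meridian.
End Ramification.

(** * Polygons *)

Section Edges.
Variable R : realType.
Local Notation V := 'rV[R]_3.
Implicit Types (P Q : seq V) (A B X : V) (e : V * V).

Definition cyclic_edges (T : Type) (s : seq T) := zip s (rot 1 s).

Lemma size_cyclic_edges (T : Type) (s : seq T) : size (cyclic_edges s) = size s.
Proof. by rewrite size1_zip ?size_rot. Qed.

Lemma nth_cyclic_edges (T : Type) (x : T) s i : (i < size s)%N ->
  nth (x, x) (cyclic_edges s) i = (nth x s i, nth x s (i.+1 %% size s)).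
Proof.
move=> si; rewrite nth_zip ?size_rot //; congr (_, _).
case: s si => // y s si; rewrite rot1_cons nth_rcons /=.
move: si; rewrite /= ltnS leq_eqVlt => /orP[/eqP ->|h].
  by rewrite ltnn eqxx modnn.
by rewrite h modn_small.
Qed.

Lemma cyclic_edgesP (T : eqType) (x : T) s (e : T * T) : reflect
  (exists2 i, (i < size s)%N & e = (nth x s i, nth x s (i.+1 %% size s)))
  (e \in cyclic_edges s).
Proof.
apply: (iffP (nthP (x, x))) => -[i]; rewrite size_cyclic_edges => si.
  by rewrite nth_cyclic_edges // => <-; exists i.
by move=> ->; exists i => //; rewrite nth_cyclic_edges.
Qed.

Lemma rot_cyclic_edges (T : eqType) k (s : seq T) :
  cyclic_edges (rot k s) =i cyclic_edges s.
Proof.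
have -> : cyclic_edges (rot k s) = rot k (cyclic_edges s).
  rewrite /cyclic_edges rot_rot.
  have h (u v : seq T) : size u = size v -> zip (rot k u) (rot k v) = rot k (zip u v).
    move=> uv; rewrite /rot zip_cat ?size_drop ?uv //; congr (_ ++ _).
      by elim: k u v {uv} => [|k IHk] [|a u] [|b v] //=; rewrite ?IHk //; case: drop.
    by elim: k u v {uv} => [|k IHk] [|a u] [|b v] //=; rewrite ?IHk //; case: take.
  by apply: h; rewrite size_rot.
by move=> e; rewrite mem_rot.
Qed.

Lemma rev_cyclic_edges (T : eqType) (s : seq T) (x y : T) :
  ((x, y) \in cyclic_edges (rev s)) = ((y, x) \in cyclic_edges s).
Proof.
have swap (u v : seq T) : ((x, y) \in zip u v) = ((y, x) \in zip v u).
  elim: u v => [|a u IHu] [|b v] //=; rewrite !inE IHu.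
  by congr orb; apply/eqP/eqP => -[-> ->].
rewrite /cyclic_edges -rev_rotr -rev_zip ?size_rotr // mem_rev swap.
by rewrite -{2}(rotrK 1 s) -/(cyclic_edges _) -(rot_cyclic_edges 1) rotrK.
Qed.

Lemma segmentC A B X : segment A B X -> segment B A X.
Proof.
move=> [t t01 <-]; exists (1 - t); first by move: t01 => /=; lra.
by rewrite /= subKr addrC.
Qed.

Lemma segmentl A B : segment A B A.
Proof. by exists 0; rewrite /= ?lexx ?ler01 //; exact: line0. Qed.

Lemma segmentr A B : segment A B B.
Proof. by exists 1; rewrite /= ?lexx ?ler01 //; exact: line1. Qed.

Lemma carrierP P X : carrier P X <->
  exists2 e, e \in cyclic_edges P & segment e.1 e.2 X.
Proof.
split=> [[i [t [si t01 ->]]]|[e /(cyclic_edgesP 0)[i si ->] [t t01 <-]]].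
  exists (P`_i, P`_(i.+1 %% size P)); first by apply/(cyclic_edgesP 0); exists i.
  by exists t => //=; lra.
have [t1|t1] := eqVneq t 1; last first.
  by exists i, t; split=> //; move: t01 => /=; rewrite lt_neqAle t1; lra.
exists (i.+1 %% size P)%N, 0; rewrite lexx ltr01; split=> //.
  by rewrite ltn_mod; case: (P) si.
by rewrite /edge_point t1 /= subrr scale0r add0r scale1r subr0 scale1r scale0r addr0.
Qed.

Lemma carrier_rot k P : carrier (rot k P) = carrier P.
Proof.
apply/seteqP; split=> X /carrierP[e he eX]; apply/carrierP; exists e => //.
  by rewrite -(rot_cyclic_edges k).
by rewrite rot_cyclic_edges.
Qed.

Lemma carrier_rev P : carrier (rev P) = carrier P.
Proof.
apply/seteqP; split=> X /carrierP[[a b] he eX]; apply/carrierP; exists (b, a);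
  try exact: segmentC; first by rewrite -rev_cyclic_edges.
by rewrite rev_cyclic_edges.
Qed.

Lemma carrier_same P Q : same_polygon P Q -> carrier P = carrier Q.
Proof. by move=> [k [->|->]]; rewrite carrier_rot ?carrier_rev. Qed.

(** Simplicity in terms of closed edges. Unlike the half-open parametrization of [is_knot], it is
    visibly invariant under reversal. *)
Definition simple_polygon P := uniq P /\ forall e e' X,
  e \in cyclic_edges P -> e' \in cyclic_edges P ->
  segment e.1 e.2 X -> segment e'.1 e'.2 X ->
  e = e' \/ X \in [:: e.1; e.2] /\ X \in [:: e'.1; e'.2].

Lemma is_knot_simple P : is_knot P -> simple_polygon P.
Proof.
move=> [P2 inj]; have pt i : edge_point P i 0 = P`_i.
  by rewrite /edge_point subr0 scale1r scale0r addr0.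
have pt1 i : edge_point P i 1 = P`_(i.+1 %% size P).
  by rewrite /edge_point subrr scale1r scale0r add0r.
have z01 : 0 <= (0 : R) < 1 by rewrite lexx ltr01.
have mS i : (i.+1 %% size P < size P)%N by rewrite ltn_mod (ltn_trans _ P2).
split=> [|e e' X].
  apply/(uniqP 0) => i j; rewrite !inE => si sj; rewrite -!pt => /inj h.
  by case: h.
move=> /(cyclic_edgesP 0)[i si ->] /(cyclic_edgesP 0)[j sj ->] /=.
move=> [t t01 <-] [u u01]; rewrite /= in t01 u01.
rewrite -/(edge_point P i t) -/(edge_point P j u) => e0.
have lt1 (x : R) : 0 <= x <= 1 -> x != 1 -> 0 <= x < 1.
  by move=> x01 x1; rewrite lt_neqAle x1; lra.
(* The parameter 1 is excluded by the half-open edges of [is_knot]; an end of an edge is read as the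
   start of the next one. *)
have [t1|t1] := eqVneq t 1; have [u1|u1] := eqVneq u 1.
- right; split; first by rewrite t1 pt1 !inE eqxx orbT.
  by rewrite -e0 u1 pt1 !inE eqxx orbT.
- right; split; first by rewrite t1 pt1 !inE eqxx orbT.
  rewrite -e0; move: e0; rewrite t1 pt1 -pt => /inj[]//; first exact: lt1.
  by move=> _ ->; rewrite pt !inE eqxx.
- right; split; last by rewrite -e0 u1 pt1 !inE eqxx orbT.
  move: e0; rewrite u1 pt1 -pt => /inj[]//; first exact: lt1.
  by move=> _ <-; rewrite pt !inE eqxx.
- by left; have [-> _] := inj i j t u si sj (lt1 _ t01 t1) (lt1 _ u01 u1) (esym e0).
Qed.

Lemma simple_same P Q : same_polygon P Q -> simple_polygon P -> simple_polygon Q.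
Proof.
move=> PQ [uP sP]; have : simple_polygon Q; last by [].
case: PQ => k [->|->]; split; rewrite ?rot_uniq ?rev_uniq //.
  by move=> e e' X; rewrite !rot_cyclic_edges; exact: sP.
move=> [a b] [a' b'] X; rewrite !rot_cyclic_edges !rev_cyclic_edges /= => h h'.
move=> /segmentC s /segmentC s'; have [[-> ->]|[/= m m']] := sP _ _ X h h' s s'.
  by left.
by right; move: m m'; rewrite !inE => m m'; split; rewrite orbC.
Qed.
End Edges.

(** * Elementary moves as homeomorphisms *)

Section Frames.
Variable R : realType.
Local Notation V := 'rV[R]_3.
Implicit Types (a b X : V).

Lemma ord3P (k : 'I_3) : [\/ k = 0, k = 1 | k = 2%:R].
Proof.
by case: k => -[|[|[|//]]] h; [constructor 1|constructor 2|constructor 3]; apply: val_inj.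
Qed.

Lemma dotE a X : dot a X = a 0 0 * X 0 0 + a 0 1 * X 0 1 + a 0 2%:R * X 0 2%:R.
Proof.
rewrite /dot !big_ord_recl big_ord0 addr0 addrA.
have -> : lift ord0 (ord0 : 'I_2) = 1 :> 'I_3 by apply: val_inj.
have -> // : lift ord0 (lift ord0 (ord0 : 'I_1)) = 2%:R :> 'I_3 by apply: val_inj.
Qed.

Definition cross a b : V := \row_k
  [:: a 0 1 * b 0 2%:R - a 0 2%:R * b 0 1; a 0 2%:R * b 0 0 - a 0 0 * b 0 2%:R;
      a 0 0 * b 0 1 - a 0 1 * b 0 0]`_k.

Lemma cross0 a b : cross a b 0 0 = a 0 1 * b 0 2%:R - a 0 2%:R * b 0 1.
Proof. by rewrite mxE. Qed.
Lemma cross1 a b : cross a b 0 1 = a 0 2%:R * b 0 0 - a 0 0 * b 0 2%:R.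
Proof. by rewrite mxE. Qed.
Lemma cross2 a b : cross a b 0 2%:R = a 0 0 * b 0 1 - a 0 1 * b 0 0.
Proof. by rewrite mxE. Qed.
Definition crossE := (cross0, cross1, cross2).

Lemma cross_eq0 a b : cross a b = 0 -> ~~ free [:: a; b].
Proof.
move=> /rowP ab0; apply/negP; rewrite free_cons seq1_free span_seq1 => /andP[/vlineP ab b0].
apply: ab; have [k bk] := rV0Pn _ b0; exists (a 0 k / b 0 k); apply/rowP => i.
have := ab0 0; have := ab0 1; have := ab0 2%:R; rewrite !crossE !mxE.
move=> e2 e1 e0.
suff : a 0 i * b 0 k = a 0 k * b 0 i by move=> h; rewrite mulrAC -h mulfK.
case: (ord3P i) (ord3P k) => -> [] ->; lra.
Qed.

(** The third vector is the cross product n of a and b. The dual basis is given by the cross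
    products of pairs from a, b, n, divided by the determinant, which is the square norm of n. *)
Lemma dual_frame a b : free [:: a; b] -> exists u v w n : V,
  [/\ forall X, X = dot u X *: a + dot v X *: b + dot w X *: n,
      [/\ dot u a = 1, dot v a = 0 & dot w a = 0],
      [/\ dot u b = 0, dot v b = 1 & dot w b = 0] &
      [/\ dot u n = 0, dot v n = 0 & dot w n = 1]].
Proof.
move=> fab; pose n := cross a b.
have D0 : dot n n != 0.
  apply: contraTneq fab => D0; apply: cross_eq0.
  move: D0; rewrite dotE -/n => D0.
  have h (x : R) : x * x = 0 -> x = 0 by move/eqP; rewrite mulf_eq0 orbb => /eqP.
  by apply/rowP => k; rewrite [RHS]mxE; case: (ord3P k) => ->; apply: h; nra.
exists ((dot n n)^-1 *: cross b n), ((dot n n)^-1 *: cross n a), ((dot n n)^-1 *: n), n.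
have dotZl c (x y : V) : dot (c *: x) y = c * dot x y.
  by rewrite !dotE !coordZ; ring.
move: D0; rewrite !dotE /n !crossE => D0.
split.
- move=> X; apply/rowP => k.
  by case: (ord3P k) => ->; rewrite !(coordD, coordZ, dotZl, dotE, crossE); field.
- by rewrite !(coordZ, crossE); split; field.
- by rewrite !(coordZ, crossE); split; field.
- by rewrite !(coordZ, crossE); split; field.
Qed.

End Frames.

(** * Pushing two sides of a triangle onto the third *)

Module Push.
Section Push.
Variable R : realType.
Local Notation V := 'rV[R]_3.

(** An edge starts at a vertex of the triangle with coordinate rates a, b, c. The inequalities at
    parameter t are homogeneous in t, hence conditions on the direction. If it lies outside the cone
    of the triangle, the margin [d] is positive and excludes all h up to d / (1 + a); otherwise the
    edge enters the triangle, and the hypothesis forces a = 0. *)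
Lemma touch_bound (a b c : R) :
  (forall t : R, 0 < t <= 1 -> 0 <= b -> b <= a -> t * (a + b) <= 2 -> c = 0 -> a = 0) ->
  exists2 eta : R, 0 < eta & forall h t rho : R, 0 < h <= eta -> 0 <= t <= 1 ->
    0 < rho -> rho <= t * a -> `|t * c| < h * rho -> - (t * b) < h * rho ->
    t * b < (1 + h) * rho -> False.
Proof.
move=> tri; have [a0|a0] := lerP a 0.
  by exists 1 => // h t rho *; snra.
pose d := Num.max `|c| (Num.max (- b) (b - a)).
have [d0|d0] := lerP d 0; last first.
  exists (d / (1 + a)); first by apply: divr_gt0; slra.
  move=> h t rho /andP[h0 hd] /andP[t0 t1] r0 ra hc hb1 hb2.
  have t0' : 0 < t by snra.
  have hda : h * (1 + a) <= d by rewrite -ler_pdivlMr //; slra.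
  have hra : h * rho <= h * (t * a) by rewrite ler_pM2l.
  have : d < h * a.
    rewrite /d !gt_max; apply/and3P; split.
    - by move: hc; rewrite normrM gtr0_norm // => hc; rewrite -(ltr_pM2l t0'); slra.
    - by rewrite -(ltr_pM2l t0'); slra.
    - by rewrite -(ltr_pM2l t0'); slra.
  by slra.
have : a = 0; last by slra.
move: d0; rewrite /d !ge_max => /and3P[c0 b0 ba].
pose t := Num.min 1 (2 / (a + b)).
have ab : 0 < a + b by slra.
apply: (tri t); rewrite /t.
- by rewrite lt_min ltr01 divr_gt0 //= ge_min lexx.
- by slra.
- by slra.
- by rewrite -ler_pdivlMr // ge_min lexx orbT.
- by apply/eqP; rewrite -normr_le0.
Qed.

Definition bump (x y : R) := Num.max 0 (Num.min x y).

(** Let v be the coordinate on the interval from -h rho to (1 + h) rho, and let a and b be the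
    distances from v to its two ends. Then v - k is the piecewise linear image of v that fixes the
    ends and takes rho to 0. The lemma recovers the shift k from the image, so this map is undone by
    the analogous one taking 0 to rho. *)
Lemma bumpK (h a b : R) : 0 < h ->
  let k := bump (a / (1 + h)) (b / h) in
  bump ((a - k) / h) ((b + k) / (1 + h)) = k.
Proof.
move=> h0 /=; have h1 : 0 < 1 + h by slra.
pose x := a / (1 + h); pose y := b / h.
have ax : a = (1 + h) * x by rewrite /x mulrCA mulfV ?mulr1 ?gt_eqF.
have bY : b = h * y by rewrite /y mulrCA mulfV ?mulr1 ?gt_eqF.
rewrite -/x -/y ax bY.
have [k0|k0] := lerP (Num.min x y) 0.
  have -> : bump x y = 0 by rewrite /bump max_l.
  rewrite /bump max_l // subr0 addr0 ge_min.
  move: k0; rewrite ge_min => /orP[k0|k0]; apply/orP; [left|right].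
    by rewrite pmulr_lle0 ?invr_gt0 // pmulr_rle0.
  by rewrite pmulr_lle0 ?invr_gt0 // pmulr_rle0.
have -> : bump x y = Num.min x y by rewrite /bump max_r // ltW.
case: (leP x y) k0 => [xy|yx] k0.
  have -> : ((1 + h) * x - x) / h = x by field; rewrite gt_eqF.
  have xm : x <= (h * y + x) / (1 + h) by rewrite ler_pdivlMr //; snra.
  by rewrite /bump (min_l xm) max_r // ltW.
have -> : (h * y + y) / (1 + h) = y by field; rewrite gt_eqF.
have ym : y <= ((1 + h) * x - y) / h by rewrite ler_pdivlMr //; snra.
by rewrite /bump (min_r ym) max_r // ltW.
Qed.

Lemma bumpKV (h a b : R) : 0 < h ->
  let k := bump (a / h) (b / (1 + h)) in
  bump ((a + k) / (1 + h)) ((b - k) / h) = k.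
Proof.
move=> h0 /=; have bC x y : bump x y = bump y x by rewrite /bump minC.
by rewrite (bC (a / h)) bC; exact: bumpK.
Qed.

Lemma ctsV (M : topologicalType) (f : M -> V) (m : M -> R) (E : V) :
  continuous f -> continuous m -> continuous (fun x => f x + m x *: E).
Proof.
move=> cf cm x; apply: cvgD; first exact: cf.
by apply: cvgZr_tmp; exact: cm.
Qed.

Section Move.
Variables A B C : V.

Definition touches_at (e : V * V) (Q : V) :=
  (Q = e.1 \/ Q = e.2) /\
  forall X, segment e.1 e.2 X -> triangle A C B X -> X = Q.

Definition avoidable (e : V * V) :=
  [\/ forall X, segment e.1 e.2 X -> ~ triangle A C B X,
      touches_at e A | touches_at e B].

Section Frame.
Variables nu nv nw n : V.
Hypothesis frameE : forall X, X = dot nu X *: (C - A) + dot nv X *: (B - A) + dot nw X *: n.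
Hypotheses (ua : dot nu (C - A) = 1) (va : dot nv (C - A) = 0) (wa : dot nw (C - A) = 0).
Hypotheses (ub : dot nu (B - A) = 0) (vb : dot nv (B - A) = 1) (wb : dot nw (B - A) = 0).

Let cV (X : V) := dot nu (X - A).
Let cR (X : V) := dot nv (X - A).
Let cW (X : V) := dot nw (X - A).
(** [E] goes from the midpoint of AB to C. Moving along it changes [cV] but neither [uu] nor [cW].
    In the plane cW = 0, the sides AC and CB form the graph cV = 1 - |uu| over AB, and [rho] is this
    function, decreased with the distance to the plane so that the motion has a support of thickness
    h. *)
Let E : V := (C - A) - (1/2) *: (B - A).
Let uu (X : V) := 2 * cR X + cV X - 1.
Let rho (h : R) (X : V) := 1 - `|uu X| - `|cW X| / h.
Let outside (h : R) (X : V) := cV X + h * rho h X <= 0 \/ (1 + h) * rho h X - cV X <= 0.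

Lemma frame X : X = A + cV X *: (C - A) + cR X *: (B - A) + cW X *: n.
Proof.
have h := frameE (X - A).
by rewrite -!addrA [_ *: (C - A) + _]addrA -h addrC subrK.
Qed.

Lemma lin m (x y : R) : dot m (x *: (C - A) + y *: (B - A)) =
    x * dot m (C - A) + y * dot m (B - A).
Proof. by rewrite (dotDr m (x *: _)) !dotZr. Qed.

Lemma triE X : triangle A C B X <->
    [/\ cW X = 0, 0 <= cV X, 0 <= cR X & cV X + cR X <= 1].
Proof.
split=> [[a [c [b [a0 c0 b0 abc ->]]]]|[w0 v0 r0 vr]].
  have XA : a *: A + c *: C + b *: B - A = c *: (C - A) + b *: (B - A).
    have -> : a = 1 - c - b by lra.
    by apply/rowP => k; rewrite !coordE; ring.
  by rewrite /cV /cR /cW XA !lin ua va wa ub vb wb; split; lra.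
exists (1 - cV X - cR X), (cV X), (cR X); split=> //; [lra|lra|].
rewrite {1}[X]frame w0 scale0r addr0.
by apply/rowP => k; rewrite !coordE; ring.
Qed.

Lemma cVl X Y t : cV (line X Y t) = (1 - t) * cV X + t * cV Y.
Proof. exact: line_dot. Qed.

Lemma cRl X Y t : cR (line X Y t) = (1 - t) * cR X + t * cR Y.
Proof. exact: line_dot. Qed.

Lemma cWl X Y t : cW (line X Y t) = (1 - t) * cW X + t * cW Y.
Proof. exact: line_dot. Qed.

Lemma ul X Y t : uu (line X Y t) = (1 - t) * uu X + t * uu Y.
Proof.
by rewrite /uu cVl cRl; ring.
Qed.

Lemma vA : cV A = 0. Proof. by rewrite /cV subrr -(scale0r A) dotZr mul0r. Qed.
Lemma rA : cR A = 0. Proof. by rewrite /cR subrr -(scale0r A) dotZr mul0r. Qed.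
Lemma wA : cW A = 0. Proof. by rewrite /cW subrr -(scale0r A) dotZr mul0r. Qed.
Lemma vB : cV B = 0. Proof. exact: ub. Qed.
Lemma rB : cR B = 1. Proof. exact: vb. Qed.
Lemma wB : cW B = 0. Proof. exact: wb. Qed.
Lemma vC : cV C = 1. Proof. exact: ua. Qed.
Lemma rC : cR C = 0. Proof. exact: va. Qed.
Lemma wC : cW C = 0. Proof. exact: wa. Qed.

Lemma out_if (h : R) (X : V) : 0 < h -> (0 < h -> 0 < 1 - `|uu X| -> `|cW X| < h * (1 - `|uu X|) ->
    - cV X < h * (1 - `|uu X|) -> cV X < (1 + h) * (1 - `|uu X|) -> False) -> outside h X.
Proof.
move=> h0 H; rewrite /outside.
have [?|h1] := lerP (cV X + h * rho h X) 0; first by left.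
have [?|h2] := lerP ((1 + h) * rho h X - cV X) 0; first by right.
have r0 : 0 < rho h X by nra.
have w0 : 0 <= `|cW X| / h by rewrite divr_ge0 // ltW.
have rr : rho h X <= 1 - `|uu X| by rewrite /rho; lra.
case: H => //; [lra| |nra|nra].
by rewrite mulrC -ltr_pdivrMr //; move: r0; rewrite /rho; lra.
Qed.

Lemma c_dot m : continuous (fun X : V => dot m (X - A)).
Proof.
have -> : (fun X : V => dot m (X - A)) = (fun X => dot m X - dot m A).
  by apply/funext => X; rewrite dotBr.
by apply: ctsB; [exact: dot_continuous|exact: cst_continuous].
Qed.

Lemma touchA Q : (forall X, segment A Q X -> triangle A C B X -> X = A) ->
    exists2 eta : R, 0 < eta & forall (h : R) (X : V), 0 < h <= eta -> segment A Q X -> outside h X.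
Proof.
move=> only.
have [t t01 b0 ba tab c0|eta eta0 H] := @touch_bound (uu Q + 1) (cV Q) (cW Q).
  have /only : segment A Q (line A Q t) by apply: segmentP; lra.
  have tA : triangle A C B (line A Q t).
    apply/triE; rewrite cVl cRl cWl vA rA wA c0; rewrite /uu in b0 ba tab *.
    by split; nra.
  move=> /(_ tA) tE; have := congr1 uu tE; rewrite ul /uu vA rA => h.
  have : t * (2 * cR Q + cV Q - 1 + 1) = 0 by lra.
  by move/eqP; rewrite mulf_eq0 => /orP[/eqP t0|/eqP //]; lra.
exists eta => // h X hh [t t01 <-]; rewrite -/(line A Q t); set X' := line A Q t.
apply: out_if => [|h0 r0 hw hv1 hv2]; first by case/andP: hh.
have uX : uu X' = t * (uu Q + 1) - 1.
  by rewrite /X' ul {1}/uu vA rA; ring.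
have vX : cV X' = t * cV Q by rewrite /X' cVl vA; ring.
have wX : cW X' = t * cW Q by rewrite /X' cWl wA; ring.
rewrite wX vX in hw hv1 hv2.
apply: (H h t (1 - `|uu X'|)) => //.
have := ler_norm (- uu X'); rewrite normrN uX; lra.
Qed.

Lemma touchB Q : (forall X, segment B Q X -> triangle A C B X -> X = B) ->
    exists2 eta : R, 0 < eta & forall (h : R) (X : V), 0 < h <= eta -> segment B Q X -> outside h X.
Proof.
move=> only.
have uB : uu B = 1 by rewrite /uu vB rB; ring.
have [t t01 b0 ba tab c0|eta eta0 H] := @touch_bound (1 - uu Q) (cV Q) (cW Q).
  have /only : segment B Q (line B Q t) by apply: segmentP; lra.
  have tA : triangle A C B (line B Q t).
    apply/triE; rewrite cVl cRl cWl vB rB wB c0; rewrite /uu in b0 ba tab *.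
    by split; nra.
  move=> /(_ tA) tE; have := congr1 uu tE; rewrite ul uB => h.
  have : t * (1 - uu Q) = 0 by lra.
  by move/eqP; rewrite mulf_eq0 => /orP[/eqP t0|/eqP //]; lra.
exists eta => // h X hh [t t01 <-]; rewrite -/(line B Q t); set X' := line B Q t.
apply: out_if => [|h0 r0 hw hv1 hv2]; first by case/andP: hh.
have uX : uu X' = 1 - t * (1 - uu Q) by rewrite /X' ul uB; ring.
have vX : cV X' = t * cV Q by rewrite /X' cVl vB; ring.
have wX : cW X' = t * cW Q by rewrite /X' cWl wB; ring.
rewrite wX vX in hw hv1 hv2.
apply: (H h t (1 - `|uu X'|)) => //.
have := ler_norm (uu X'); rewrite {1}uX; lra.
Qed.

Lemma c_cV : continuous cV.
Proof. exact: c_dot. Qed.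

Lemma c_cW : continuous cW.
Proof. exact: c_dot. Qed.

Lemma c_uu : continuous uu.
Proof.
apply: ctsB; last exact: cst_continuous.
apply: ctsD; last exact: c_cV.
by apply: ctsM; [exact: cst_continuous|exact: c_dot].
Qed.

(** The function [f] is positive exactly off the triangle and is less than h on the support of the
    motion. By compactness it has a positive minimum on the segment, which serves as the bound for
    h. *)
Lemma miss P Q : (forall X, segment P Q X -> ~ triangle A C B X) ->
    exists2 eta : R, 0 < eta & forall (h : R) (X : V), 0 < h <= eta -> segment P Q X -> outside h X.
Proof.
move=> off; have [[ctsV_ ctsW_] ctsu_] := (c_cV, c_cW, c_uu).
pose f (X : V) := Num.max `|cW X| (Num.max (- cV X) (cV X - 1 + `|uu X|)).
have cf : continuous f.
  apply: cts_max; first exact: cts_norm.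
  apply: cts_max; first exact: ctsN.
  apply: ctsD; last exact: cts_norm.
  by apply: ctsB => //; exact: cst_continuous.
have [|c c01 fc] := @EVT_min R (f \o line P Q) 0 1 ler01.
  apply: continuous_subspaceT => t; apply: continuous_comp; first exact: line_continuous.
  exact: cf.
rewrite in_itv /= in c01.
have fc0 : 0 < f (line P Q c).
  rewrite ltNge; apply/negP; rewrite /f !ge_max => /and3P[w0 v0 u0].
  apply: (off (line P Q c)); first exact: segmentP.
  apply/triE; rewrite /uu in u0; split.
  - by apply/eqP; rewrite -normr_le0.
  - lra.
  - have := ler_norm (- (2 * cR (line P Q c) + cV (line P Q c) - 1)).
    by rewrite normrN; lra.
  - by have := ler_norm (2 * cR (line P Q c) + cV (line P Q c) - 1); lra.
exists (f (line P Q c)) => // h X /andP[h0 hf] [t t01 <-].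
have : f (line P Q c) <= f (line P Q t) by apply: fc; rewrite in_itv.
rewrite -/(line P Q t); set X' := line P Q t => ff.
apply: out_if => // _ r0 hw hv1 hv2.
have : f X' < h; last by lra.
have uX := normr_ge0 (uu X').
by rewrite /f !gt_max; apply/and3P; split; nra.
Qed.

Lemma avoid (s : seq (V * V)) : (forall e, e \in s -> avoidable e) ->
    exists2 eta : R, 0 < eta & forall h : R, 0 < h <= eta ->
    forall e X, e \in s -> segment e.1 e.2 X -> outside h X.
Proof.
elim: s => [|e s IHs] avd; first by exists 1.
have [|eta1 eta10 H1] := IHs; first by move=> e' he'; apply: avd; rewrite inE he' orbT.
have [eta2 eta20 H2] : exists2 eta : R, 0 < eta &
    forall (h : R) (X : V), 0 < h <= eta -> segment e.1 e.2 X -> outside h X.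
  have [|off|[[Ae|Ae] only]|[[Be|Be] only]] := avd e; first by rewrite inE eqxx.
  - exact: miss.
  - by move: only; rewrite -Ae; exact: touchA.
  - move: only; rewrite -Ae => only.
    have [|eta ? H] := @touchA e.1; first by move=> X /segmentC; exact: only.
    by exists eta => // h X hh /segmentC; exact: H.
  - by move: only; rewrite -Be; exact: touchB.
  - move: only; rewrite -Be => only.
    have [|eta ? H] := @touchB e.1; first by move=> X /segmentC; exact: only.
    by exists eta => // h X hh /segmentC; exact: H.
exists (Num.min eta1 eta2); first by rewrite lt_min eta10.
move=> h; rewrite le_min => /andP[h0 /andP[h1 h2]] e' X.
rewrite inE => /orP[/eqP ->|]; first by apply: H2; rewrite h0.
by apply: H1; rewrite h0.
Qed.

(** The map slides each point along [E] by the shift of [bump]. The shift vanishes outside the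
    support, so the given edges stay fixed; on AC and CB it equals [cV], which brings them down to
    AB. *)
Lemma push (s : seq (V * V)) (eta : R) : 0 < eta ->
  (forall e X, e \in s -> segment e.1 e.2 X -> outside eta X) ->
  exists phi psi : V -> V,
    [/\ continuous phi /\ continuous psi, cancel phi psi, cancel psi phi,
        forall e X, e \in s -> segment e.1 e.2 X -> phi X = X &
        (forall X, segment A C X \/ segment C B X -> segment A B (phi X)) /\
        (forall X, segment A B X -> segment A C (psi X) \/ segment C B (psi X))].
Proof.
move=> eta0 out; have [[ctsV_ ctsW_] ctsu_] := (c_cV, c_cW, c_uu).
pose k (X : V) := bump ((cV X + eta * rho eta X) / (1 + eta)) (((1 + eta) * rho eta X - cV X) / eta).
pose k' (X : V) := bump ((cV X + eta * rho eta X) / eta) (((1 + eta) * rho eta X - cV X) / (1 + eta)).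
have eta1 : 0 < 1 + eta by lra.
have c_rho : continuous (rho eta).
  apply: ctsB; last by apply: ctsM; [exact: cts_norm|exact: cst_continuous].
  by apply: ctsB; [exact: cst_continuous|exact: cts_norm].
have c_a : continuous (fun X : V => cV X + eta * rho eta X).
  by apply: ctsD => //; apply: ctsM => //; exact: cst_continuous.
have c_b : continuous (fun X : V => (1 + eta) * rho eta X - cV X).
  by apply: ctsB => //; apply: ctsM => //; exact: cst_continuous.
have bump_cts (a b : V -> R) x y : continuous a -> continuous b ->
    continuous (fun X : V => bump (a X / x) (b X / y)).
  move=> ca cb; apply: cts_max; first exact: cst_continuous.
  by apply: cts_min; apply: ctsM => //; exact: cst_continuous.
have EE : [/\ dot nu E = 1, dot nv E = - (1/2) & dot nw E = 0].
  by rewrite /E -scaleNr -[C - A]scale1r !lin ua va wa ub vb wb; split; lra.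
case: EE => Ev Er Ew.
have cVE X t : cV (X + t *: E) = cV X + t.
  by rewrite /cV addrAC (dotDr _ (X - A)) dotZr Ev mulr1.
have cRE X t : cR (X + t *: E) = cR X - t / 2.
  by rewrite /cR addrAC (dotDr _ (X - A)) dotZr Er; ring.
have cWE X t : cW (X + t *: E) = cW X.
  by rewrite /cW addrAC (dotDr _ (X - A)) dotZr Ew mulr0 addr0.
have uE X t : uu (X + t *: E) = uu X by rewrite /uu cVE cRE; field.
have rE X t : rho eta (X + t *: E) = rho eta X by rewrite /rho uE cWE.
have segE P Q X : (exists2 t : R, 0 <= t <= 1 & X = (1 - t) *: P + t *: Q) -> segment P Q X.
  by move=> [t t01 ->]; exists t.
have onAC X : segment A C X \/ segment C B X ->
    0 <= cR X /\ [/\ cW X = 0, 0 <= cV X, cV X + cR X <= 1 & cV X = 1 - `|uu X|].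
  case=> -[t /= t01 <-]; rewrite -/(line _ _ t).
    rewrite ul cVl cRl cWl /uu vA rA wA vC rC wC.
    by rewrite ler0_norm; [split; [lra|split; lra]|lra].
  rewrite ul cVl cRl cWl /uu vB rB wB vC rC wC.
  by rewrite ger0_norm; [split; [lra|split; lra]|lra].
exists (fun X => X + (- k X) *: E), (fun X => X + k' X *: E); split.
- split; apply: ctsV; try by move=> X; exact: cvg_id.
    by apply: ctsN; exact: bump_cts.
  exact: bump_cts.
- move=> X; rewrite /k' cVE rE -addrA -scalerDl.
  have -> : cV X + - k X + eta * rho eta X = cV X + eta * rho eta X - k X by ring.
  have -> : (1 + eta) * rho eta X - (cV X + - k X) = (1 + eta) * rho eta X - cV X + k X.
    by ring.
  by rewrite bumpK // addNr scale0r addr0.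
- move=> X; rewrite /k cVE rE -addrA -scalerDl.
  have -> : cV X + k' X + eta * rho eta X = cV X + eta * rho eta X + k' X by ring.
  have -> : (1 + eta) * rho eta X - (cV X + k' X) = (1 + eta) * rho eta X - cV X - k' X.
    by ring.
  by rewrite bumpKV // addrN scale0r addr0.
- move=> e X es eX; have := out e X es eX; rewrite /outside => oX.
  have -> : k X = 0; last by rewrite oppr0 scale0r addr0.
  rewrite /k /bump max_l // ge_min; apply/orP; case: oX => h; [left|right].
    by rewrite pmulr_lle0 ?invr_gt0.
  by rewrite pmulr_lle0 ?invr_gt0.
split=> X.
- move=> /onAC[r0 [w0 v0 vr vu]].
  have kX : k X = cV X.
    rewrite /k /rho w0 normr0 mul0r subr0 -vu.
    have -> : (cV X + eta * cV X) / (1 + eta) = cV X by field; rewrite gt_eqF.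
    have -> : ((1 + eta) * cV X - cV X) / eta = cV X by field; rewrite gt_eqF.
    by rewrite /bump minxx max_r.
  apply: segE; exists (cR X + cV X / 2); first by lra.
  rewrite kX {1}[X]frame w0 scale0r addr0 /E.
  by apply/rowP => i; rewrite !coordE; field.
- move=> [t /= t01 <-]; rewrite -/(line A B t); set Y := line A B t.
  have vY : cV Y = 0 by rewrite cVl vA vB; ring.
  have uY : uu Y = 2 * t - 1 by rewrite ul /uu vA vB rA rB; ring.
  have wY : cW Y = 0 by rewrite cWl wA wB; ring.
  have kY : k' Y = 1 - `|2 * t - 1|.
    rewrite /k' vY /rho wY uY normr0 mul0r add0r !subr0.
    rewrite mulrAC mulfV ?gt_eqF // mul1r mulrAC mulfV ?gt_eqF // mul1r.
    rewrite /bump minxx max_r // subr_ge0 ler_norml; lra.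
  (* The first half of AB is lifted to AC and the second half to CB. *)
  rewrite kY /E; have [t2|t2] := lerP t (1/2); [left|right]; apply: segE.
    exists (2 * t); first by lra.
    rewrite ler0_norm; last by lra.
    by rewrite /Y /line; apply/rowP => i; rewrite !coordE; field.
  exists (2 * t - 1); first by lra.
  rewrite ger0_norm; last by lra.
  by rewrite /Y /line; apply/rowP => i; rewrite !coordE; field.
Qed.

End Frame.

Lemma push_homeomorphism (s : seq (V * V)) : free [:: C - A; B - A] ->
  (forall e, e \in s -> avoidable e) ->
  exists phi psi : V -> V,
    [/\ continuous phi /\ continuous psi, cancel phi psi, cancel psi phi,
        forall e X, e \in s -> segment e.1 e.2 X -> phi X = X &
        (forall X, segment A C X \/ segment C B X -> segment A B (phi X)) /\
        (forall X, segment A B X -> segment A C (psi X) \/ segment C B (psi X))].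
Proof.
move=> ABC avd.
have [nu [nv [nw [n [frameE [ua va wa] [ub vb wb] _]]]]] := dual_frame ABC.
have [eta eta0 out] := avoid frameE ua va wa ub vb wb avd.
by apply: (push frameE ua va wa ub vb wb eta0); apply: out; rewrite eta0 lexx.
Qed.

End Move.
End Push.
End Push.

Lemma segment_subdivision (R : realType) (A B X : 'rV[R]_3) (t : R) : 0 < t < 1 ->
  let C := (1 - t) *: A + t *: B in
  segment A C X \/ segment C B X <-> segment A B X.
Proof.
move=> t01 C; rewrite /C; split=> [[[u /= u01 <-]|[u /= u01 <-]]|[u /= u01 <-]].
- exists (u * t); first by rewrite /=; nra.
  by apply/rowP => k; rewrite !coordE; ring.
- exists (t + u * (1 - t)); first by rewrite /=; nra.
  by apply/rowP => k; rewrite !coordE; ring.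
- have [ut|ut] := lerP u t; [left|right].
    exists (u / t); first by rewrite /= divr_ge0 ?ler_pdivrMr //=; lra.
    by apply/rowP => k; rewrite !coordE; field; lra.
  exists ((u - t) / (1 - t)); first by rewrite /= divr_ge0 ?ler_pdivrMr //=; lra.
  by apply/rowP => k; rewrite !coordE; field; lra.
Qed.

(** * Isotopic links are ambient homeomorphic *)

Section Ambient.
Variables (R : realType) (m : nat).
Local Notation V := 'rV[R]_3.
Implicit Types (C D : 'I_m -> set V) (L : link R m).

Definition homeomorphic C D := exists phi psi : V -> V,
  [/\ continuous phi, continuous psi, cancel phi psi, cancel psi phi &
      forall i X, C i X <-> D i (phi X)].

Lemma homeomorphic_refl C : homeomorphic C C.
Proof. by exists id, id; split=> //; move=> X; exact: cvg_id. Qed.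

Lemma homeomorphic_sym C D : homeomorphic C D -> homeomorphic D C.
Proof.
move=> [phi [psi [cf cg fK gK CD]]]; exists psi, phi; split=> // i X.
by rewrite CD gK.
Qed.

Lemma homeomorphic_trans C D E :
  homeomorphic C D -> homeomorphic D E -> homeomorphic C E.
Proof.
move=> [f [g [cf cg fK gK CD]]] [f' [g' [cf' cg' fK' gK' DE]]].
exists (f' \o f), (g \o g'); split=> [X|X|X|X|i X].
- by apply: continuous_comp; [exact: cf|exact: cf'].
- by apply: continuous_comp; [exact: cg'|exact: cg].
- by rewrite /= fK' fK.
- by rewrite /= gK gK'.
- by rewrite CD DE.
Qed.

Definition carriers L i := carrier (tnth L i).

Lemma reduction_homeomorphic L L' :
  elementary_reduction L L' -> homeomorphic (carriers L) (carriers L').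
Proof.
move=> [i [A [C [B [s [LACB LAB same]]]]]].
have car := carrier_same LACB; have car' := carrier_same LAB.
have carE X : carrier [:: A, C, B & s] X <-> (segment A C X \/ segment C B X) \/
    exists2 e, e \in behead (cyclic_edges [:: A, B & s]) & segment e.1 e.2 X.
  rewrite carrierP; split=> [[e]|].
    rewrite /cyclic_edges /= !inE => /or3P[/eqP->|/eqP->|eS] eX; [by left; left|by left; right|].
    by right; exists e.
  case=> [[h|h]|[e he eX]].
  - by exists (A, C); rewrite ?inE ?eqxx.
  - by exists (C, B); rewrite ?inE ?eqxx ?orbT.
  - by exists e => //; rewrite /cyclic_edges /= !inE; move: he => /= ->; rewrite !orbT.
have carE' X : carrier [:: A, B & s] X <-> segment A B X \/
    exists2 e, e \in behead (cyclic_edges [:: A, B & s]) & segment e.1 e.2 X.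
  rewrite carrierP; split=> [[e]|].
    rewrite /cyclic_edges /= !inE => /orP[/eqP->|eS] eX; first by left.
    by right; exists e.
  case=> [h|[e he eX]].
  - by exists (A, B); rewrite ?inE ?eqxx.
  - by exists e => //; rewrite /cyclic_edges /= !inE; move: he => /= ->; rewrite !orbT.
case: ifP => [ABC off|_ [t t01 CE]]; last first.
  (* A subdivision does not change the carrier. *)
  exists id, id; split=> //; try by move=> X; exact: cvg_id.
  move=> j X; rewrite /carriers; have [->|ji] := eqVneq j i; last first.
    by rewrite (carrier_same (same j ji)).
  rewrite car car' carE carE'.
  by rewrite CE segment_subdivision.
have simp : simple_polygon [:: A, C, B & s].
  by apply: simple_same LACB _; apply: is_knot_simple; case: (componentsP L) => /(_ i).
have simp' : simple_polygon [:: A, B & s].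
  by apply: simple_same LAB _; apply: is_knot_simple; case: (componentsP L') => /(_ i).
have [uP sP] := simp.
have [Lknot Ldisj] := componentsP L.
(* A knot has at least three vertices, also after the move. Otherwise the edge back from B to A
   would be AB itself. *)
have s0 : s != [::].
  apply/eqP => s0; have [+ _] := (componentsP L').1 i.
  have -> : size (tnth L' i) = 2%N; last by [].
  by move: LAB; rewrite s0 => -[k [] /(congr1 size)]; rewrite size_rot ?size_rev.
pose others := behead (cyclic_edges [:: A, B & s]).
pose E := others ++ flatten [seq cyclic_edges (tnth L j) | j <- enum 'I_m & j != i].
have [e he|phi [psi [[cf cg] fK gK fix_ [fAB gAB]]]] := Push.push_homeomorphism ABC (s := E).
  move: he; rewrite mem_cat => /orP[he|/flattenP[es /mapP[j + ->] he]]; last first.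
    rewrite mem_filter => /andP[ji _]; constructor 1 => X eX tX.
    have LjX : carrier (tnth L j) X by apply/carrierP; exists e.
    have LiX : carrier (tnth L i) X.
      by rewrite car carE; left; have := off j X (conj LjX tX).
    by have := Ldisj j i ji; rewrite -subset0 => /(_ X); apply.
  have he' : e \in cyclic_edges [:: A, C, B & s].
    by rewrite /cyclic_edges /= !inE; move: he; rewrite /others /= => ->; rewrite !orbT.
  have nAC : (A, C) \in cyclic_edges [:: A, C, B & s] by rewrite inE eqxx.
  have nCB : (C, B) \in cyclic_edges [:: A, C, B & s] by rewrite !inE eqxx orbT.
  have oE : others = zip (B :: s) (rcons s A) by rewrite /others /cyclic_edges rot1_cons.
  rewrite {}oE in he.
  have e1 : e.1 \in B :: s.
    by have := map_f fst he; rewrite -/(unzip1 _) unzip1_zip //= size_rcons.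
  have e2 : e.2 \in rcons s A.
    by have := map_f snd he; rewrite -/(unzip2 _) unzip2_zip //= size_rcons.
  move: uP; rewrite /= !inE !negb_or => /and4P[/and3P[AC AB As] /andP[CB Cs] Bs us].
  have e1A : e.1 != A by apply: contraTneq e1 => ->; rewrite inE negb_or AB.
  have e1C : e.1 != C by apply: contraTneq e1 => ->; rewrite inE negb_or CB.
  have e2B : e.2 != B.
    by apply: contraTneq e2 => ->; rewrite mem_rcons inE negb_or eq_sym AB.
  have e2C : e.2 != C.
    by apply: contraTneq e2 => ->; rewrite mem_rcons inE negb_or eq_sym AC.
  have eBA : ~ (e.1 = B /\ e.2 = A).
    move: he; case: (e) => x y /= + [xB yA]; rewrite {}xB {}yA.
    case: (s) s0 As Bs => // z s' _; rewrite !inE !negb_or => /andP[Az _] /andP[Bz Bs'] /=.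
    move=> /orP[/eqP[Az']|h]; first by rewrite Az' eqxx in Az.
    have : B \in z :: s'.
      have h' : (B, A) \in zip (z :: s') (rcons s' A) := h.
      by have := map_f fst h'; rewrite -/(unzip1 _) unzip1_zip //= size_rcons.
    by rewrite inE (negPf Bz) (negPf Bs').
  (* By simplicity, a remaining edge of this component meets the triangle only in a vertex shared
     with AC or CB, and not in C. *)
  have eX X : segment e.1 e.2 X -> triangle A C B X ->
      X = A /\ e.2 = A \/ X = B /\ e.1 = B.
    move=> sX tX.
    have LiX : carrier (tnth L i) X by rewrite car; apply/carrierP; exists e.
    case: (off i X (conj LiX tX)) => hX.
      have [eE|[]] := sP e (A, C) X he' nAC sX hX; first by rewrite eE eqxx in e1A.
      rewrite !inE => /orP[/eqP XE|/eqP XE] /orP[/eqP XE'|/eqP XE'].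
      - by move: e1A; rewrite -XE XE' eqxx.
      - by move: e1C; rewrite -XE XE' eqxx.
      - by left; rewrite -XE.
      - by move: e2C; rewrite -XE XE' eqxx.
    have [eE|[]] := sP e (C, B) X he' nCB sX hX; first by rewrite eE eqxx in e1C.
    rewrite !inE => /orP[/eqP XE|/eqP XE] /orP[/eqP XE'|/eqP XE'].
    - by move: e1C; rewrite -XE XE' eqxx.
    - by right; rewrite -XE.
    - by move: e2C; rewrite -XE XE' eqxx.
    - by move: e2B; rewrite -XE XE' eqxx.
  have [e2A|e2A] := eqVneq e.2 A.
    constructor 2; split=> [|X sX tX]; first by right.
    by have [[]//|[_ e1B]] := eX X sX tX; case: eBA.
  have [e1B|e1B] := eqVneq e.1 B.
    constructor 3; split=> [|X sX tX]; first by left.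
    by have [[_ h]|[]//] := eX X sX tX; case: eBA.
  constructor 1 => X sX tX; have [[_ h]|[_ h]] := eX X sX tX.
    by rewrite h eqxx in e2A.
  by rewrite h eqxx in e1B.
exists phi, psi; split=> // j X; rewrite /carriers.
have fixP e Y : e \in E -> segment e.1 e.2 Y -> phi Y = Y /\ psi Y = Y.
  by move=> eE eY; have := fix_ e Y eE eY => fY; split=> //; rewrite -{1}fY fK.
have [->|ji] := eqVneq j i; last first.
  have jE e : e \in cyclic_edges (tnth L j) -> e \in E.
    move=> he; rewrite mem_cat; apply/orP; right; apply/flattenP.
    exists (cyclic_edges (tnth L j)) => //; apply/mapP; exists j => //.
    by rewrite mem_filter ji mem_enum.
  rewrite -(carrier_same (same j ji)); split.
    by move=> /carrierP[e he eX]; have [-> _] := fixP e X (jE e he) eX; apply/carrierP; exists e.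
  move=> /carrierP[e he eX]; have [_] := fixP e _ (jE e he) eX.
  by rewrite fK => ->; apply/carrierP; exists e.
have oE e : e \in others -> e \in E by move=> he; rewrite mem_cat he.
rewrite car car' carE carE'; split.
  case=> [h|[e he eX]]; first by left; exact: fAB.
  by right; exists e => //; have [-> _] := fixP e X (oE e he) eX.
case=> [/gAB|[e he eX]]; first by rewrite fK; left.
by right; exists e => //; have [_] := fixP e _ (oE e he) eX; rewrite fK => ->.
Qed.

Lemma isotopic_homeomorphic L L' :
  isotopic L L' -> homeomorphic (carriers L) (carriers L').
Proof.
elim=> [x y|x|x y _|x y z _ h1 _ h2].
- exact: reduction_homeomorphic.
- exact: homeomorphic_refl.
- exact: homeomorphic_sym.
- exact: homeomorphic_trans h1 h2.
Qed.

End Ambient.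

(** * Invariants *)

Section Invariants.
Variables (R : realType) (m : nat).
Local Notation V := 'rV[R]_3.
Implicit Types (C D : 'I_m -> set V).

Definition total C : set V := [set X | exists i, C i X].

Definition colorable C := exists (f : 'I_m -> bool) (T : V -> V -> dihedral),
  [/\ exists i j, f i != f j,
      forall X, ~ total C X -> flat_at T X &
      forall i p, C i p ->
        ramified (fun Y Z => is_reflection (T Y Z)) (total C) p /\
        ramified (fun Y Z => parity (f i) (T Y Z)) (total C) p].

(** Only the sign of the system along component i matters; dihedral values are kept so that the same
    systems serve both invariants. *)
Definition oddly_linked C := exists i j (T : V -> V -> dihedral),
  [/\ i != j, forall X, ~ C j X -> flat_at T X &
      ~ exists s, section_on (fun Y Z => is_reflection (T Y Z)) (C i) s].

Lemma colorable_homeomorphic C D : homeomorphic C D -> colorable C -> colorable D.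
Proof.
move=> [phi [psi [cf cg fK gK CD]]] [f [T [fN Tflat ram]]].
have tE X : total C X <-> total D (phi X).
  by split=> -[i /CD h]; exists i.
exists f, (fun Y Z => T (psi Y) (psi Z)); split=> //.
  move=> X DX; apply: flat_at_comp; first exact: cg.
  by apply: Tflat => /tE; rewrite gK.
have ramD (A : groupType) (chi : dihedral -> A) p :
    ramified (fun Y Z => chi (T Y Z)) (total C) p ->
    ramified (fun Y Z => chi (T (psi Y) (psi Z))) (total D) (phi p).
  move=> H U pU [s sU]; apply: (H (phi @^-1` U)); first exact: cf.
  exists (s \o phi); have := section_on_comp cf sU.
  move/(section_onS (E := phi @^-1` U `\` total C)).
  have /[swap]/[apply] : phi @^-1` U `\` total C `<=` phi @^-1` (U `\` total D).
    by move=> X [UX CX]; split=> // /tE.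
  by apply: section_on_eq => Y Z; rewrite !fK.
move=> i p Dp; have := ram i (psi p); rewrite CD gK => /(_ Dp)[r1 r2].
by rewrite -(gK p); split; exact: ramD.
Qed.

Lemma oddly_linked_homeomorphic C D :
  homeomorphic C D -> oddly_linked C -> oddly_linked D.
Proof.
move=> [phi [psi [cf cg fK gK CD]]] [i [j [T [ij Tflat nsec]]]].
exists i, j, (fun Y Z => T (psi Y) (psi Z)); split=> //.
  move=> X DX; apply: flat_at_comp; first exact: cg.
  by apply: Tflat => /CD; rewrite gK.
move=> [s sD]; apply: nsec; exists (s \o phi); have := section_on_comp cf sD.
have -> : phi @^-1` D i = C i by apply/seteqP; split=> X /CD.
by apply: section_on_eq => Y Z; rewrite !fK.
Qed.

End Invariants.

(** * The Dehn presentation of a lattice link *)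

Section Piercing.
Variable R : realType.
Local Notation V := 'rV[R]_3.
Implicit Types (X Y Z p a b c d e : V).

Lemma segment_closed a b : closed (segment a b).
Proof.
apply: compact_closed; first exact: norm_hausdorff.
have -> : segment a b = line a b @` `[0, 1].
  by apply/seteqP; split=> X [t t01 <-]; exists t => //; move: t01; rewrite /= in_itv.
apply: continuous_compact; last exact: segment_compact.
by apply: continuous_subspaceT; exact: line_continuous.
Qed.

Definition det3 a b c := dot a (cross b c).


Lemma det3_cramer x y z d :
  det3 y z d *: x + det3 z x d *: y + det3 x y d *: z = det3 x y z *: d.
Proof.
apply/rowP => k; rewrite !coordE /det3.
by case: (ord3P k) => ->; rewrite !(dotE, crossE); ring.
Qed.

Lemma side_dotl (d e Y Z : V) t :
  dot (cross d (Z - Y)) (Y - (e + t *: d)) = - det3 (Y - e) (Z - e) d.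
Proof. by rewrite /det3 !(dotE, crossE, coordE); ring. Qed.

Lemma side_dotr (d e Y Z : V) t :
  dot (cross d (Z - Y)) (Z - (e + t *: d)) = - det3 (Y - e) (Z - e) d.
Proof. by rewrite /det3 !(dotE, crossE, coordE); ring. Qed.

Section Pierced.
Variables (G A : groupType) (chi : G -> A) (K K' : set V) (T : V -> V -> G).
Hypothesis chiM : {morph chi : g h / (g * h)%g}.
Hypothesis Tflat : forall X, ~ K X -> flat_at T X.
Local Notation P := (transport T).

(** The determinants involving d are proportional to the barycentric coordinates of the piercing
    point p, and det3 x y z over their sum is its parameter on the edge. The half-spaces for
    [meridian] are bounded by the planes containing the edge and parallel to a side of the triangle.
    Their normals add up to 0, so they cover the complement of the line of the edge. *)
Lemma pierced_meridian X Y Z e1 e2 : let d := e2 - e1 in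
  let x := X - e1 in let y := Y - e1 in let z := Z - e1 in
  0 < det3 y z d -> 0 < det3 z x d -> 0 < det3 x y d ->
  0 < det3 x y z -> det3 x y z < det3 y z d + det3 z x d + det3 x y d ->
  (forall Q, K Q <-> segment e1 e2 Q \/ K' Q) -> closed K' ->
  (forall Q, triangle X Y Z Q -> ~ K' Q) ->
  (forall Q, segment e1 e2 Q -> ramified (fun Y Z => chi (T Y Z)) K Q) ->
  chi (P X Y * P Y Z * P Z X)%g <> 1%g.
Proof.
move=> d x y z D1 D2 D3 V0 VS KE cK' offK' ram.
pose S := det3 y z d + det3 z x d + det3 x y d.
have S0 : 0 < S by rewrite /S; slra.
pose tau := det3 x y z / S.
have tau01 : 0 < tau < 1 by rewrite divr_gt0 //= ltr_pdivrMr // mul1r.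
pose p := line e1 e2 tau.
have pE : p = e1 + tau *: d.
  by rewrite /p /line /d; apply/rowP => k; rewrite !coordE; ring.
have pt : triangle X Y Z p.
  exists (det3 y z d / S), (det3 z x d / S), (det3 x y d / S).
  split; [exact/ltW/divr_gt0|exact/ltW/divr_gt0|exact/ltW/divr_gt0| |].
    by rewrite -!mulrDl mulfV ?gt_eqF.
  have SN : S != 0 by rewrite gt_eqF.
  have -> : p = e1 + S^-1 *: (det3 x y z *: d).
    by rewrite pE /tau scalerA mulrC.
  rewrite -det3_cramer; move: SN; rewrite /S => SN; apply/rowP => k; rewrite !coordE.
  by field.
have ep : segment e1 e2 p by apply: segmentP; slra.
have only Q : triangle X Y Z Q -> K Q -> Q = p.
  move=> tQ /KE[[t t01 QE]|/(offK' _ tQ)//].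
  case: tQ => [a [b [c [_ _ _ abc QE']]]].
  have tS : t * S = det3 x y z.
    have h : t *: d = a *: x + b *: y + c *: z.
      have ce : c = 1 - a - b by rewrite -abc; ring.
      move: QE; rewrite QE' => /rowP QE; apply/rowP => k; have := QE k.
      by rewrite !coordE ce => hk; slra.
    have := congr1 (dot (cross (y - x) (z - x))) h.
    rewrite dotZr (dotDr _ (a *: x + b *: y)) (dotDr _ (a *: x)) !dotZr.
    have -> : dot (cross (y - x) (z - x)) d = S.
      by rewrite /S /det3 !(dotE, crossE, coordB); ring.
    have nu u : u \in [:: x; y; z] -> dot (cross (y - x) (z - x)) u = det3 x y z.
      rewrite !inE => /or3P[] /eqP ->;
      by rewrite /det3 !(dotE, crossE, coordB); ring.
    by rewrite !nu ?inE ?eqxx ?orbT // -!mulrDl abc mul1r.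
  have -> : Q = line e1 e2 t by [].
  by rewrite /p /tau -tS mulfK // gt_eqF.
have d0 : 0 < `|d|.
  rewrite normr_gt0; apply: contraTneq D1 => ->.
  by rewrite /det3 !(dotE, crossE, mxE) !(mulr0, mul0r, subr0, addr0) ltxx.
have [e0 e00 eK'] : exists2 e0 : R, 0 < e0 & forall Q, ball p e0 Q -> ~ K' Q.
  have : nbhs p (~` K').
    by apply: open_nbhs_nbhs; split; [exact: closed_openC|exact: offK'].
  by move=> /nbhs_ballP[e0 /= e00 h]; exists e0.
pose tm := Num.min tau (1 - tau).
have tm0 : 0 < tm by rewrite /tm lt_min; slra.
(* Within this radius the line of the edge stays between its two ends, and the rest of the link is
   not reached. *)
pose e := Num.min e0 (tm * `|d|).
have ee0 : e <= e0 by rewrite /e ge_min lexx.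
have etm : e <= tm * `|d| by rewrite /e ge_min lexx orbT.
have f_d n s : n \in [:: cross d (Z - Y); cross d (X - Z); cross d (Y - X)] ->
    dot n (s *: d) = 0.
  rewrite dotZr !inE => /or3P[] /eqP ->;
  by rewrite !(dotE, crossE, coordB); ring.
apply: (@meridian R G A chi K T chiM Tflat p e (cross d (Z - Y)) (cross d (X - Z))
  (cross d (Y - X))) => //.
- by rewrite /e lt_min e00 mulr_gt0.
- move=> Q bQ KQ; pose q := Q - p.
  case: (ltrP (dot (cross d (Z - Y)) q) 0) => f1; first by constructor 1.
  case: (ltrP (dot (cross d (X - Z)) q) 0) => f2; first by constructor 2.
  case: (ltrP (dot (cross d (Y - X)) q) 0) => f3; first by constructor 3.
  exfalso; apply: KQ; apply/KE; left.
  pose tx := det3 x q d; pose ty := det3 y q d; pose tz := det3 z q d.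
  have g1 : dot (cross d (Z - Y)) q = tz - ty.
    by rewrite /tz /ty /z /y /det3 !(dotE, crossE, coordB); ring.
  have g2 : dot (cross d (X - Z)) q = tx - tz.
    by rewrite /tz /tx /z /x /det3 !(dotE, crossE, coordB); ring.
  have g3 : dot (cross d (Y - X)) q = ty - tx.
    by rewrite /tx /ty /x /y /det3 !(dotE, crossE, coordB); ring.
  rewrite g1 in f1; rewrite g2 in f2; rewrite g3 in f3.
  have xy : tx = ty by slra.
  have yz : tz = ty by slra.
  have St : S * ty = 0.
    have : det3 y z d * tx + det3 z x d * ty + det3 x y d * tz = 0.
      by rewrite /tx /ty /tz /det3 !(dotE, crossE); ring.
    by rewrite xy yz -!mulrDl.
  have ty0 : ty = 0.
    by move/eqP: St; rewrite mulf_eq0 gt_eqF //= => /eqP.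
  have qE : q = (det3 x y q / det3 x y d) *: d.
    have D3N : det3 x y d != 0 by rewrite gt_eqF.
    apply: (scalerI D3N); rewrite scalerA mulrCA mulfV // mulr1.
    have := det3_cramer x y q d.
    have -> : det3 y q d = 0 by [].
    have -> : det3 q x d = - tx by rewrite /tx /det3 !(dotE, crossE); ring.
    by rewrite xy ty0 oppr0 !scale0r !add0r.
  pose s := det3 x y q / det3 x y d; rewrite -/s in qE.
  have : `|q| < e by move: bQ; rewrite -ball_normE /= distrC.
  rewrite qE normrZ => se.
  have : `|s| < tm by rewrite -(ltr_pM2r d0); apply: lt_le_trans etm.
  rewrite lt_min ltr_norml => /andP[/andP[s1 s2]]; rewrite ltr_norml => /andP[s3 s4].
  have -> : Q = line e1 e2 (tau + s).
    rewrite -[Q](subrK p) -/q qE pE /line; apply/rowP => k; rewrite !coordE; ring.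
  by apply: segmentP; slra.
- move=> Q n bQ nn nQ /KE[[t t01 QE]|]; last first.
    apply: eK'; move: bQ; rewrite -!ball_normE /= => bQ; exact: lt_le_trans bQ ee0.
  move: nQ; have -> : Q - p = (t - tau) *: d.
    by rewrite -QE pE; apply/rowP => k; rewrite !coordE; ring.
  by rewrite f_d // ltxx.
- by rewrite pE side_dotl oppr_lt0.
- by rewrite pE side_dotr oppr_lt0.
- by rewrite pE side_dotr oppr_lt0.
- by rewrite pE side_dotl oppr_lt0.
- by rewrite pE side_dotl oppr_lt0.
- by rewrite pE side_dotr oppr_lt0.
- exact: ram.
Qed.
End Pierced.
End Piercing.

(* Points with coordinates in Z/2, given by the doubled coordinates.          *)
Notation zpoint := (Z * Z * Z)%type.
Notation zedge := (zpoint * zpoint)%type.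

(** * Certificates over the integers *)

Section Certificates.
Local Open Scope Z_scope.
Implicit Types (a b c f : zpoint) (e : zedge) (E : seq zedge).

Definition zdot a b := a.1.1 * b.1.1 + a.1.2 * b.1.2 + a.2 * b.2.
Definition zsub a b : zpoint := (a.1.1 - b.1.1, a.1.2 - b.1.2, a.2 - b.2).
Definition zcross a b : zpoint :=
  (a.1.2 * b.2 - a.2 * b.1.2, a.2 * b.1.1 - a.1.1 * b.2, a.1.1 * b.1.2 - a.1.2 * b.1.1).
Definition zdet a b c := zdot a (zcross b c).
Definition swap e : zedge := (e.2, e.1).

Definition separates f (s t : seq zpoint) :=
  all (fun a => all (fun b => Z.ltb (zdot f a) (zdot f b)) t) s.

(* By the separating axis theorem, these directions suffice in general.       *)
Definition directions a b c e :=
  let d := zsub e.2 e.1 in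
  let s := [:: zsub b a; zsub c a; zsub c b] in
  let n := zcross (zsub b a) (zsub c a) in
  n :: zcross d n :: map (fun u => zcross u d) s ++ map (zcross n) s.

Definition misses_edge a b c e :=
  has (fun f => separates f [:: a; b; c] [:: e.1; e.2] ||
                separates f [:: e.1; e.2] [:: a; b; c]) (directions a b c e).

Definition misses E a b c := all (misses_edge a b c) E.

Definition pierced a b c e :=
  let d := zsub e.2 e.1 in
  let x := zsub a e.1 in let y := zsub b e.1 in let z := zsub c e.1 in
  [&& 0 <? zdet y z d, 0 <? zdet z x d, 0 <? zdet x y d, 0 <? zdet x y z &
      zdet x y z <? zdet y z d + zdet z x d + zdet x y d].

Definition pierced_only_by E a b c e :=
  [&& (e \in E) || (swap e \in E), pierced a b c e &
      all (fun e' => [|| e' == e, e' == swap e | misses_edge a b c e']) E].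

End Certificates.

Section Realization.
Variable R : realType.
Local Notation V := 'rV[R]_3.
Implicit Types (a b c f : zpoint) (e : zedge) (E : seq zedge).

Definition zr (n : Z) : R := (int_of_Z n)%:~R.

Lemma zrD (m n : Z) : zr (Z.add m n) = zr m + zr n.
Proof. by rewrite /zr -intrD -rmorphD. Qed.
Lemma zrN (n : Z) : zr (Z.opp n) = - zr n.
Proof. by rewrite /zr -intrN -rmorphN. Qed.
Lemma zrB (m n : Z) : zr (Z.sub m n) = zr m - zr n.
Proof. by rewrite -zrN -zrD Z.add_opp_r. Qed.
Lemma zrM (m n : Z) : zr (Z.mul m n) = zr m * zr n.
Proof. by rewrite /zr -intrM -rmorphM. Qed.
Lemma zr_lt (m n : Z) : Z.ltb m n -> zr m < zr n.
Proof. rewrite /zr ltr_int; lia. Qed.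
Definition zrE := (zrD, zrB, zrM).

Definition vec a : V := \row_k (zr ([:: a.1.1; a.1.2; a.2]`_k) / 2).

Lemma vec0 a : vec a 0 0 = zr a.1.1 / 2. Proof. by rewrite mxE. Qed.
Lemma vec1 a : vec a 0 1 = zr a.1.2 / 2. Proof. by rewrite mxE. Qed.
Lemma vec2 a : vec a 0 2%:R = zr a.2 / 2. Proof. by rewrite mxE. Qed.
Definition vecE := (vec0, vec1, vec2).

Lemma dot_vec f a : dot (vec f) (vec a) = zr (zdot f a) / 4.
Proof. by rewrite dotE !vecE /zdot !zrE; field. Qed.

Lemma dot_cross_vec a b c d :
  det3 (vec a - vec d) (vec b - vec d) (vec c - vec d) =
  zr (zdet (zsub a d) (zsub b d) (zsub c d)) / 8.
Proof.
by rewrite /det3 !(dotE, crossE, coordB, vecE) /zdet /zdot /zcross /zsub /= !zrE; field.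
Qed.

Definition tube E : set V :=
  [set X | exists2 e, e \in E & segment (vec e.1) (vec e.2) X].

Lemma tube_closed E : closed (tube E).
Proof.
elim: E => [|e E IHE].
  have -> : tube [::] = set0 by apply/seteqP; split=> // X [].
  exact: closed0.
have -> : tube (e :: E) = segment (vec e.1) (vec e.2) `|` tube E.
  apply/seteqP; split=> X.
    by move=> [e']; rewrite inE => /orP[/eqP ->|h] h'; [left|right; exists e'].
  by case=> [h|[e' h h']]; [exists e|exists e'] => //; rewrite inE ?eqxx ?h ?orbT.
by apply: closedU => //; exact: segment_closed.
Qed.

Lemma convex_lt (x y z t A B C D E : R) : 0 <= x -> 0 <= y -> 0 <= z ->
  x + y + z = 1 -> 0 <= t <= 1 -> A < D -> A < E -> B < D -> B < E -> C < D -> C < E ->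
  x * A + y * B + z * C < (1 - t) * D + t * E.
Proof.
move=> x0 y0 z0 xyz t01 AD AE BD BE CD CE.
have lt M : A < M -> B < M -> C < M -> x * A + y * B + z * C < M.
  move=> AM BM CM; have -> : M = x * M + y * M + z * M by rewrite -!mulrDl xyz mul1r.
  have hx : x * A <= x * M by rewrite ler_wpM2l // ltW.
  have hy : y * B <= y * M by rewrite ler_wpM2l // ltW.
  have hz : z * C <= z * M by rewrite ler_wpM2l // ltW.
  have [x1|x1] := ltrP 0 x; first by have := AM; rewrite -(ltr_pM2l x1); lra.
  have [y1|y1] := ltrP 0 y; first by have := BM; rewrite -(ltr_pM2l y1); lra.
  have z1 : 0 < z by lra.
  by have := CM; rewrite -(ltr_pM2l z1); lra.
have [DE|ED] := lerP D E; first by apply: lt_le_trans (lt D _ _ _) _ => //; nra.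
by apply: lt_le_trans (lt E _ _ _) _ => //; nra.
Qed.

Lemma separates_disjoint f a b c e X :
  separates f [:: a; b; c] [:: e.1; e.2] || separates f [:: e.1; e.2] [:: a; b; c] ->
  triangle (vec a) (vec b) (vec c) X -> segment (vec e.1) (vec e.2) X -> False.
Proof.
move=> sep [x [y [z [x0 y0 z0 xyz ->]]]] [t /= t01].
move=> /(congr1 (dot (vec f))); rewrite !(dotDr, dotZr) !dot_vec.
have q : 0 < 4^-1 :> R by rewrite invr_gt0.
case/orP: sep; rewrite /= !andbT.
  move=> /and3P[/andP[/zr_lt a1 /zr_lt a2] /andP[/zr_lt b1 /zr_lt b2] /andP[/zr_lt c1 /zr_lt c2]] h.
  have := @convex_lt x y z t (zr (zdot f a) / 4) (zr (zdot f b) / 4) (zr (zdot f c) / 4)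
    (zr (zdot f e.1) / 4) (zr (zdot f e.2) / 4) x0 y0 z0 xyz t01.
  by rewrite h ltxx !ltr_pM2r // => /(_ a1 a2 b1 b2 c1 c2).
move=> /andP[/and3P[/zr_lt a1 /zr_lt b1 /zr_lt c1] /and3P[/zr_lt a2 /zr_lt b2 /zr_lt c2]] h.
have := @convex_lt x y z t (- (zr (zdot f a) / 4)) (- (zr (zdot f b) / 4))
  (- (zr (zdot f c) / 4)) (- (zr (zdot f e.1) / 4)) (- (zr (zdot f e.2) / 4)) x0 y0 z0 xyz t01.
rewrite !mulrN -!opprD h ltxx !ltrN2 !ltr_pM2r // => /(_ a1 a2 b1 b2 c1 c2).
by [].
Qed.

Lemma misses_edgeP a b c e X : misses_edge a b c e ->
  triangle (vec a) (vec b) (vec c) X -> ~ segment (vec e.1) (vec e.2) X.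
Proof. by move=> /hasP[f _ h] tX eX; exact: separates_disjoint h tX eX. Qed.

Lemma missesP E a b c X : misses E a b c ->
  triangle (vec a) (vec b) (vec c) X -> ~ tube E X.
Proof. by move=> /allP h tX [e eE eX]; exact: misses_edgeP (h e eE) tX eX. Qed.

Section Transports.
Variables (G A : groupType) (chi : G -> A) (E : seq zedge) (T : V -> V -> G).
Hypothesis chiM : {morph chi : g h / (g * h)%g}.
Hypothesis Tflat : forall X, ~ tube E X -> flat_at T X.
Local Notation P a b := (transport T (vec a) (vec b)).

Lemma missesM a b c : misses E a b c -> (P a b * P b c = P a c)%g.
Proof. by move=> h; apply: (transportM Tflat) => X; exact: missesP. Qed.

Lemma pierced_meridian_vec a b c e : pierced_only_by E a b c e ->
  (forall X, segment (vec e.1) (vec e.2) X ->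
     ramified (fun Y Z => chi (T Y Z)) (tube E) X) ->
  chi (P a b * P b c * P c a)%g <> 1%g.
Proof.
move=> /and3P[eE /and5P[D1 D2 D3 V0 VS] /allP only] ram.
pose E' := [seq e' <- E | (e' != e) && (e' != swap e)].
have q : 0 < 8^-1 :> R by rewrite invr_gt0.
have zr0 : zr 0 = 0 by [].
apply: (@pierced_meridian R G A chi (tube E) (tube E') T chiM Tflat _ _ _
  (vec e.1) (vec e.2)) => //.
- by rewrite dot_cross_vec mulr_gt0 // -zr0; exact: zr_lt.
- by rewrite dot_cross_vec mulr_gt0 // -zr0; exact: zr_lt.
- by rewrite dot_cross_vec mulr_gt0 // -zr0; exact: zr_lt.
- by rewrite dot_cross_vec mulr_gt0 // -zr0; exact: zr_lt.
- by rewrite !dot_cross_vec -!mulrDl -!zrD ltr_pM2r //; exact: zr_lt.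
- move=> Q; split=> [[e' e'E h]|[h|[e' + h]]].
  + have [e'e|e'e] := eqVneq e' e; first by left; rewrite -e'e.
    have [e'e2|e'e2] := eqVneq e' (swap e).
      by left; apply: segmentC; move: h; rewrite e'e2.
    by right; exists e' => //; rewrite mem_filter e'e e'e2.
  + case/orP: eE => eE; first by exists e.
    by exists (swap e) => //; exact: segmentC.
  + by rewrite mem_filter => /andP[_ e'E]; exists e'.
- exact: tube_closed.
- move=> Q tQ [e' + h]; rewrite mem_filter => /andP[/andP[n1 n2] /only].
  by rewrite (negPf n1) (negPf n2) /= => /misses_edgeP/(_ tQ).
Qed.

End Transports.
End Realization.

Definition zpoint_of (v : lattice_point) : zpoint :=
  (Z.double (Z_of_int v.1.1), Z.double (Z_of_int v.1.2), Z.double (Z_of_int v.2)).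

Definition zedges (P : seq lattice_point) : seq zedge :=
  cyclic_edges (map zpoint_of P).

Section Lattice.
Variable R : realType.

Lemma lattice_vecE v : lattice_vec R v = vec R (zpoint_of v).
Proof.
apply/rowP => k; rewrite !mxE.
have zr_double n : zr R (Z.double (Z_of_int n)) / 2 = n%:~R.
  have -> : Z.double (Z_of_int n) = Z_of_int (n + n).
    by rewrite rmorphD /=; lia.
  by rewrite /zr Z_of_intK intrD; field.
by case: (ord3P k) => -> /=; rewrite zr_double.
Qed.

Lemma map_cyclic_edges (T U : Type) (f : T -> U) (s : seq T) :
  cyclic_edges (map f s) = [seq (f e.1, f e.2) | e <- cyclic_edges s].
Proof.
rewrite /cyclic_edges -map_rot; elim: s (rot 1 s) => [|x s IHs] [|y t] //=.
by rewrite IHs.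
Qed.
End Lattice.

(** Whichever of ga and gd reverses the orientation, their quotient is the reflection x |-> (ga.2 +
    gd.2) - x. The noncommutative Dehn relation thus becomes linear, without signs. *)
Lemma reflection_coordinates f (ga gb gc gd : dihedral) :
  is_reflection (ga * gd^-1)%g <> 1%g -> parity f (ga * gd^-1)%g <> 1%g ->
  (ga * gd^-1)%g = (gb * gc^-1)%g ->
  ga.2 + gd.2 = gb.2 + gc.2 /\ odd `|(ga.2 + gd.2)%R|%N = f.
Proof.
case: ga gb gc gd => ba xa [bb xb] [bc xc] [bd xd].
have mE (b b' : bool) (x y : int) :
    (((b, x) : dihedral) * ((b', y) : dihedral)^-1)%g =
    (b (+) b', x + sgz_of b (- sgz_of b' y)) :> dihedral by [].
rewrite !{}mE /is_reflection /parity /sgz_of /=.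
have one : (1%g : signs) = false by [].
rewrite !{}one.
case: ba bd => -[] //= _; case: f => /=; rewrite ?addbF ?addbT => + [];
  rewrite ?opprK; case: bb bc => -[] //= par _; rewrite ?opprK in par * => e;
  by split=> //; move: par; case: (odd _).
Qed.

(* The Dehn presentation: [o] is high above the diagram, [u] deep below it,   *)
(* and [region r] is the holonomy from [o] to [u] through the point [r].      *)
Section Dehn.
Variables (R : realType) (E : seq zedge) (o u : zpoint).
Local Notation V := 'rV[R]_3.
Variable T : V -> V -> dihedral.
Hypothesis Tflat : forall X, ~ tube E X -> flat_at T X.
Local Notation P a b := (transport T (vec R a) (vec R b)).
Implicit Types (a b c d r : zpoint).

Definition region r : dihedral := (P o r * P r u)%g.

Definition same_region a b := misses E o a b && misses E a b u.

Lemma same_regionP a b : same_region a b -> region a = region b.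
Proof.
move=> /andP[oab abu]; rewrite /region -(missesM Tflat oab) -mulgA.
by rewrite (missesM Tflat abu).
Qed.

(* The over strand separates [a, b] from [c, d], the under strand [a, d] from *)
(* [b, c], and the square [abcd] passes between the two strands.              *)
Definition crossing_ok (F : seq zedge) (x : zpoint * zpoint * zpoint * zpoint) :=
  let: (a, b, c, d) := x in
  [&& misses E o a b, misses E o c d, misses E a d u, misses E b c u,
      misses E a b c, misses E a c d, misses E o d d &
      has (pierced_only_by E o a d) (F ++ map swap F)].

(** Both sides reduce to the loop oa * ab * bc * oc^-1 through the gap between the two strands. *)
Lemma crossing_identity (G : groupType) (oa ab bc cd du oc cu : G) :
  (oa * (ab * bc * cd * du) * (oc * cd * du)^-1 =
   oa * ab * (bc * cu) * (oc * cu)^-1)%g.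
Proof. by rewrite !invgM !mulgA !mulgK. Qed.

Lemma crossing_relation F a b c d : crossing_ok F (a, b, c, d) ->
  (region a * (region d)^-1 = region b * (region c)^-1)%g.
Proof.
move=> /and5P[/(missesM Tflat) oab /(missesM Tflat) ocd /(missesM Tflat) adu].
move=> /(missesM Tflat) bcu /and4P[/(missesM Tflat) abc /(missesM Tflat) acd _ _].
rewrite /region -adu -bcu -oab -ocd -acd -abc; exact: crossing_identity.
Qed.

Lemma crossing_meridian (A : groupType) (chi : dihedral -> A) F a b c d :
  {morph chi : g h / (g * h)%g} -> crossing_ok F (a, b, c, d) ->
  (forall e X, e \in F -> segment (vec R e.1) (vec R e.2) X ->
     ramified (fun Y Z => chi (T Y Z)) (tube E) X) ->
  chi (region a * (region d)^-1)%g <> 1%g.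
Proof.
move=> chiM /and5P[oab ocd adu bcu /and4P[abc acd odd_ /hasP[e eF pe]]] ram.
have := pierced_meridian_vec chiM Tflat pe.
(* The triangle below the segment from a to d misses the link, so the lower halves of the two paths
   through the regions cancel. What remains is the boundary of a triangle pierced by the over
   strand. *)
have -> : (P o a * P a d * P d o = region a * (region d)^-1)%g.
  have -> : (P d o = (P o d)^-1)%g.
    apply: (transportV Tflat) => X [t /= t01 <-]; apply: (missesP odd_).
    by exists (1 - t), t, 0; split; [lra|lra|by []|lra|by rewrite scale0r addr0].
  by rewrite /region -(missesM Tflat adu) invgM !mulgA mulgK.
apply=> X eX; move: eF; rewrite mem_cat => /orP[eF|/mapP[e' e'F ee']].
  exact: ram eF eX.
by apply: ram e'F _; apply: segmentC; move: eX; rewrite ee'.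
Qed.

Lemma crossing_coordinates F a b c d f : crossing_ok F (a, b, c, d) ->
  (forall e X, e \in F -> segment (vec R e.1) (vec R e.2) X ->
     ramified (fun Y Z => is_reflection (T Y Z)) (tube E) X /\
     ramified (fun Y Z => parity f (T Y Z)) (tube E) X) ->
  (region a).2 + (region d).2 = (region b).2 + (region c).2 /\
  odd `|((region a).2 + (region d).2)%R|%N = f.
Proof.
move=> ok ram; have rel := crossing_relation ok.
have m1 := crossing_meridian is_reflectionM ok (fun e X eF eX => (ram e X eF eX).1).
have m2 := crossing_meridian (parityM f) ok (fun e X eF eX => (ram e X eF eX).2).
exact: reflection_coordinates m1 m2 rel.
Qed.

End Dehn.

(** * Diagrams of closed braids *)

Section Closures.
Variables (R : realType) (m n : nat) (w : braid_word) (L : link R m).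
Local Notation V := 'rV[R]_3.
Let Ps := braid_closure n w.

Definition closure_edges k := zedges (nth [::] (braid_closure n w) k).
Definition diagram_edges := flatten [seq zedges P | P <- braid_closure n w].

Lemma lattice_carrierP (P : seq lattice_point) (X : V) :
  carrier (map (lattice_vec R) P) X <->
  exists2 e, e \in zedges P & segment (vec R e.1) (vec R e.2) X.
Proof.
rewrite carrierP /zedges !map_cyclic_edges; split.
  move=> [e /mapP[e' he' ->]] /=; rewrite !lattice_vecE => h.
  by exists (zpoint_of e'.1, zpoint_of e'.2) => //; apply/mapP; exists e'.
move=> [e /mapP[e' he' ->]] /= h.
exists (lattice_vec R e'.1, lattice_vec R e'.2); last by rewrite /= !lattice_vecE.
by apply/mapP; exists e'.
Qed.

Hypothesis closureL : is_closure_of n w L.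

Lemma closure_vertices : exists s : seq nat, perm_eq s (iota 0 m) /\
  forall i : 'I_m, tnth L i = map (lattice_vec R) (nth [::] Ps (nth 0%N s i)).
Proof.
have /(perm_iotaP [::])[s sP LE] := closureL.
have sz : size Ps = m.
  by have := perm_size closureL; rewrite size_tuple size_map => <-.
rewrite size_map -/Ps sz in sP; exists s; split=> // i.
have ss : size s = m by rewrite (perm_size sP) size_iota.
rewrite (tnth_nth [::]) LE (nth_map 0%N) ?ss // (nth_map [::]) //.
have : nth 0%N s i \in iota 0 m by rewrite -(perm_mem sP) mem_nth ?ss.
by rewrite mem_iota sz.
Qed.

Lemma closure_index : exists s : seq nat,
  perm_eq s (iota 0 m) /\ forall i : 'I_m,
    carriers L i = [set X | exists2 e, e \in closure_edges (nth 0%N s i) &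
                      segment (vec R e.1) (vec R e.2) X].
Proof.
have [s [sP LE]] := closure_vertices; exists s; split=> // i.
by rewrite /carriers LE; apply/seteqP; split=> X /lattice_carrierP.
Qed.

Lemma total_closure : total (carriers L) = tube (R := R) diagram_edges.
Proof.
have [s [sP LE]] := closure_index.
have sz : size Ps = m.
  by have := perm_size closureL; rewrite size_tuple size_map => <-.
have ss : size s = m by rewrite (perm_size sP) size_iota.
apply/seteqP; split=> X.
  move=> [i]; rewrite LE => -[e eE eX]; exists e => //.
  apply/flattenP; exists (closure_edges (nth 0%N s i)) => //.
  apply/mapP; exists (nth [::] Ps (nth 0%N s i)) => //; apply: mem_nth.
  have : nth 0%N s i \in iota 0 m by rewrite -(perm_mem sP) mem_nth ?ss.
  by rewrite mem_iota sz.
move=> [e /flattenP[es /mapP[P PP ->] eP] eX].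
have [k km PE] : exists2 k, (k < m)%N & nth [::] Ps k = P.
  by exists (index P Ps); rewrite ?nth_index // -sz index_mem.
have ks : k \in s by rewrite (perm_mem sP) mem_iota.
have ki : (index k s < m)%N by rewrite -ss index_mem.
exists (Ordinal ki); rewrite LE; exists e => //.
by rewrite /= nth_index // /closure_edges -/Ps PE.
Qed.

Lemma closure_colors : colorable (carriers L) ->
  exists (c : nat -> bool) (T : V -> V -> dihedral),
  [/\ exists k l, [/\ (k < m)%N, (l < m)%N & c k != c l],
      forall X, ~ tube diagram_edges X -> flat_at T X &
      forall k, (k < m)%N -> forall e X, e \in closure_edges k ->
        segment (vec R e.1) (vec R e.2) X ->
        ramified (fun Y Z => is_reflection (T Y Z)) (tube diagram_edges) X /\
        ramified (fun Y Z => parity (c k) (T Y Z)) (tube diagram_edges) X].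
Proof.
move=> [f [T [[i [j fij]] Tflat ram]]]; rewrite total_closure in Tflat ram.
have [s [sP LE]] := closure_index.
have ss : size s = m by rewrite (perm_size sP) size_iota.
have us : uniq s by rewrite (perm_uniq sP) iota_uniq.
have sm (i' : 'I_m) : (nth 0%N s i' < m)%N.
  have : nth 0%N s i' \in iota 0 m by rewrite -(perm_mem sP) mem_nth ?ss.
  by rewrite mem_iota.
(* The colors are reindexed by the components of the braid closure; [i] is a default outside the
   range. *)
pose c k := f (insubd i (index k s)).
have cs (i' : 'I_m) : c (nth 0%N s i') = f i'.
  by rewrite /c index_uniq ?ss // valKd.
exists c, T; split=> //.
  by exists (nth 0%N s i), (nth 0%N s j); rewrite !cs.
move=> k km e X ek eX.
have ks : k \in s by rewrite (perm_mem sP) mem_iota.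
have ki : (index k s < m)%N by rewrite -ss index_mem.
have := ram (Ordinal ki) X; rewrite LE /= nth_index //.
have -> : f (Ordinal ki) = c k by rewrite -cs /= nth_index.
by apply; exists e.
Qed.

End Closures.

Notation quadrangle := (zpoint * zpoint * zpoint * zpoint)%type.

Section Corners.
Local Open Scope Z_scope.

(** The regions around the crossing (4i+2, 4k+2), listed cyclically from the west. The direction
    depends on the sign of the letter, so that the over strand always separates the first two from
    the last two. *)
Definition corners (k : nat) (a : nat * bool) : quadrangle :=
  let x := Z.of_nat (4 * a.1) in let y := Z.of_nat (4 * k) in
  let west := (x, y + 2, 0) in let east := (x + 4, y + 2, 0) in
  let south := (x + 2, y, 0) in let north := (x + 2, y + 4, 0) in
  if a.2 then (west, north, east, south) else (west, south, east, north).

End Corners.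

Fixpoint all_prop (T : Type) (Q : T -> Prop) (s : seq T) : Prop :=
  if s is x :: s' then Q x /\ all_prop Q s' else True.

Lemma all_propP (T : Type) (a : pred T) (Q : T -> Prop) s :
  (forall x, a x -> Q x) -> all a s -> all_prop Q s.
Proof. by move=> aQ; elim: s => //= x s IHs /andP[/aQ ? /IHs]. Qed.

Section Diagram.
Variables (R : realType) (m n : nat) (w : braid_word) (L : link R m).
Variables (o u : zpoint) (overs : seq nat) (regions : seq (seq zpoint)).

(* [overs] lists the components of the over strands at the crossings.         *)
Definition diagram_crossings := zip (mkseq (fun k => corners k (nth (0%N, true) w k)) (size w)) overs.

Let E := diagram_edges n w.

Definition diagram_ok :=
  all (fun x => (x.2 < m)%N && crossing_ok E o u (closure_edges n w x.2) x.1) diagram_crossings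
  && all (fun r => path (same_region E o u) (head o r) (behead r)) regions.

Lemma colored_diagram : is_closure_of n w L -> diagram_ok -> colorable (carriers L) ->
  exists (c : nat -> bool) (x : zpoint -> int),
  [/\ exists k l, [/\ (k < m)%N, (l < m)%N & c k != c l],
      all_prop (fun y : quadrangle * nat => let: (p, q, r, s) := y.1 in
        x p + x s = x q + x r /\ odd `|(x p + x s)%R|%N = c y.2) diagram_crossings &
      all_prop (fun r => all_prop (fun a => x a = x (head o r)) r) regions].
Proof.
move=> closureL /andP[xs_ok rs_ok] /(closure_colors closureL)[c [T [cN Tflat ram]]].
pose x r := (region o u T r).2; exists c, x; split=> //.
  apply: all_propP xs_ok => -[[[[p q] r] s] k] /= /andP[km ok].
  exact: (crossing_coordinates Tflat ok (ram k km)).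
have eq_x a b : same_region E o u a b -> x b = x a.
  by move=> ab; rewrite /x (same_regionP Tflat ab).
apply: all_propP rs_ok => -[//|b r] /= h; split=> //.
elim: r b h => [//|a r IHr b /andP[/eq_x ba h]].
by split=> //; rewrite -ba; exact: IHr.
Qed.

End Diagram.

Section Data.
Local Open Scope Z_scope.

(** Each list is a walk inside one region of the plane diagram through the crossing corners that lie
    in it. Odd coordinates run beside the braid and between the closing arcs, whose vertices all
    have even ones. *)
Definition hopf_regions : seq (seq zpoint) :=
  [:: [:: (4, 2, 0); (2, 2, 0); (2, 6, 0); (4, 6, 0)];
      [:: (8, 2, 0); (9, 2, 0); (9, 6, 0); (8, 6, 0)];
      [:: (6, 8, 0); (6, 11, 0); (11, 11, 0); (11, -3, 0); (6, -3, 0); (6, 0, 0)]].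

Definition whitehead_regions : seq (seq zpoint) :=
  [:: [:: (4, 2, 0); (2, 2, 0); (2, 10, 0); (4, 10, 0)];
      [:: (12, 6, 0); (13, 6, 0); (13, 14, 0); (12, 14, 0); (13, 14, 0); (13, 18, 0); (12, 18, 0)];
      [:: (6, 4, 0); (6, 6, 0); (8, 6, 0); (6, 6, 0); (6, 8, 0)];
      [:: (6, 12, 0); (6, 14, 0); (8, 14, 0); (6, 14, 0); (6, 18, 0); (8, 18, 0); (6, 18, 0);
          (6, 25, 0); (17, 25, 0); (17, -5, 0); (6, -5, 0); (6, 0, 0)];
      [:: (10, 8, 0); (10, 10, 0); (8, 10, 0); (10, 10, 0); (10, 12, 0)];
      [:: (10, 20, 0); (10, 23, 0); (15, 23, 0); (15, -3, 0); (10, -3, 0); (10, 2, 0); (8, 2, 0);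
          (10, 2, 0); (10, 4, 0)]].

Definition borromean_regions : seq (seq zpoint) :=
  [:: [:: (4, 2, 0); (2, 2, 0); (2, 10, 0); (4, 10, 0); (2, 10, 0); (2, 18, 0); (4, 18, 0)];
      [:: (12, 6, 0); (13, 6, 0); (13, 14, 0); (12, 14, 0); (13, 14, 0); (13, 22, 0); (12, 22, 0)];
      [:: (6, 4, 0); (6, 6, 0); (8, 6, 0); (6, 6, 0); (6, 8, 0)];
      [:: (6, 12, 0); (6, 14, 0); (8, 14, 0); (6, 14, 0); (6, 16, 0)];
      [:: (6, 20, 0); (6, 22, 0); (8, 22, 0); (6, 22, 0);
          (6, 29, 0); (17, 29, 0); (17, -5, 0); (6, -5, 0); (6, 0, 0)];
      [:: (10, 8, 0); (10, 10, 0); (8, 10, 0); (10, 10, 0); (10, 12, 0)];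
      [:: (10, 16, 0); (10, 18, 0); (8, 18, 0); (10, 18, 0); (10, 20, 0)];
      [:: (10, 24, 0); (10, 27, 0); (15, 27, 0); (15, -3, 0); (10, -3, 0); (10, 2, 0); (8, 2, 0);
          (10, 2, 0); (10, 4, 0)]].

(** A viewpoint far away compared with the heights -2, 0 and 2 of the vertices, so that triangles
    through it tilt little near the diagram. The odd coordinates put it in general position. *)
Definition above n (w : braid_word) (h : Z) : zpoint :=
  (Z.of_nat (4 * n + 1), Z.of_nat (2 * size w + 1), h).

End Data.

Lemma hopf_diagram : let w := [:: sigma 1; sigma 1] in
  diagram_ok 2 2 w (above 2 w 40) (above 2 w (-40)) [:: 0%N; 1%N] hopf_regions.
Proof. by vm_compute. Qed.

Lemma whitehead_diagram : let w := [:: sigma 1; sigmaV 2; sigma 1; sigmaV 2; sigmaV 2] in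
  diagram_ok 2 3 w (above 3 w 40) (above 3 w (-40)) [:: 0; 0; 1; 0; 1]%N whitehead_regions.
Proof. by vm_compute. Qed.

Lemma borromean_diagram :
  let w := [:: sigma 1; sigmaV 2; sigma 1; sigmaV 2; sigma 1; sigmaV 2] in
  diagram_ok 3 3 w (above 3 w 40) (above 3 w (-40)) [:: 0; 2; 1; 0; 2; 1]%N borromean_regions.
Proof. by vm_compute. Qed.

Section NotColorable.
Variable R : realType.

(** The relations say that [x] is an integral Dehn coloring of the regions. The sums x p + x s are
    the Fox colors of the over strands and agree because the determinant is nonzero: here the two
    crossings give L + N = B + M and L + B = N + M, so N = B. The linear arithmetic in the two
    lemmas below has the same reason, with determinants 8 and 16. *)
Lemma hopf_not_colorable (L : link R 2) : is_hopf_link L -> ~ colorable (carriers L).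
Proof.
move=> isL /(colored_diagram isL hopf_diagram)[c [x [[k [l [k2 l2 kl]]] /= crs regs]]].
have c1 : c 1%N = c 0%N by lia.
have cE j : (j < 2)%N -> c j = c 0%N by case: j => [|[|]].
by rewrite (cE k) // (cE l) // eqxx in kl.
Qed.

Lemma whitehead_not_colorable (L : link R 2) :
  is_whitehead_link L -> ~ colorable (carriers L).
Proof.
move=> isL /(colored_diagram isL whitehead_diagram)[c [x [[k [l [k2 l2 kl]]] /= crs regs]]].
have c1 : c 1%N = c 0%N by lia.
have cE j : (j < 2)%N -> c j = c 0%N by case: j => [|[|]].
by rewrite (cE k) // (cE l) // eqxx in kl.
Qed.

Lemma borromean_not_colorable (L : link R 3) :
  is_borromean_link L -> ~ colorable (carriers L).
Proof.
move=> isL /(colored_diagram isL borromean_diagram)[c [x [[k [l [k3 l3 kl]]] /= crs regs]]].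
have [c1 c2] : c 1%N = c 0%N /\ c 2%N = c 0%N by lia.
have cE j : (j < 3)%N -> c j = c 0%N by case: j => [|[|[|]]].
by rewrite (cE k) // (cE l) // eqxx in kl.
Qed.

End NotColorable.

(** * The trivial link *)

Lemma dihedral_reflectionK (c : int) : (((true, c) : dihedral) * ((true, c) : dihedral) = 1)%g.
Proof. by congr (_, _); rewrite /= subrr. Qed.

Lemma nbhs_forall (M : topologicalType) (I : finType) (x : M) (f : I -> set M) :
  (forall i, nbhs x (f i)) -> nbhs x [set y | forall i, f i y].
Proof. by move=> fx; apply: filter_forall. Qed.

(** * Systems that jump across walls *)

Section Walls.
Variables (R : realType) (I : finType).
Local Notation V := 'rV[R]_3.
Variables (g h : I -> V -> R) (r : I -> dihedral).
Hypothesis g_cts : forall i, continuous (g i).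
Hypothesis h_cts : forall i, continuous (h i).
Hypothesis rr : forall i, (r i * r i = 1)%g.

(* Crossing the surface [h i = 0] inside the region [g i > 0] multiplies by   *)
(* [r i]; the local system branches along the curves [g i = h i = 0].         *)
Definition wall_crossed i (Y Z : V) := (0 < g i Y) && ((0 < h i Y) != (0 < h i Z)).

(** The walls will be disjoint, so that at most one of them separates two close points and the
    choice made by [pick] is harmless. *)
Definition wall_system (Y Z : V) : dihedral :=
  if [pick i | wall_crossed i Y Z] is Some i then r i else 1%g.

Lemma sign_near (f : V -> R) X : continuous f -> f X != 0 ->
  nbhs X [set Y | (0 < f Y) = (0 < f X) /\ f Y != 0].
Proof.
move=> cf; case: (ltgtP (f X) 0) => // fX _.
  apply: filterS (nbhs_neg cf fX) => Y /= fY.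
  by split; [apply/idP/idP; slra|rewrite lt_eqF].
apply: filterS (nbhs_pos cf fX) => Y /= fY.
by split; [apply/idP/idP; slra|rewrite gt_eqF].
Qed.

Lemma wall_systemE i Y Z : (forall j, j != i -> (0 < h j Y) = (0 < h j Z)) ->
  wall_system Y Z = if wall_crossed i Y Z then r i else 1%g.
Proof.
move=> same; rewrite /wall_system; case: pickP => [j|/(_ i) -> //].
have [-> -> //|ji] := eqVneq j i.
by rewrite /wall_crossed (same j ji) eqxx andbF.
Qed.

(** Off the branch curve, g i or h i keeps its sign nearby. If h i does, there is no jump; if g i
    does, the jumps depend only on the sides of the wall and compose because r i is an involution.
    This is also why testing g i at [Y] alone suffices. *)
Lemma wall_system_flat i X : (forall j, j != i -> h j X != 0) ->
  g i X != 0 \/ h i X != 0 -> flat_at wall_system X.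
Proof.
move=> hX ghX.
have near_same : nbhs X [set Y | forall j, j != i -> (0 < h j Y) = (0 < h j X)].
  apply: (nbhs_forall (f := fun j Y => j != i -> (0 < h j Y) = (0 < h j X))) => j.
  have [->|ji] := eqVneq j i; first exact: filterE.
  by apply: filterS (sign_near (@h_cts j) (hX j ji)) => Y [].
have [U UX TU] : exists2 U, nbhs X U & forall Y Z, U Y -> U Z ->
    (if wall_crossed i Y Z then r i else 1%g) =
    if (0 < g i X) && ((0 < h i Y) != (0 < h i Z)) then r i else 1%g.
  case: ghX => nz.
    exists [set Y | (0 < g i Y) = (0 < g i X)].
      by apply: filterS (sign_near (@g_cts i) nz) => Y [].
    by move=> Y Z /= gY _; rewrite /wall_crossed gY.
  exists [set Y | (0 < h i Y) = (0 < h i X)].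
    by apply: filterS (sign_near (@h_cts i) nz) => Y [].
  by move=> Y Z /= hY hZ; rewrite /wall_crossed hY hZ eqxx !andbF.
exists (U `&` [set Y | forall j, j != i -> (0 < h j Y) = (0 < h j X)]).
  exact: filterI.
move=> Y Z W [UY sY] [UZ sZ] [UW sW].
have sys A B : U A -> U B -> (forall j, j != i -> (0 < h j A) = (0 < h j X)) ->
    (forall j, j != i -> (0 < h j B) = (0 < h j X)) -> wall_system A B =
    if (0 < g i X) && ((0 < h i A) != (0 < h i B)) then r i else 1%g.
  move=> UA UB sA sB; rewrite (wall_systemE (i := i)) ?TU // => j ji.
  by rewrite sA ?sB.
rewrite !sys //; case: (0 < g i X) => /=; last by rewrite mulg1.
by case: (0 < h i Y); case: (0 < h i Z); case: (0 < h i W);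
  rewrite /= ?mulg1 ?mul1g ?rr.
Qed.

Lemma segment_const (S : Type) (f : V -> S) A B :
  (forall t : R, 0 <= t <= 1 -> exists2 W, nbhs (line A B t) W &
     forall u : R, 0 <= u <= 1 -> W (line A B u) -> f (line A B u) = f (line A B t)) ->
  f A = f B.
Proof.
move=> loc; have := @unit_interval_const R S (fun t => f (line A B t)).
rewrite line0 line1; apply => t t01.
have [W Wt fW] := loc t t01; exists (line A B @^-1` W).
  exact: line_continuous.
by move=> u Wu u01; apply: fW.
Qed.

(** In the plane through p spanned by v and N, g i has the sign of the first coordinate and h i is
    the second. A section is followed around the triangle (t, q), (-t, 0), (t, -q), which encloses
    p: no wall is crossed on its first two sides and one wall on the third, so chi (r i) would be
    trivial. *)
Lemma wall_ramified (A : groupType) (chi : dihedral -> A) K i p v N :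
  {morph chi : x y / (x * y)%g} -> chi (r i) <> 1%g ->
  (forall j, j != i -> h j p != 0) ->
  (forall X, K X -> exists j, g j X = 0 /\ h j X = 0) ->
  (forall t, h i (p + t *: v) = 0) ->
  (forall t, 0 < t <= 1 -> 0 < g i (p + t *: v) /\ g i (p + (- t) *: v) < 0) ->
  (forall X t, g i (X + t *: N) = g i X /\ h i (X + t *: N) = h i X + t) ->
  ramified (fun Y Z => chi (wall_system Y Z)) K p.
Proof.
move=> chiM chir hp KE hv gv vert U pU [s sU].
pose same : set V := [set Y | forall j, j != i ->
    (0 < h j Y) = (0 < h j p) /\ h j Y != 0].
have near_same : nbhs p same.
  apply: (nbhs_forall (f := fun j Y => j != i ->
    (0 < h j Y) = (0 < h j p) /\ h j Y != 0)) => j.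
  have [->|ji] := eqVneq j i; first exact: filterE.
  by apply: filterS (sign_near (@h_cts j) (hp j ji)) => Y.
have : nbhs p (U `&` same) by exact: filterI.
move=> /nbhs_ballP[e /= e0 eU].
(* The bounds [t] and [q] keep the rectangle inside the ball; t <= 1 is the range in which the sign
   of g i is known. *)
pose t := Num.min 1 (e / (2 * (1 + `|v|))).
have v0 := normr_ge0 v; have N0 := normr_ge0 N.
have t0 : 0 < t by rewrite lt_min ltr01 divr_gt0 //; slra.
have t1 : t <= 1 by rewrite ge_min lexx.
have te : t * `|v| < e / 2.
  have : t * (2 * (1 + `|v|)) <= e.
    by rewrite -ler_pdivlMr ?ge_min ?lexx ?orbT //; slra.
  by slra.
pose q := e / (2 * (1 + `|N|)).
have q0 : 0 < q by rewrite divr_gt0 //; slra.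
have qe : q * `|N| < e / 2.
  have : q * (2 * (1 + `|N|)) = e by rewrite /q mulfVK // gt_eqF //; slra.
  by slra.
pose pt x y := p + x *: v + y *: N.
have hpt x y : h i (pt x y) = y by rewrite /pt (vert _ y).2 hv add0r.
have gpt x y : g i (pt x y) = g i (p + x *: v) by rewrite /pt (vert _ y).1.
have inb x y : - t <= x <= t -> - q <= y <= q -> ball p e (pt x y).
  move=> xt yq; rewrite -ball_normE /= /pt.
  have -> : p - (p + x *: v + y *: N) = - (x *: v + y *: N).
    by rewrite -addrA opprD addrA subrr sub0r.
  rewrite normrN; apply: le_lt_trans (ler_normD _ _) _; rewrite !normrZ.
  have : `|y| * `|N| <= q * `|N| by rewrite ler_wpM2r // ler_norml.
  have : `|x| * `|v| <= t * `|v| by rewrite ler_wpM2r // ler_norml.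
  by slra.
have lpt x0 y0 x1 y1 u : line (pt x0 y0) (pt x1 y1) u =
    pt ((1 - u) * x0 + u * x1) ((1 - u) * y0 + u * y1).
  by rewrite /line /pt; apply/rowP => k; rewrite !coordE; ring.
have gpos x : 0 < x <= t -> 0 < g i (p + x *: v) by move=> xt; apply: (gv x _).1; slra.
have gneg x : - t <= x < 0 -> g i (p + x *: v) < 0.
  by move=> xt; have := (gv (- x) _).2; rewrite opprK; apply; slra.
have step x y : - t <= x <= t -> - q <= y <= q -> x != 0 \/ y != 0 ->
    exists2 W, nbhs (pt x y) W & forall x' y', W (pt x' y') ->
      - t <= x' <= t -> - q <= y' <= q -> x' != 0 \/ y' != 0 ->
      s (pt x' y') = (s (pt x y) *
        chi (if wall_crossed i (pt x y) (pt x' y') then r i else 1%g))%g.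
  have off x0 y0 : - t <= x0 <= t -> - q <= y0 <= q -> x0 != 0 \/ y0 != 0 ->
      (U `\` K) (pt x0 y0).
    move=> xt yq nz; have [UZ hZ] := eU _ (inb x0 y0 xt yq).
    split=> // /KE[j [gj hj]]; have [ji|ji] := eqVneq j i; last first.
      by have [_] := hZ j ji; rewrite hj eqxx.
    move: gj hj; rewrite ji gpt hpt => gj hj; case: nz; last by rewrite hj eqxx.
    case: (ltgtP x0 0) => // x00 _; last by have := gpos x0; rewrite gj ltxx; slra.
    by have := gneg x0; rewrite gj ltxx; slra.
  move=> xt yq nz; have [W WX sW] := sU _ (off x y xt yq nz).
  exists W => // x' y' WY xt' yq' nz'.
  rewrite (sW _ _ (nbhs_singleton WX) (off x y xt yq nz) WY (off x' y' xt' yq' nz')).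
  rewrite (wall_systemE (i := i)) // => j ji.
  by rewrite ((eU _ (inb x y xt yq)).2 j ji).1 ((eU _ (inb x' y' xt' yq')).2 j ji).1.
have chi1 : chi 1%g = 1%g by exact: morph1.
have walk (f : V -> A) x0 y0 x1 y1 :
    - t <= x0 <= t -> - q <= y0 <= q -> - t <= x1 <= t -> - q <= y1 <= q ->
    (forall u : R, 0 <= u <= 1 -> (1 - u) * x0 + u * x1 != 0 \/ (1 - u) * y0 + u * y1 != 0) ->
    (forall u : R, 0 <= u <= 1 ->
       let X := line (pt x0 y0) (pt x1 y1) u in
       exists2 W, nbhs X W & forall u' : R, 0 <= u' <= 1 ->
       let Y := line (pt x0 y0) (pt x1 y1) u' in W Y ->
       s Y = (s X * chi (if wall_crossed i X Y then r i else 1%g))%g -> f Y = f X) ->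
    f (pt x0 y0) = f (pt x1 y1).
  move=> hx0 hy0 hx1 hy1 nz fs; apply: segment_const => u u01.
  have [W1 W1X fW] := fs u u01.
  have [|||W2 W2X sW] := step ((1 - u) * x0 + u * x1) ((1 - u) * y0 + u * y1).
  - snra.
  - snra.
  - exact: nz.
  rewrite -lpt in W2X sW.
  exists (W1 `&` W2) => [|u' u01' [W1Y W2Y]]; first exact: filterI.
  apply: fW => //=; move: W2Y; rewrite (lpt _ _ _ _ u') => W2Y.
  by apply: sW => //; [snra|snra|exact: nz].
have s1 : s (pt t q) = s (pt (- t) 0).
  apply: walk; [slra|slra|slra|slra| |].
    move=> u u01; have [->|u1] := eqVneq u 1; [left|right]; first by rewrite lt_eqF //; slra.
    by rewrite mulr0 addr0 mulf_neq0 ?gt_eqF // subr_gt0 lt_neqAle u1; slra.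
  move=> u u01 X; have [gX|gX] := ltrP 0 (g i X); last first.
    exists setT; first exact: filterT.
    by move=> u' u01' Y _ ->; rewrite /wall_crossed ltNge gX /= chi1 mulg1.
  have hX : 0 < h i X.
    rewrite /X lpt hpt; move: gX; rewrite /X lpt gpt => gX.
    rewrite mulr0 addr0 mulr_gt0 //; case: (ltgtP u 1) => [|u1|u1]; [slra|slra|].
    by have := gneg (- t); rewrite u1 in gX; move: gX; rewrite subrr mul0r add0r mul1r; slra.
  exists [set Y | 0 < h i Y]; first exact: nbhs_pos.
  by move=> u' u01' Y /= hY ->; rewrite /wall_crossed hX hY /= andbF chi1 mulg1.
have s2 : s (pt (- t) 0) = s (pt t (- q)).
  apply: walk; [slra|slra|slra|slra| |].
    move=> u u01; have [->|u1] := eqVneq u 0; [left|right].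
      by rewrite lt_eqF //; slra.
    rewrite mulr0 add0r mulrN oppr_eq0 mulf_neq0 ?gt_eqF //.
    by rewrite lt_neqAle eq_sym u1; slra.
  move=> u u01 X; exists setT; first exact: filterT.
  move=> u' u01' Y _ ->.
  have hn (z : R) : 0 <= z <= 1 -> (0 < h i (line (pt (- t) 0) (pt t (- q)) z)) = false.
    by move=> z01; rewrite lpt hpt; apply/negbTE; rewrite -leNgt; snra.
  by rewrite /wall_crossed !hn // andbF chi1 mulg1.
pose f X := (s X * chi (if 0 < h i X then r i else 1%g))%g.
have s3 : f (pt t (- q)) = f (pt t q).
  apply: walk; [slra|slra|slra|slra| |].
    by move=> u u01; left; rewrite gt_eqF //; snra.
  move=> u u01 X; exists setT; first exact: filterT.
  move=> u' u01' Y _ sY; rewrite /f sY /wall_crossed.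
  have -> : 0 < g i X.
    by rewrite /X lpt gpt; apply: gpos; snra.
  rewrite -!mulgA -!chiM; congr (s X * chi _)%g.
  by case: (0 < h i X); case: (0 < h i Y); rewrite /= ?mulg1 ?mul1g ?rr.
apply: chir; move: s3; rewrite /f !hpt q0 ltNge oppr_le0 ltW //= chi1 mulg1 -s2 -s1.
by move=> /esym; rewrite -{2}[s _]mulg1 => /mulgI.
Qed.
End Walls.

(** * The wall bounded by a triangle *)

Section TrivialLink.
Variable R : realType.
Local Notation V := 'rV[R]_3.
Implicit Types (A B C X p n v N : V).

(** If the vertices were collinear, B = (1 - k) A + k C, the middle one would lie on the edge
    joining the two others. It is A, B or C according to the position of k relative to 0 and 1. *)
Lemma triangle_free A B C : simple_polygon [:: A; B; C] -> free [:: B - A; C - A].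
Proof.
move=> [/= ABC sP]; move: ABC; rewrite !inE negb_or !andbT => /andP[/andP[AB AC] BC].
have eAB : (A, B) \in cyclic_edges [:: A; B; C] by rewrite inE eqxx.
have eBC : (B, C) \in cyclic_edges [:: A; B; C] by rewrite !inE eqxx orbT.
have eCA : (C, A) \in cyclic_edges [:: A; B; C] by rewrite !inE eqxx !orbT.
rewrite free_cons seq1_free span_seq1 subr_eq0 eq_sym AC andbT.
apply/negP => /vlineP[k BE].
have BE' : B = (1 - k) *: A + k *: C.
  by rewrite -[B](subrK A) BE; apply/rowP => i; rewrite !coordE; ring.
have [k0|k0] := ltrP k 0.
  have k1 : 1 - k != 0 by rewrite gt_eqF //; slra.
  case: (sP _ _ A eAB eBC); first exact: segmentl.
  - exists (- k / (1 - k)); first by rewrite /= divr_ge0 ?ler_pdivrMr; slra.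
    by rewrite BE'; apply/rowP => i; rewrite !coordE; field.
  - by move=> [e _]; rewrite e eqxx in AB.
  - by rewrite /= !inE (negPf AB) (negPf AC) => -[].
have [k1|k1] := lerP k 1.
  case: (sP _ _ B eAB eCA); first exact: segmentr.
  - apply: segmentC; exists k => //=; slra.
  - by move=> [e _]; rewrite e eqxx in AC.
  - by rewrite /= !inE => -[_ /orP[] /eqP e]; move: AB AC BC; rewrite e ?eqxx ?andbF.
have kN : k != 0 by rewrite gt_eqF //; slra.
case: (sP _ _ C eAB eBC).
- exists k^-1; first by rewrite /= invr_ge0 invf_le1; slra.
  by rewrite BE'; apply/rowP => i; rewrite !coordE; field.
- exact: segmentr.
- by move=> [e _]; rewrite e eqxx in AB.
- by rewrite /= !inE => -[/orP[] /eqP e _]; move: AB AC BC; rewrite e ?eqxx ?andbF.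
Qed.

Definition on_sides (a b c : R) :=
  [\/ [/\ a = 0, 0 <= b & 0 <= c], [/\ b = 0, 0 <= a & 0 <= c]
    | [/\ c = 0, 0 <= a & 0 <= b]].

Lemma min3_eq0 (a b c : R) : Num.min a (Num.min b c) = 0 <-> on_sides a b c.
Proof.
case: (leP b c) => h; [case: (leP a b)|case: (leP a c)] => h';
  split=> [e|[[]|[]|[]]]; try lra.
- by constructor 1; split; lra.
- by constructor 2; split; lra.
- by constructor 1; split; lra.
- by constructor 3; split; lra.
Qed.

(** Starting on the boundary of a triangle, a step towards the barycenter makes all barycentric
    coordinates positive; the opposite step makes a vanishing one negative. *)
Lemma min3_center (b c t : R) : on_sides (1 - b - c) b c -> 0 < t <= 1 ->
  let f (s : R) := let b' := (1 - s) * b + s * (1 / 3) in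
    let c' := (1 - s) * c + s * (1 / 3) in
    Num.min (1 - b' - c') (Num.min b' c') in
  0 < f t /\ f (- t) < 0.
Proof.
move=> gp t01 /=; rewrite !lt_min !gt_min; split.
  by case: gp => -[]; nra.
by case: gp => -[] *; apply/or3P; [constructor 1|constructor 2|constructor 3]; nra.
Qed.

(** [g] is the smallest barycentric coordinate, extended constantly in the direction [N] transverse
    to the plane. [v] points to the barycenter. *)
Lemma triangle_wall A B C n (c : R) : free [:: B - A; C - A] -> n != 0 ->
  dot n A = c -> dot n B = c -> dot n C = c ->
  exists (g : V -> R) (N : V),
  [/\ continuous g,
      forall X, carrier [:: A; B; C] X <-> g X = 0 /\ dot n X = c,
      forall X t, g (X + t *: N) = g X /\ dot n (X + t *: N) = dot n X + t &
      forall p, carrier [:: A; B; C] p -> exists v, forall t,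
        dot n (p + t *: v) = c /\
        (0 < t <= 1 -> 0 < g (p + t *: v) /\ g (p + (- t) *: v) < 0)].
Proof.
move=> ABC n0 nA nB nC.
have [u [v [w [m [frame [ua va wa] [ub vb wb] [um vm wm]]]]]] := dual_frame ABC.
have nAB : dot n (B - A) = 0 by rewrite dotBr nA nB subrr.
have nAC : dot n (C - A) = 0 by rewrite dotBr nA nC subrr.
(* Otherwise n would be orthogonal to the whole frame, in particular to itself. *)
have nm : dot n m != 0.
  apply: contraNneq n0 => nm0.
  have nn : dot n n = 0.
    rewrite {2}(frame n) (dotDr _ (_ + _)) (dotDr _ (_ *: (B - A))) !dotZr nAB nAC nm0; ring.
  have h (x : R) : x * x = 0 -> x = 0 by move/eqP; rewrite mulf_eq0 orbb => /eqP.
  apply/eqP/rowP => k; rewrite [RHS]mxE; move: nn; rewrite dotE => nn.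
  by case: (ord3P k) => ->; apply: h; snra.
pose lB X := dot u (X - A); pose lC X := dot v (X - A).
pose lA X := 1 - lB X - lC X.
pose g X := Num.min (lA X) (Num.min (lB X) (lC X)).
pose N := (dot n m)^-1 *: m.
have shift X x y : X + x *: y - A = (X - A) + x *: y by rewrite addrAC.
have c_dot a : continuous (fun X : V => dot a (X - A)).
  have -> : (fun X : V => dot a (X - A)) = (fun X => dot a X - dot a A).
    by apply/funext => X; rewrite dotBr.
  by apply: ctsB; [exact: dot_continuous|exact: cst_continuous].
have planeE X : dot n X = c -> X = A + lB X *: (B - A) + lC X *: (C - A).
  move=> nX; have hX := frame (X - A).
  have w0 : dot w (X - A) = 0.
    have : dot n (X - A) = dot w (X - A) * dot n m.
      rewrite {1}hX (dotDr _ (_ + _)) (dotDr _ (_ *: (B - A))) !dotZr nAB nAC; ring.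
    by rewrite dotBr nX nA subrr => /esym/eqP; rewrite mulf_eq0 (negPf nm) orbF => /eqP.
  rewrite w0 scale0r addr0 in hX.
  by rewrite -addrA -hX addrC subrK.
have lBl X Y t : lB (line X Y t) = (1 - t) * lB X + t * lB Y by exact: line_dot.
have lCl X Y t : lC (line X Y t) = (1 - t) * lC X + t * lC Y by exact: line_dot.
have nl X Y t : dot n (line X Y t) = (1 - t) * dot n X + t * dot n Y.
  by rewrite /line dotDr !dotZr.
have A0 : lB A = 0 /\ lC A = 0.
  by rewrite /lB /lC subrr -(scale0r A) !dotZr !mul0r.
have B0 : lB B = 1 /\ lC B = 0 by [].
have C0 : lB C = 0 /\ lC C = 1 by [].
case: A0 B0 C0 => [BA CA] [BB CB] [BC CC].
have g_eq0 X : g X = 0 <-> on_sides (lA X) (lB X) (lC X) by exact: min3_eq0.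
have car X : carrier [:: A; B; C] X <-> g X = 0 /\ dot n X = c.
  rewrite carrierP g_eq0; split.
    move=> [e]; rewrite !inE => /or3P[] /eqP -> /= [t /= t01 <-]; rewrite -/(line _ _ t);
      rewrite /lA !lBl !lCl nl ?nA ?nB ?nC ?BA ?CA ?BB ?CB ?BC ?CC; (split; last by ring).
    - by constructor 3; split; slra.
    - by constructor 1; split; slra.
    - by constructor 2; split; slra.
  move=> [+ /planeE XE]; rewrite /on_sides /lA => -[[e0 b0 c0]|[b0 a0 c0]|[c0 a0 b0]].
  - exists (B, C); first by rewrite !inE eqxx orbT.
    exists (lC X); first by rewrite /=; slra.
    rewrite [RHS]XE /=; have -> : lB X = 1 - lC X by slra.
    by apply/rowP => i; rewrite !coordE; ring.
  - exists (C, A); first by rewrite !inE eqxx !orbT.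
    exists (1 - lC X); first by rewrite /=; slra.
    by rewrite [RHS]XE b0 /=; apply/rowP => i; rewrite !coordE; ring.
  - exists (A, B); first by rewrite !inE eqxx.
    exists (lB X); first by rewrite /=; slra.
    by rewrite [RHS]XE c0 /=; apply/rowP => i; rewrite !coordE; ring.
exists g, N; split=> //.
- have cB : continuous lB by exact: c_dot.
  have cC : continuous lC by exact: c_dot.
  apply: cts_min; last exact: cts_min.
  by apply: ctsB => //; apply: ctsB => //; exact: cst_continuous.
- move=> X t; rewrite dotDr !dotZr mulVf // mulr1; split=> //.
  by rewrite /g /lA /lB /lC !shift !(dotDr _ (X - A)) !dotZr um vm !mulr0 !addr0.
move=> p /car[/g_eq0 gp np].
pose cen := (1/3) *: (A + B + C).
have Bc : lB cen = 1/3.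
  have -> : cen = line A (line B C (1/2)) (2/3).
    by rewrite /cen /line; apply/rowP => i; rewrite !coordE; field.
  by rewrite lBl lBl BA BB BC; field.
have Cc : lC cen = 1/3.
  have -> : cen = line A (line B C (1/2)) (2/3).
    by rewrite /cen /line; apply/rowP => i; rewrite !coordE; field.
  by rewrite lCl lCl CA CB CC; field.
have nc : dot n cen = c by rewrite /cen dotZr !dotDr nA nB nC; field.
have pl t : p + t *: (cen - p) = line p cen t.
  by rewrite /line; apply/rowP => i; rewrite !coordE; ring.
exists (cen - p) => t; rewrite !pl nl np nc; split; first by ring.
move=> t01; rewrite /g /lA !lBl !lCl Bc Cc; exact: min3_center.
Qed.

End TrivialLink.

Section TrivialLinkColorable.
Variable R : realType.
Local Notation V := 'rV[R]_3.

Lemma trivial_link_colorable m (L : link R m.+2) :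
  is_trivial_link L -> colorable (carriers L).
Proof.
move=> [size3 [n n0 [c c_inj cE]]].
have wall (i : 'I_m.+2) : exists gN : (V -> R) * V, 
  [/\ continuous gN.1,
      forall X, carriers L i X <-> gN.1 X = 0 /\ dot n X = c i,
      forall X t, gN.1 (X + t *: gN.2) = gN.1 X /\ dot n (X + t *: gN.2) = dot n X + t &
      forall p, carriers L i p -> exists v, forall t,
        dot n (p + t *: v) = c i /\
        (0 < t <= 1 -> 0 < gN.1 (p + t *: v) /\ gN.1 (p + (- t) *: v) < 0)].
  have [knots _] := componentsP L; have := is_knot_simple (knots i).
  rewrite /carriers; have := size3 i; have := cE i.
  case: (tnth L i) => [|A [|B [|C [|]]]] // cEi _ /triangle_free ABC.
  have [|||g [N H]] := triangle_wall ABC n0 (c := c i);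
    try by apply: cEi; rewrite !inE eqxx ?orbT.
  by exists (g, N).
have [gN gNP] := choice wall.
pose g i := (gN i).1; pose h i X := dot n X - c i.
(* Only parities matter: the first wall carries x |-> -x and all others x |-> 1 - x. With at least
   two components [f] is not constant. *)
pose f (i : 'I_m.+2) := i != ord0.
pose r (i : 'I_m.+2) : dihedral := (true, Posz (f i)).
have h_cts i : continuous (h i).
  by apply: ctsB; [exact: dot_continuous|exact: cst_continuous].
have g_cts i : continuous (g i) by have [] := gNP i.
have rr i : (r i * r i = 1)%g by exact: dihedral_reflectionK.
have carE i X : carriers L i X <-> g i X = 0 /\ h i X = 0.
  have [_ -> _ _] := gNP i; rewrite /g /h; split=> -[-> e]; split=> //; lra.
exists f, (wall_system g h r); split.
- by exists ord0, ord_max.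
- move=> X LX.
  have [[i hi]|nh] := pselect (exists i, h i X = 0).
    apply: (wall_system_flat g_cts h_cts rr (i := i)).
      move=> j; apply: contraNneq; move: hi; rewrite /h => hi hj; apply/eqP/c_inj; lra.
    left; apply/eqP => gi; apply: LX; exists i; exact/carE.
  have nh' j : h j X != 0 by apply/eqP => hj; apply: nh; exists j.
  by apply: (wall_system_flat g_cts h_cts rr (i := ord0)) => //; right.
move=> i p Lp; have [_ _ vert dir] := gNP i; have [v hv] := dir p Lp.
have [gp hp] := (carE i p).1 Lp.
have ram (A : groupType) (chi : dihedral -> A) : {morph chi : x y / (x * y)%g} ->
    chi (r i) <> 1%g ->
    ramified (fun Y Z => chi (wall_system g h r Y Z)) (total (carriers L)) p.
  move=> chiM chir; apply: (wall_ramified h_cts rr chiM chir (v := v) (N := (gN i).2)).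
  - move=> j; apply: contraNneq; move: hp; rewrite /h => hi hj; apply/eqP/c_inj; lra.
  - by move=> X [j /carE Lj]; exists j.
  - by move=> t; rewrite /h (hv t).1 subrr.
  - by move=> t t01; exact: (hv t).2.
  - move=> X t; rewrite /h (vert X t).2; split; [exact: (vert X t).1|ring].
split; first by apply: ram => //; exact: is_reflectionM.
apply: ram; first exact: parityM.
by rewrite /parity /r /=; case: (f i).
Qed.

End TrivialLinkColorable.

(** * The Hopf link *)

Section HopfLink.
Variable R : realType.
Local Notation V := 'rV[R]_3.
Implicit Types (X Y Z : V).

(* The second component of the Hopf link projects injectively to the plane    *)
(* z = 0; it is the part over the boundary of the disc [disc > 0] of the      *)
(* graph of [height].                                                         *)
Definition disc_edge (y : R) := Num.min 4 (2 + `|y - 2|).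
Definition disc (x y : R) :=
  Num.min (Num.min (5 - x) (x - disc_edge y)) (Num.min (y + 1) (5 - y)).
(** y - 2 clamped to the interval of radius max 0 (4 - x) around 0. On the edge of the disc it takes
    the values -1 and 1 at the crossings (3, 1) and (3, 3). *)
Definition height (x y : R) :=
  Num.max (- Num.max 0 (4 - x)) (Num.min (Num.max 0 (4 - x)) (y - 2)).

Definition hopf_disc (i : 'I_1) X := disc (X 0 0) (X 0 1).
Definition hopf_height (i : 'I_1) X := X 0 2%:R - height (X 0 0) (X 0 1).

Lemma hopf_disc_continuous i : continuous (hopf_disc i).
Proof.
have c0 : continuous (fun X : V => X 0 0) by exact: coord_continuous.
have c1 : continuous (fun X : V => X 0 1) by exact: coord_continuous.
have cc (a : R) : continuous (fun _ : V => a) by exact: cst_continuous.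
apply: cts_min; apply: cts_min.
- exact: ctsB.
- apply: ctsB => //; apply: cts_min => //; apply: ctsD => //.
  by apply: cts_norm; exact: ctsB.
- exact: ctsD.
- exact: ctsB.
Qed.

Lemma hopf_height_continuous i : continuous (hopf_height i).
Proof.
have c0 : continuous (fun X : V => X 0 0) by exact: coord_continuous.
have c1 : continuous (fun X : V => X 0 1) by exact: coord_continuous.
have c2 : continuous (fun X : V => X 0 2%:R) by exact: coord_continuous.
have cc (a : R) : continuous (fun _ : V => a) by exact: cst_continuous.
have cM : continuous (fun X : V => Num.max 0 (4 - X 0 0)).
  by apply: cts_max => //; exact: ctsB.
apply: ctsB => //; apply: cts_max; first exact: ctsN.
by apply: cts_min => //; exact: ctsB.
Qed.

Definition point (x y z : R) : V := \row_k [:: x; y; z]`_k.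

Lemma pointE X x y z : X 0 0 = x -> X 0 1 = y -> X 0 2%:R = z -> X = point x y z.
Proof. by move=> <- <- <-; apply/rowP => k; rewrite mxE; case: (ord3P k) => ->. Qed.

Lemma point_coord x y z :
  [/\ point x y z 0 0 = x, point x y z 0 1 = y & point x y z 0 2%:R = z].
Proof. by rewrite !mxE. Qed.

Lemma line_point x y z x' y' z' t : line (point x y z) (point x' y' z') t =
  point ((1 - t) * x + t * x') ((1 - t) * y + t * y') ((1 - t) * z + t * z').
Proof. by apply: pointE; rewrite !mxE. Qed.

Lemma lattice_vec_point a b c :
  lattice_vec R (a, b, c) = point a%:~R b%:~R c%:~R.
Proof. by apply: pointE; rewrite mxE. Qed.

Definition hopf1 : seq lattice_point := nth [::] (braid_closure 2 [:: sigma 1; sigma 1]) 0.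
Definition hopf2 : seq lattice_point := nth [::] (braid_closure 2 [:: sigma 1; sigma 1]) 1.

Definition edges2 : seq (V * V) :=
  [:: (point 4 0 0, point 3 1 (-1)); (point 3 1 (-1), point 2 2 0);
      (point 2 2 0, point 3 3 1); (point 3 3 1, point 4 4 0);
      (point 4 4 0, point 4 5 0); (point 4 5 0, point 5 5 0);
      (point 5 5 0, point 5 (-1) 0); (point 5 (-1) 0, point 4 (-1) 0);
      (point 4 (-1) 0, point 4 0 0)].

Definition edges1 : seq (V * V) :=
  [:: (point 2 0 0, point 3 1 1); (point 3 1 1, point 4 2 0);
      (point 4 2 0, point 3 3 (-1)); (point 3 3 (-1), point 2 4 0);
      (point 2 4 0, point 2 6 0); (point 2 6 0, point 6 6 0);
      (point 6 6 0, point 6 (-2) 0); (point 6 (-2) 0, point 2 (-2) 0);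
      (point 2 (-2) 0, point 2 0 0)].

Lemma hopf1_edges : cyclic_edges (map (lattice_vec R) hopf1) = edges1.
Proof.
have -> : hopf1 = [:: (2,0,0); (3,1,1); (4,2,0); (3,3,-1); (2,4,0); (2,6,0); (6,6,0);
  (6,-2,0); (2,-2,0)] by vm_compute.
by rewrite /= !lattice_vec_point.
Qed.

Lemma hopf2_edges : cyclic_edges (map (lattice_vec R) hopf2) = edges2.
Proof.
have -> : hopf2 = [:: (4,0,0); (3,1,-1); (2,2,0); (3,3,1); (4,4,0); (4,5,0); (5,5,0);
  (5,-1,0); (4,-1,0)] by vm_compute.
by rewrite /= !lattice_vec_point.
Qed.

(** The branch curve is contained in the second component, which makes the system flat off it. The
    cases run through the nine edges. *)
Lemma hopf2_boundary X : hopf_disc ord0 X = 0 -> hopf_height ord0 X = 0 ->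
  exists2 e, e \in edges2 & segment e.1 e.2 X.
Proof.
rewrite /hopf_disc /hopf_height.
move: (@pointE X _ _ _ erefl erefl erefl); set x := X 0 0; set y := X 0 1; set z := X 0 2%:R.
move=> XE d0 /eqP; rewrite subr_eq0 => /eqP zE.
have on j a b c a' b' c' t : (j < 9)%N ->
    nth (0, 0) edges2 j = (point a b c, point a' b' c') -> 0 <= t <= 1 -> x = (1 - t) * a + t * a' -> y = (1 - t) * b + t * b' ->
    z = (1 - t) * c + t * c' -> exists2 e, e \in edges2 & segment e.1 e.2 X.
  move=> j9 he t01 ex ey ez; exists (point a b c, point a' b' c').
    by rewrite -he; exact: mem_nth.
  by exists t => //=; rewrite -[LHS]/(line _ _ t) line_point -ex -ey -ez XE.
set Q := (exists2 e : V * V, _ & _) in on *; clear XE; clearbody Q x y z.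
have z0 : 4 <= x -> z = 0.
  move=> x4; rewrite zE /height.
  have -> : Num.max 0 (4 - x) = 0 by rewrite max_l; slra.
  rewrite oppr0; case: (leP 0 (y - 2)) => h; first by rewrite maxxx.
  by rewrite max_l // ltW.
have [[x5 dx] [y1 y5]] : (x <= 5 /\ disc_edge y <= x) /\ (- 1 <= y /\ y <= 5).
  have : 0 <= disc x y by rewrite d0.
  rewrite /disc !le_min => /andP[/andP[h1 h2] /andP[h3 h4]]; split; split; slra.
have [x5'|nx5] := eqVneq x 5.
  apply: (on 6%N 5 5 0 5 (-1) 0 ((5 - y) / 6) erefl erefl); try slra; by rewrite z0; slra.
have e4 : (4 <= y \/ y <= 0) -> disc_edge y = 4.
  case=> h; rewrite /disc_edge; [rewrite ger0_norm|rewrite ler0_norm]; try slra.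
    by rewrite min_l; slra.
  by rewrite min_l; slra.
have [y1'|ny1] := eqVneq y (-1).
  have x4 : 4 <= x by rewrite -(e4 _) //; right; slra.
  apply: (on 7%N 5 (-1) 0 4 (-1) 0 (5 - x) erefl erefl); try slra; by rewrite z0; slra.
have [y5'|ny5] := eqVneq y 5.
  have x4 : 4 <= x by rewrite -(e4 _) //; left; slra.
  apply: (on 5%N 4 5 0 5 5 0 (x - 4) erefl erefl); try slra; by rewrite z0; slra.
have xlt : x < 5 by rewrite lt_neqAle nx5.
have ygt : - 1 < y by rewrite lt_neqAle eq_sym ny1.
have ylt : y < 5 by rewrite lt_neqAle ny5.
have xe : x = disc_edge y.
  apply/eqP; rewrite eq_le dx andbT leNgt; apply/negP => xd.
  have : 0 < disc x y; last by rewrite d0 ltxx.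
  by rewrite /disc !lt_min; apply/andP; split; apply/andP; split; slra.
have [y0|y0] := lerP y 0.
  have x4 : x = 4 by rewrite xe e4 //; right.
  apply: (on 8%N 4 (-1) 0 4 0 0 (y + 1) erefl erefl); try slra; by rewrite z0; slra.
have [y4|y4] := lerP 4 y.
  have x4 : x = 4 by rewrite xe e4 //; left.
  apply: (on 4%N 4 4 0 4 5 0 (y - 4) erefl erefl); try slra; by rewrite z0; slra.
have [y2|y2] := lerP y 2.
  have xy : x = 4 - y.
    by rewrite xe /disc_edge ler0_norm ?min_r; slra.
  have zy : z = Num.max (- y) (Num.min y (y - 2)).
    rewrite zE /height xy; have -> : Num.max 0 (4 - (4 - y)) = y by rewrite max_r; slra.
    by [].
  have [y1'|y1'] := lerP y 1.
    apply: (on 0%N 4 0 0 3 1 (-1) y erefl erefl); try slra; by rewrite zy min_r ?max_l; slra.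
  apply: (on 1%N 3 1 (-1) 2 2 0 (y - 1) erefl erefl); try slra; by rewrite zy min_r ?max_r; slra.
have xy : x = y.
  by rewrite xe /disc_edge ger0_norm ?min_r; slra.
have zy : z = Num.max (- (4 - y)) (Num.min (4 - y) (y - 2)).
  by rewrite zE /height xy; have -> : Num.max 0 (4 - y) = 4 - y by rewrite max_r; slra.
have [y3|y3] := lerP y 3.
  apply: (on 2%N 2 2 0 3 3 1 (y - 2) erefl erefl); try slra; by rewrite zy min_r ?max_r; slra.
apply: (on 3%N 3 3 1 4 4 0 (y - 3) erefl erefl); try slra; by rewrite zy min_l ?max_r; slra.
Qed.

End HopfLink.

Section HopfLinking.
Variable R : realType.
Local Notation V := 'rV[R]_3.

(** The first component crosses the wall exactly once, at its vertex (4, 2, 0): it arrives there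
    from above the disc, continues below it, and returns outside the disc. A section would be
    multiplied once by the nontrivial sign. *)
Lemma hopf_oddly_linked (L : link R 2) : is_hopf_link L -> oddly_linked (carriers L).
Proof.
move=> isL.
have comp P : P \in [:: hopf1; hopf2] -> exists i, tnth L i = map (lattice_vec R) P.
  move=> hP; have : map (lattice_vec R) P \in tval L.
    rewrite (perm_mem isL); apply/mapP; exists P => //.
  by move=> /tnthP[i ->]; exists i.
have [i Li] := comp hopf1 (mem_head _ _).
have [j Lj] := comp hopf2 (mem_last _ [:: hopf2]).
have iP X : carriers L i X <-> exists2 e, e \in edges1 R & segment e.1 e.2 X.
  by rewrite /carriers Li carrierP hopf1_edges.
have jP X : carriers L j X <-> exists2 e, e \in edges2 R & segment e.1 e.2 X.
  by rewrite /carriers Lj carrierP hopf2_edges.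
pose r (_ : 'I_1) : dihedral := (true, 0).
pose T := wall_system (@hopf_disc R) (@hopf_height R) r.
exists i, j, T; split.
- apply/eqP => ij; move: Li; rewrite ij Lj => /(congr1 (fun P : seq V => (head 0 P) 0 0)).
  have -> : hopf1 = (2, 0, 0) :: behead hopf1 by vm_compute.
  have -> : hopf2 = (4, 0, 0) :: behead hopf2 by vm_compute.
  rewrite /= !lattice_vec_point; have [-> _ _] := @point_coord R 2 0 0.
  by have [-> _ _] := @point_coord R 4 0 0; slra.
- move=> X LX; apply: (wall_system_flat (@hopf_disc_continuous R) (@hopf_height_continuous R) _ (i := ord0)).
  + by move=> k; exact: dihedral_reflectionK.
  + by move=> k; rewrite !ord1 eqxx.
  + case: eqVneq => [d0|]; [right|by left]; apply/eqP => h0; apply: LX; apply/jP.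
    exact: hopf2_boundary.
move=> [s sec].
pose sg Y Z : signs := is_reflection (T Y Z).
have sgE Y Z : sg Y Z = wall_crossed (@hopf_disc R) (@hopf_height R) ord0 Y Z.
  rewrite /sg /T (@wall_systemE _ _ _ _ _ ord0); last by move=> k; rewrite !ord1 eqxx.
  by case: wall_crossed.
have const A B : (A, B) \in edges1 R ->
    (forall t u : R, 0 <= t <= 1 -> 0 <= u <= 1 -> sg (line A B t) (line A B u) = false) ->
    s A = s B.
  move=> AB nocross; apply: segment_const => t t01.
  have onL u : 0 <= u <= 1 -> carriers L i (line A B u).
    by move=> u01; apply/iP; exists (A, B) => //; exact: segmentP.
  have [W WX sW] := sec _ (onL t t01); exists W => // u u01 Wu.
  rewrite (sW _ _ (nbhs_singleton WX) (onL t t01) Wu (onL u u01)).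
  by rewrite -/(sg _ _) nocross // mulg1.
have discE x y z : hopf_disc ord0 (point x y z : V) = disc x y.
  by rewrite /hopf_disc; have [-> ->] := point_coord x y z.
have heightE x y z : hopf_height ord0 (point x y z : V) = z - height x y.
  by rewrite /hopf_height; have [-> -> ->] := point_coord x y z.
have outside x y z x' y' z' : (point x y z, point x' y' z') \in edges1 R ->
    (forall t : R, 0 <= t <= 1 -> let a := (1 - t) * x + t * x' in
       let b := (1 - t) * y + t * y' in
       [\/ 5 <= a, a <= 4 /\ a <= 2 + `|b - 2|, 5 <= b | b <= -1]) ->
    s (point x y z) = s (point x' y' z').
  move=> he H; apply: const => // t u t01 u01; rewrite sgE /wall_crossed.
  rewrite line_point discE ltNge (_ : disc _ _ <= 0) //.
  rewrite /disc !ge_min; have := H t t01 => /=.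
  set a := (_ + _ * x'); set b := (_ + _ * y') => -[h|[h1 h2]|h|h].
  - by apply/orP; left; apply/orP; left; slra.
  - by apply/orP; left; apply/orP; right; rewrite subr_le0 /disc_edge le_min h1.
  - by apply/orP; right; apply/orP; right; slra.
  - by apply/orP; right; apply/orP; left; slra.
have nrm (b : R) : b - 2 <= `|b - 2| /\ 2 - b <= `|b - 2|.
  by split; [exact: ler_norm|rewrite -normrN opprB; exact: ler_norm].
have around : s (point 3 3 (-1)) = s (point 3 1 1).
  rewrite (outside _ _ _ 2 4 0); last 2 first.
  - by rewrite !inE eqxx ?orbT.
  - by move=> t t01 a b; constructor 2; have := nrm b; rewrite /a /b; slra.
  rewrite (outside _ _ _ 2 6 0); last 2 first.
  - by rewrite !inE eqxx ?orbT.
  - by move=> t t01 a b; constructor 2; have := nrm b; rewrite /a /b; slra.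
  rewrite (outside _ _ _ 6 6 0); last 2 first.
  - by rewrite !inE eqxx ?orbT.
  - by move=> t t01 a b; constructor 3; rewrite /b; slra.
  rewrite (outside _ _ _ 6 (-2) 0); last 2 first.
  - by rewrite !inE eqxx ?orbT.
  - by move=> t t01 a b; constructor 1; rewrite /a; slra.
  rewrite (outside _ _ _ 2 (-2) 0); last 2 first.
  - by rewrite !inE eqxx ?orbT.
  - by move=> t t01 a b; constructor 4; rewrite /b; slra.
  rewrite (outside _ _ _ 2 0 0); last 2 first.
  - by rewrite !inE eqxx ?orbT.
  - by move=> t t01 a b; constructor 2; have := nrm b; rewrite /a /b; slra.
  rewrite (outside _ _ _ 3 1 1) //.
  - by rewrite !inE eqxx ?orbT.
  - by move=> t t01 a b; constructor 2; have := nrm b; rewrite /a /b; slra.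
have below : s (point 4 2 0) = s (point 3 3 (-1)).
  apply: const => [|t u t01 u01]; first by rewrite !inE eqxx ?orbT.
  have hE (v : R) : 0 <= v <= 1 ->
      (0 < hopf_height ord0 (line (point 4 2 0) (point 3 3 (-1)) v)) = false.
    move=> v01; rewrite line_point heightE /height; apply/negbTE; rewrite -leNgt.
    have -> : 4 - ((1 - v) * 4 + v * 3) = v by ring.
    have -> : (1 - v) * 2 + v * 3 - 2 = v by ring.
    have -> : Num.max 0 v = v by rewrite max_r; slra.
    by rewrite minxx max_r; slra.
  by rewrite sgE /wall_crossed !hE // andbF.
have up1 (v : R) : 0 <= v <= 1 ->
    hopf_height ord0 (line (point 3 1 1) (point 4 2 0) v) = 2 * (1 - v).
  move=> v01; rewrite line_point heightE /height.
  have -> : 4 - ((1 - v) * 3 + v * 4) = 1 - v by ring.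
  have -> : (1 - v) * 1 + v * 2 - 2 = - (1 - v) by ring.
  have -> : Num.max 0 (1 - v) = 1 - v by rewrite max_r; slra.
  by rewrite min_r ?maxxx; [ring|slra].
have disc1 (v : R) : 0 <= v <= 1 ->
    0 < v -> 0 < hopf_disc ord0 (line (point 3 1 1 : V) (point 4 2 0) v).
  move=> v01 v0; rewrite line_point discE /disc !lt_min; apply/andP; split.
    apply/andP; split; first by slra.
    by rewrite subr_gt0 /disc_edge gt_min; apply/orP; right; rewrite ler0_norm; slra.
  by apply/andP; split; slra.
pose f X : signs := (s X * (0 < hopf_height ord0 X))%g.
have e1 : (point 3 1 1, point 4 2 0) \in edges1 R by rewrite !inE eqxx ?orbT.
have crossing : f (point 3 1 1) = f (point 4 2 0).
  apply: segment_const => t t01.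
  have onL u : 0 <= u <= 1 -> carriers L i (line (point 3 1 1) (point 4 2 0) u).
    by move=> u01; apply/iP; exists (point 3 1 1, point 4 2 0) => //; exact: segmentP.
  have [W WX sW] := sec _ (onL t t01).
  have stepE u : 0 <= u <= 1 -> W (line (point 3 1 1) (point 4 2 0) u) ->
      s (line (point 3 1 1) (point 4 2 0) u) =
      (s (line (point 3 1 1) (point 4 2 0) t) *
       sg (line (point 3 1 1) (point 4 2 0) t) (line (point 3 1 1) (point 4 2 0) u))%g.
    by move=> u01 Wu; rewrite (sW _ _ (nbhs_singleton WX) (onL t t01) Wu (onL u u01)).
  have [t0|t0] := ltrP 0 t.
    exists W => // u u01 Wu; rewrite /f stepE // sgE /wall_crossed disc1 //=.
    by case: (s _) (0 < _) (0 < _) => [] [] [].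
  (* The point (3, 1, 1) projects to the edge of the disc, where the sign of [disc] is not constant,
     but nearby the curve stays above the wall. *)
  have t00 : t = 0 by slra.
  exists (W `&` [set Y | 0 < hopf_height ord0 Y]).
    apply: filterI => //; apply: nbhs_pos; first exact: hopf_height_continuous.
    by rewrite up1 // t00; slra.
  move=> u u01 [Wu /= hu]; rewrite /f stepE // sgE /wall_crossed hu up1 // t00.
  have -> : (0 : R) < 2 * (1 - 0) by slra.
  by rewrite eqxx andbF mulg1.
move: crossing; rewrite /f below around.
have := up1 0; rewrite line0 => ->; last by slra.
have := up1 1; rewrite line1 => ->; last by slra.
have -> : (0 : R) < 2 * (1 - 0) by slra.
have -> : ((0 : R) < 2 * (1 - 1)) = false by apply/negbTE; rewrite -leNgt; slra.
by move=> /mulgI.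
Qed.

End HopfLinking.

(** * Linking numbers modulo 2 *)

Section PolygonSection.
Variable R : realType.
Local Notation V := 'rV[R]_3.
Variables (G : groupType) (chi : G -> signs) (K : set V) (T : V -> V -> G).
Hypothesis chiM : {morph chi : g h / (g * h)%g}.
Hypothesis Tflat : forall X, ~ K X -> flat_at T X.
Local Notation P := (transport T).

Lemma segment_convex (A B X Y Z W : V) : segment A B X -> segment A B Y -> segment A B Z ->
  triangle X Y Z W -> segment A B W.
Proof.
move=> [x /= x01 <-] [y /= y01 <-] [z /= z01 <-] [a [b [c [a0 b0 c0 abc ->]]]].
exists (a * x + b * y + c * z).
  have le1 (p q : R) : 0 <= p -> 0 <= q <= 1 -> 0 <= p * q <= p by nra.
  by have := le1 a x a0 x01; have := le1 b y b0 y01; have := le1 c z c0 z01; rewrite /=; lra.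
have -> : a = 1 - b - c by lra.
by apply/rowP => k; rewrite !coordE; ring.
Qed.

Lemma edge_section A B g : (forall X, segment A B X -> ~ K X) ->
  section_on (fun Y Z => chi (T Y Z)) (segment A B) (fun X => g * chi (P A X))%g.
Proof.
move=> off X sX; have [U UX PT] := transport_near Tflat (off X sX).
exists U => // Y Z UY sY UZ sZ; rewrite -mulgA -chiM -PT // (transportM Tflat) //.
by move=> W tW; apply: off; apply: segment_convex tW => //; exact: segmentl.
Qed.

(** A potential on the vertices extends along each edge by holonomy; the extensions agree at the
    vertices, the only points where distinct edges meet, and are pasted edge by edge. *)
Lemma polygon_section (Q : seq V) (S : V -> signs) : simple_polygon Q ->
  (forall X, carrier Q X -> ~ K X) ->
  (forall e, e \in cyclic_edges Q -> S e.2 = (S e.1 * chi (P e.1 e.2))%g) ->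
  exists s, section_on (fun Y Z => chi (T Y Z)) (carrier Q) s.
Proof.
move=> [uQ sQ] off SE; pose se (e : V * V) X := (S e.1 * chi (P e.1 X))%g.
have offe e X : e \in cyclic_edges Q -> segment e.1 e.2 X -> ~ K X.
  by move=> he eX; apply: off; apply/carrierP; exists e.
have ends e X : e \in cyclic_edges Q -> X \in [:: e.1; e.2] -> se e X = S X.
  move=> he; rewrite !inE => /orP[/eqP ->|/eqP ->]; last by rewrite /se SE.
  by rewrite /se (transport1 Tflat) ?(morph1 chiM) ?mulg1 //; exact: offe he (segmentl _ _).
have agree e e' X : e \in cyclic_edges Q -> e' \in cyclic_edges Q ->
    segment e.1 e.2 X -> segment e'.1 e'.2 X -> se e X = se e' X.
  move=> he he' eX eX'; have [-> //|[h h']] := sQ e e' X he he' eX eX'.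
  by rewrite (ends e) // (ends e').
have flat X : ~ K X -> flat_at (fun Y Z => chi (T Y Z)) X.
  by move=> /Tflat[U UX TU]; exists U => // y z w *; rewrite -chiM TU.
have H (es : seq (V * V)) : {subset es <= cyclic_edges Q} -> exists s,
    section_on (fun Y Z => chi (T Y Z)) [set X | exists2 e, e \in es & segment e.1 e.2 X] s /\
    forall e X, e \in es -> segment e.1 e.2 X -> s X = se e X.
  elim: es => [|e es IHes] sub; first by exists (fun _ => 1%g); split=> [X [e]|e X].
  have he : e \in cyclic_edges Q by apply: sub; rewrite inE eqxx.
  have [|s [sec sE]] := IHes; first by move=> e' h; apply: sub; rewrite inE h orbT.
  have subes e' : e' \in es -> e' \in cyclic_edges Q.
    by move=> h; apply: sub; rewrite inE h orbT.
  pose D := segment e.1 e.2; pose E := [set X | exists2 e, e \in es & segment e.1 e.2 X].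
  exists (fun X => if `[< D X >] then se e X else s X).
  have DE : [set X | exists2 e', e' \in e :: es & segment e'.1 e'.2 X] = D `|` E.
    apply/seteqP; split=> X.
      by move=> [e']; rewrite inE => /orP[/eqP ->|h] h'; [left|right; exists e'].
    by case=> [h|[e' h h']]; [exists e|exists e'] => //; rewrite inE ?eqxx ?h ?orbT.
  split.
    rewrite DE; apply: section_onU => //.
    - exact: segment_closed.
    - rewrite /E; elim: (es) => [|e' es' IH].
        have -> : [set X : V | exists2 e, e \in [::] & segment e.1 e.2 X] = set0.
          by apply/seteqP; split=> // X [].
        exact: closed0.
      have -> : [set X : V | exists2 e, e \in e' :: es' & segment e.1 e.2 X] =
          segment e'.1 e'.2 `|` [set X | exists2 e, e \in es' & segment e.1 e.2 X].
        apply/seteqP; split=> X.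
          by move=> [f]; rewrite inE => /orP[/eqP ->|h] h'; [left|right; exists f].
        by case=> [h|[f h h']]; [exists e'|exists f] => //; rewrite inE ?eqxx ?h ?orbT.
      by apply: closedU => //; exact: segment_closed.
    - move=> X [DX|[e' he' eX]]; apply: flat; first exact: offe he DX.
      exact: offe (subes e' he') eX.
    - by apply: edge_section => X; exact: offe.
    - move=> X DX [e' he' eX]; rewrite (sE e') //; apply: agree => //; exact: subes.
  move=> e' X; rewrite inE => /orP[/eqP ->|he'] eX.
    by case: asboolP.
  case: asboolP => [DX|_]; last exact: sE.
  by apply: agree => //; exact: subes.
have [//|s [sec _]] := H (cyclic_edges Q).
exists s; apply: section_onS sec => X /carrierP[e he eX]; by exists e.
Qed.

(** The potential is the partial sum along the polygon from its first vertex. *)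
Lemma cyclic_potential (Q : seq V) (w : V * V -> bool) : uniq Q ->
  \big[addb/false]_(e <- cyclic_edges Q) w e = false ->
  exists S : V -> bool, forall e, e \in cyclic_edges Q -> S e.2 = S e.1 (+) w e.
Proof.
move=> uQ tot; exists (fun v => \big[addb/false]_(e <- take (index v Q) (cyclic_edges Q)) w e).
move=> e /(cyclic_edgesP 0)[i si ->] /=.
have sz := size_cyclic_edges Q.
rewrite (index_uniq _ si uQ).
have tS : \big[addb/false]_(e <- take i.+1 (cyclic_edges Q)) w e =
    (\big[addb/false]_(e <- take i (cyclic_edges Q)) w e) (+) w (Q`_i, Q`_(i.+1 %% size Q)).
  rewrite (take_nth (0, 0)) ?sz // big_rcons /= nth_cyclic_edges //.
rewrite -tS; have [iS|iS] := ltnP i.+1 (size Q).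
  by rewrite modn_small // index_uniq.
(* The last edge returns to the first vertex, where the empty partial sum has to agree with the
   total. *)
have -> : i.+1 = size Q by apply/eqP; rewrite eqn_leq si iS.
rewrite modnn index_uniq //; last by case: (Q) si.
by rewrite take0 big_nil take_oversize ?sz.
Qed.

End PolygonSection.

(** * Chains modulo 2 *)

Section Chains.
Local Open Scope Z_scope.

Definition zltb (a b : zpoint) :=
  (a.1.1 <? b.1.1) || ((a.1.1 =? b.1.1) && ((a.1.2 <? b.1.2) ||
    ((a.1.2 =? b.1.2) && (a.2 <? b.2)))).

End Chains.

Section Homology.
Variables (F E : seq zedge) (ts : seq (zpoint * zpoint * zpoint)).

(* A normal form of undirected edges, which keeps the edges of [F] unchanged. *)
Definition orient (e : zedge) : zedge :=
  if e \in F then e else if swap e \in F then swap e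
  else if zltb e.1 e.2 then e else swap e.

Definition boundary (t : zpoint * zpoint * zpoint) : seq zedge :=
  let: (a, b, c) := t in [:: (a, b); (b, c); (a, c)].

(* [F] is the boundary modulo 2 of the chain [ts], which misses [E].          *)
Definition bounds :=
  all (fun t => misses E t.1.1 t.1.2 t.2) ts &&
  (let M := F ++ map orient (flatten (map boundary ts)) in
   all (fun e => ~~ odd (count_mem e M)) M).

Lemma even_sum (X : eqType) (w : X -> bool) (M : seq X) :
  all (fun e => ~~ odd (count_mem e M)) M -> \big[addb/false]_(e <- M) w e = false.
Proof.
have iter_even n b : ~~ odd n -> iter n (addb b) false = false.
  rewrite -{2}(odd_double_half n) => /negPf ->; rewrite add0n.
  by elim: n./2 => // k IHk; rewrite doubleS /= IHk addbF addbb.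
move=> /allP ev; rewrite -big_undup_iterop_count big_seq big1 // => e.
rewrite mem_undup => /ev /iter_even; rewrite Monoid.iteropE; exact.
Qed.

Variables (R : realType) (T : 'rV[R]_3 -> 'rV[R]_3 -> dihedral).
Hypothesis Tflat : forall X, ~ tube E X -> flat_at T X.
Let u (e : zedge) : bool := is_reflection (transport T (vec R e.1) (vec R e.2)).

(** Stokes modulo 2: in [F] together with the boundaries of the triangles each edge occurs an even
    number of times, and the holonomy around each triangle is trivial. *)
Lemma bounds_even : bounds -> \big[addb/false]_(e <- F) u e = false.
Proof.
move=> /andP[/allP ts_miss /even_sum-/(_ u)]; rewrite big_cat /=.
suff -> : \big[addb/false]_(e <- map orient (flatten (map boundary ts))) u e = false.
  by rewrite addbF.
rewrite big_map big_flatten /= big_map big_seq big1 // => -[[a b] c] /ts_miss /= abc.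
(* The inverse of a sign is itself, so edges may be oriented freely. *)
have uswap x y : (forall X, segment (vec R x) (vec R y) X -> ~ tube E X) ->
    u (orient (x, y)) = u (x, y).
  move=> off; have uV : u (y, x) = u (x, y).
    by rewrite /u /= (transportV Tflat off) (morphV is_reflectionM).
  by rewrite /orient !(fun_if u) uV !if_same.
have off := missesP (R := R) abc.
rewrite !big_cons big_nil !uswap.
- rewrite /u /= -(missesM Tflat abc) is_reflectionM addbF.
  by case: is_reflection; case: is_reflection.
- by move=> X [t /= t01 <-]; apply: off; exists (1 - t), 0, t; split; [lra|by []|lra|lra|rewrite scale0r addr0].
- by move=> X [t /= t01 <-]; apply: off; exists 0, (1 - t), t; split; [by []|lra|lra|lra|rewrite scale0r add0r].
- by move=> X [t /= t01 <-]; apply: off; exists (1 - t), t, 0; split; [lra|lra|by []|lra|rewrite scale0r addr0].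
Qed.

End Homology.

Section EvenLinking.
Variables (R : realType) (m n : nat) (w : braid_word) (L : link R m).

(** An even total sign along component i yields a potential on its vertices, hence a section over
    all of it. *)
Lemma bounds_not_oddly_linked :
  (forall k l, (k < m)%N -> (l < m)%N -> k != l ->
     exists ts, bounds (closure_edges n w k) (closure_edges n w l) ts) ->
  is_closure_of n w L -> ~ oddly_linked (carriers L).
Proof.
move=> bnd closureL [i [j [T [ij Tflat]]]]; apply.
have [s [sP LE]] := closure_vertices closureL.
have ss : size s = m by rewrite (perm_size sP) size_iota.
have us : uniq s by rewrite (perm_uniq sP) iota_uniq.
have sm (i' : 'I_m) : (nth 0%N s i' < m)%N.
  have : nth 0%N s i' \in iota 0 m by rewrite -(perm_mem sP) mem_nth ?ss.
  by rewrite mem_iota.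
have sij : nth 0%N s i != nth 0%N s j by rewrite nth_uniq ?ss.
set k := nth 0%N s i in sij; set l := nth 0%N s j in sij.
have [ts bts] := bnd k l (sm i) (sm j) sij.
have Cj : carriers L j = tube (R := R) (closure_edges n w l).
  by rewrite /carriers LE; apply/seteqP; split=> X /lattice_carrierP.
rewrite Cj in Tflat; have := bounds_even Tflat bts.
have [knots disj] := componentsP L.
have Qe : cyclic_edges (tnth L i) =
    [seq (vec R e.1, vec R e.2) | e <- closure_edges n w k].
  rewrite LE -/k /closure_edges /zedges !map_cyclic_edges -map_comp.
  by apply: eq_map => e /=; rewrite !lattice_vecE.
have sQ := is_knot_simple (knots i).
pose u (e : 'rV[R]_3 * 'rV[R]_3) : bool := is_reflection (transport T e.1 e.2).
rewrite -(big_map (fun e => (vec R e.1, vec R e.2)) xpredT u) -Qe.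
move=> /(cyclic_potential sQ.1)[S SE].
apply: (polygon_section (S := S) is_reflectionM Tflat sQ _ SE) => X iX jX.
have : set0 X by rewrite -(disj i j ij) -[carrier (tnth L j)]/(carriers L j) Cj; split.
by [].
Qed.

End EvenLinking.

Section WhiteheadChains.
Local Open Scope Z_scope.

(* Each arc of the component is coned from above or from below, so as to      *)
(* avoid the other component; the last triangles match the boundaries.        *)
Definition whitehead_chain0 : seq (zpoint * zpoint * zpoint) :=
  let o := (13, 11, 40) in let u := (13, 11, -40) in
  [::
   ((4, 12, 0), (4, 16, 0), o); ((4, 16, 0), (4, 20, 0), o); ((4, 20, 0), (4, 26, 0), o);
   ((4, 26, 0), o, (18, 26, 0)); (o, (18, -6, 0), (18, 26, 0));
   ((4, -6, 0), o, (18, -6, 0)); ((4, -6, 0), (4, 0, 0), o); ((4, 0, 0), (6, 2, 2), o);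
   ((6, 2, 2), (8, 4, 0), o); ((8, 4, 0), (10, 6, -2), o); ((10, 6, -2), (12, 8, 0), o);
   ((12, 8, 0), (12, 12, 0), o); ((10, 14, 2), (12, 12, 0), o);
   ((8, 16, 0), (10, 14, 2), o); ((12, 0, 0), (12, 4, 0), u); ((10, 6, 2), (12, 4, 0), u);
   ((8, 8, 0), (10, 6, 2), u); ((6, 10, -2), (8, 8, 0), u); ((4, 12, 0), (6, 10, -2), u);
   ((8, 16, 0), (10, 18, -2), u); ((10, 18, -2), (12, 20, 0), u);
   ((12, 20, 0), (12, 22, 0), u); ((12, 22, 0), u, (14, 22, 0));
   (u, (14, -2, 0), (14, 22, 0)); ((12, -2, 0), u, (14, -2, 0));
   ((12, -2, 0), (12, 0, 0), u); ((4, 12, 0), (8, 16, 0), o); ((4, 12, 0), (8, 16, 0), u)].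

Definition whitehead_chain1 : seq (zpoint * zpoint * zpoint) :=
  let o := (13, 11, 40) in let u := (13, 11, -40) in
[::
   ((4, 4, 0), (4, 8, 0), o); ((4, 8, 0), (6, 10, 2), o); ((8, 20, 0), (10, 18, 2), o);
   ((8, 20, 0), (8, 24, 0), o); ((8, 24, 0), o, (16, 24, 0));
   (o, (16, -4, 0), (16, 24, 0)); ((8, -4, 0), o, (16, -4, 0));
   ((6, 2, -2), (8, 0, 0), u); ((4, 4, 0), (6, 2, -2), u); ((6, 10, 2), (8, 12, 0), u);
   ((8, 12, 0), (10, 14, -2), u); ((10, 14, -2), (12, 16, 0), u);
   ((10, 18, 2), (12, 16, 0), u); ((8, -4, 0), (8, 0, 0), u); ((4, 4, 0), (6, 4, 0), u);
   ((4, 4, 0), (6, 8, 0), o); ((6, 10, 2), (10, 8, 0), o); ((6, 10, 2), (10, 8, 0), u);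
   ((8, -4, 0), (10, 4, 0), o); ((8, -4, 0), (10, 4, 0), u); ((6, 4, 0), (10, 8, 0), u);
   ((6, 8, 0), (10, 4, 0), o); ((10, 4, 0), (12, 6, 0), u); ((10, 8, 0), (12, 6, 0), o);
   ((10, 18, 2), u, o); ((12, 6, 0), u, o); ((4, 4, 0), (6, 4, 0), (12, 6, 0));
   ((4, 4, 0), (6, 8, 0), (12, 6, 0)); ((6, 4, 0), (10, 8, 0), (12, 6, 0));
   ((6, 8, 0), (10, 4, 0), (12, 6, 0))].

End WhiteheadChains.

Section WhiteheadLinking.
Variables (R : realType) (L : link R 2).

Lemma whitehead_not_oddly_linked : is_whitehead_link L -> ~ oddly_linked (carriers L).
Proof.
apply: bounds_not_oddly_linked => -[|[|k]] [|[|l]] // _ _ _.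
  by exists whitehead_chain0; vm_compute.
by exists whitehead_chain1; vm_compute.
Qed.

End WhiteheadLinking.

Local Close Scope ring_scope.

Theorem theorem2p2 (R : realType) :
  (forall H T W : link R 2,
     is_hopf_link H -> is_trivial_link T -> is_whitehead_link W ->
     [/\ ~ isotopic H T, ~ isotopic H W & ~ isotopic T W]) /\
  (forall B T : link R 3,
     is_borromean_link B -> is_trivial_link T -> ~ isotopic B T).
Proof.
split=> [H T W hH hT hW|B T hB hT].
  have cT := trivial_link_colorable hT.
  split=> /isotopic_homeomorphic h.
  - exact: hopf_not_colorable hH (colorable_homeomorphic (homeomorphic_sym h) cT).
  - exact: whitehead_not_oddly_linked hW (oddly_linked_homeomorphic h (hopf_oddly_linked hH)).
  - exact: whitehead_not_colorable hW (colorable_homeomorphic h cT).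
move=> /isotopic_homeomorphic h.
have cT := colorable_homeomorphic (homeomorphic_sym h) (trivial_link_colorable hT).
exact: borromean_not_colorable hB cT.
Qed.
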